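(* Let $(M,\xi,J)$ be a closed spherical $CR$ $3$-manifold. Suppose $\hat\theta$ is a contact form on $M$ which together with $J$ defines a positive pseudohermitian structure with vanishing torsion and positive Tanaka-Webster curvature. Let $\theta_{(t)}$, $t\in[0,t_{\max})$, be a smooth solution of the (unnormalized) Yamabe flow $\partial_t\theta_{(t)}=-2W_{(t)}\theta_{(t)}$ with $\theta_{(0)}=\hat\theta$, where $W_{(t)}$ is the Tanaka-Webster curvature of $(J,\theta_{(t)})$. Then for every $t\in(0,t_{\max})$ and every Legendrian vector field $\eta$ one has, at every point of $M$, $$Z(\theta_{(t)},\eta)\ \ge\ 0,$$ where $$Z(\theta_{(t)},\eta)=2\Delta_bW+W^2+\frac{W}{t}+\langle\nabla_bW,\eta\rangle_{J,\theta}+\frac18\,W\,|\eta|^2_{J,\theta},$$ with $W=W_{(t)}$ and $\nabla_b$, $\Delta_b$, $\langle\cdot,\cdot\rangle_{J,\theta}$, $|\cdot|_{J,\theta}$ taken with respect to $(J,\theta_{(t)})$.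
   Context: Closed means compact without boundary. $M$ is a smooth $3$-manifold with an oriented contact structure $\xi\subset TM$; $J:\xi\to\xi$ is a smooth endomorphism with $J^2=-\mathrm{id}$ (a $CR$ structure compatible with $\xi$). $J$ is spherical if $(M,\xi,J)$ is locally $CR$ equivalent to the standard sphere $S^3\subset\mathbb C^2$ (equivalently, its Cartan curvature tensor vanishes). A pseudohermitian structure $(J,\theta)$ is $J$ together with a global contact form $\theta$ for $\xi$. $T$ is the characteristic vector field: $\theta(T)=1$, $d\theta(T,\cdot)=0$. Choose (locally) a complex vector field $Z_1$ in $\xi\otimes\mathbb C$ with $JZ_1=iZ_1$, put $Z_{\bar1}=\overline{Z_1}$, and let $\{\theta,\theta^1,\theta^{\bar1}\}$ be the coframe dual to $\{T,Z_1,Z_{\bar1}\}$; then $d\theta=ih_{1\bar1}\theta^1\wedge\theta^{\bar1}$ with $h_{1\bar1}$ real and nonzero. $(J,\theta)$ is positive if $h_{1\bar1}>0$, and then $Z_1$ is chosen so that $h_{1\bar1}=1$, i.e. $d\theta=i\theta^1\wedge\theta^{\bar1}$. The connection form $\omega_1{}^1$ and the torsion $A^1{}_{\bar1}$ are determined by $d\theta^1=\theta^1\wedge\omega_1{}^1+A^1{}_{\bar1}\theta\wedge\theta^{\bar1}$ and $\omega_1{}^1+\omega_{\bar1}{}^{\bar1}=0$, where $\omega_{\bar1}{}^{\bar1}=\overline{\omega_1{}^1}$; $A_{\bar1\bar1}=A^1{}_{\bar1}$ and $A_{11}=\overline{A_{\bar1\bar1}}$. The Tanaka-Webster curvature $W$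 is the real function defined by $d\omega_1{}^1=W\theta^1\wedge\theta^{\bar1}+2i\,\mathrm{Im}(A_{11,\bar1}\theta^1\wedge\theta)$. Covariant derivatives of a function $f$: $f_{,1}=Z_1f$, $f_{,\bar1}=Z_{\bar1}f$, $f_{,1\bar1}=Z_{\bar1}Z_1f-\omega_1{}^1(Z_{\bar1})Z_1f$, $f_{,\bar11}=Z_1Z_{\bar1}f-\omega_{\bar1}{}^{\bar1}(Z_1)Z_{\bar1}f$. Subgradient: $\nabla_bf=f_{,\bar1}Z_1+f_{,1}Z_{\bar1}$. Sublaplacian: $\Delta_bf=f_{,1\bar1}+f_{,\bar11}$. Levi form: for $V=v_1Z_{\bar1}+v_{\bar1}Z_1$, $U=u_1Z_{\bar1}+u_{\bar1}Z_1$ in $\xi$, $\langle V,U\rangle_{J,\theta}=v_1u_{\bar1}+v_{\bar1}u_1$, and $|V|^2_{J,\theta}=\langle V,V\rangle_{J,\theta}$. These do not depend on the choice of $Z_1$. A Legendrian vector field is a real vector field on $M$ lying in $\xi$ at each point. *)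

(* Defs.v *)
(* MathComp world: smooth 3-manifolds and pseudohermitian geometry over an
   arbitrary R : realType.

   Tangent vectors are complexified throughout: an element of T_pM (x) C is a
   C-linear derivation at p of the complex-valued functions that are smooth
   near p, and a real tangent vector is one commuting with conjugation.       *)
From HB Require Import structures.
From mathcomp Require Import all_boot all_order all_algebra.
From mathcomp Require Import all_classical all_reals all_analysis.
From mathcomp Require Import complex.

Set Implicit Arguments.
Unset Strict Implicit.
Unset Printing Implicit Defensive.

Import Order.TTheory GRing.Theory Num.Theory.
Import numFieldNormedType.Exports.

Local Open Scope classical_set_scope.
Local Open Scope ring_scope.

(* On an open set U: continuous, with partial derivatives of class C^(k-1).
   Only the values of f on U matter.                                          *)
Fixpoint class_C (R : realType) (n k : nat) (U : set 'rV[R]_n)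
    (f : 'rV[R]_n -> R) : Prop :=
  (forall x, U x -> {for x, continuous f}) /\
  (if k is k'.+1 then
     forall i : 'I_n,
       (forall x, U x -> derivable f x (delta_mx 0 i)) /\
       class_C k' U (fun x => 'D_(delta_mx 0 i) f x)
   else True).

Definition smooth_on (R : realType) (n : nat) (U : set 'rV[R]_n)
    (f : 'rV[R]_n -> R) : Prop := forall k, class_C k U f.

Record chart (R : realType) (M : topologicalType) := Chart {
  chart_dom : set M;
  chart_map : M -> 'rV[R]_3;
  chart_inv : 'rV[R]_3 -> M;
  chart_dom_open : open chart_dom;
  chart_img_open : open (chart_map @` chart_dom);
  chart_mapK : forall p, chart_dom p -> chart_inv (chart_map p) = p;
  chart_map_cont : forall p, chart_dom p -> {for p, continuous chart_map};
  chart_inv_cont : forall x, (chart_map @` chart_dom) x ->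
    {for x, continuous chart_inv} }.

Definition smooth_atlas (R : realType) (M : topologicalType)
    (A : set (chart R M)) : Prop :=
  (forall p, exists2 c, A c & chart_dom c p) /\
  (forall c d, A c -> A d -> forall j : 'I_3,
     smooth_on (chart_map c @` (chart_dom c `&` chart_dom d))
       (fun x => chart_map d (chart_inv c x) 0 j)).

Record manifold3 (R : realType) := Manifold3 {
  carrier :> topologicalType;
  atlas : set (chart R carrier);
  atlas_smooth : smooth_atlas atlas;
  carrier_hausdorff : hausdorff_space carrier;
  carrier_second_countable : @second_countable carrier }.

Arguments atlas {R} m _.

Definition closed_manifold (R : realType) (M : manifold3 R) : Prop :=
  compact [set: M].

Section Manifold.
Variables (R : realType) (M : manifold3 R).
Local Notation C := R[i].

Definition smooth_at (p : M) (f : M -> R) : Prop :=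
  exists c, [/\ atlas M c, chart_dom c p &
    exists2 V, open_nbhs (chart_map c p) V & smooth_on V (f \o chart_inv c)].

Definition csmooth_at (p : M) (f : M -> C) : Prop :=
  smooth_at p (fun q => complex.Re (f q)) /\
  smooth_at p (fun q => complex.Im (f q)).

(* Smoothness of a time-dependent function on [0, tmax) x N in the sense of
   manifolds with boundary: local extendability to a smooth function on an open
   subset of R x R^3.                                                         *)
Definition smooth_in_time (tmax : \bar R) (N : set M) (g : R -> M -> R) : Prop :=
  forall t0 p, 0 <= t0 -> (t0%:E < tmax)%E -> N p ->
  exists c, [/\ atlas M c, chart_dom c p &
    exists (V : set 'rV[R]_(1 + 3)) (G : 'rV[R]_(1 + 3) -> R),
      [/\ open_nbhs (row_mx (const_mx t0) (chart_map c p)) V,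
          smooth_on V G &
          forall (t : R) (x : 'rV[R]_3), 0 <= t -> V (row_mx (const_mx t) x) ->
            G (row_mx (const_mx t) x) = g t (chart_inv c x)]].

(* a u + v, for functions as well as for tangent vectors. *)
Definition lcomb (D : Type) (a : C) (u v : D -> C) : D -> C :=
  fun x => a * u x + v x.

Definition tvec : Type := (M -> C) -> C.

(* The value on functions not smooth near p is normalised to 0, so that two
   tangent vectors are equal as soon as they agree on smooth germs.           *)
Definition tangent (p : M) (v : tvec) : Prop :=
  [/\ forall f, ~ csmooth_at p f -> v f = 0,
      forall a f g, csmooth_at p f -> csmooth_at p g ->
        v (lcomb a f g) = a * v f + v g
    & forall f g, csmooth_at p f -> csmooth_at p g ->
        v (fun q => f q * g q) = v f * g p + f p * v g].

Definition vconj (v : tvec) : tvec := fun f => (v (fun q => (f q)^*))^*.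

Definition real_tangent (p : M) (v : tvec) : Prop := tangent p v /\ vconj v = v.

Definition vfield (U : set M) (X : M -> tvec) : Prop :=
  forall p, U p -> tangent p (X p) /\
    forall f, csmooth_at p f -> csmooth_at p (fun q => X q f).

Definition fconj (X : M -> tvec) : M -> tvec := fun p => vconj (X p).

Definition bracket (X Y : M -> tvec) : M -> tvec := fun p f =>
  if `[< csmooth_at p f >] then X p (fun q => Y q f) - Y p (fun q => X q f)
  else 0.

Definition form1 : Type := M -> tvec -> C.
Definition form2 : Type := (M -> tvec) -> (M -> tvec) -> M -> C.

Definition is_form1 (U : set M) (a : form1) : Prop :=
  (forall p, U p -> forall k v w, tangent p v -> tangent p w ->
     a p (lcomb k v w) = k * a p v + a p w) /\
  (forall N X, open N -> N `<=` U -> vfield N X ->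
     forall p, N p -> csmooth_at p (fun q => a q (X q))).

Definition conj1 (a : form1) : form1 := fun p v => (a p (vconj v))^*.

Definition real_form1 (U : set M) (a : form1) : Prop :=
  forall p, U p -> forall v, tangent p v -> conj1 a p v = a p v.

Definition ext_d (a : form1) : form2 := fun X Y p =>
  X p (fun q => a q (Y q)) - Y p (fun q => a q (X q)) - a p (bracket X Y p).

Definition wedge (a b : form1) : form2 := fun X Y p =>
  a p (X p) * b p (Y p) - a p (Y p) * b p (X p).

Definition wedge12 (a : form1) (b : form2) (X Y Z : M -> tvec) (p : M) : C :=
  a p (X p) * b Y Z p + a p (Y p) * b Z X p + a p (Z p) * b X Y p.

Definition conj2 (b : form2) : form2 := fun X Y p =>
  (b (fconj X) (fconj Y) p)^*.

Definition eq_form2 (U : set M) (a b : form2) : Prop :=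
  forall X Y, vfield U X -> vfield U Y -> forall p, U p -> a X Y p = b X Y p.

(* A plane field is given by its real tangent vectors. *)
Definition contact_form (U : set M) (xi : M -> tvec -> Prop) (th : form1) : Prop :=
  [/\ is_form1 U th, real_form1 U th,
      forall p, U p -> forall v, xi p v <-> real_tangent p v /\ th p v = 0
    & forall p, U p -> exists X Y Z,
        [/\ vfield U X, vfield U Y, vfield U Z
          & wedge12 th (ext_d th) X Y Z p != 0]].

(* No separate orientation datum: below, a compatible J orients xi by the bases
   (v, J v), and a global contact form co-orients it.                         *)
Definition contact_structure (xi : M -> tvec -> Prop) : Prop :=
  forall p, exists U th, [/\ open U, U p & contact_form U xi th].

(* xi (x) C *)
Definition complexified (xi : M -> tvec -> Prop) (p : M) (v : tvec) : Prop :=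
  exists u w, [/\ xi p u, xi p w & v = lcomb 'i w u].

(* J stands for the C-linear extension to xi (x) C; its values elsewhere are
   irrelevant.                                                                *)
Definition cr_structure (xi : M -> tvec -> Prop) (J : M -> tvec -> tvec) : Prop :=
  [/\ forall p v, xi p v -> xi p (J p v),
      forall p v, xi p v -> J p (J p v) = (fun f => - v f),
      forall p k v w, complexified xi p v -> complexified xi p w ->
        J p (lcomb k v w) = lcomb k (J p v) (J p w)
    & forall N X, open N -> vfield N X ->
        (forall p, N p -> complexified xi p (X p)) ->
        vfield N (fun p => J p (X p))].

(* Near each point, F = (F1, F2) is a diffeomorphism of an open set U onto an
   open subset of S^3 in C^2 (an injective immersion between 3-manifolds) whose
   differential v |-> (v F1, v F2) maps xi into the complex tangent line
   { w | w1 conj(z1) + w2 conj(z2) = 0 } of S^3 at z = F(p) and intertwines J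
   with multiplication by i.                                                  *)
Definition spherical (xi : M -> tvec -> Prop) (J : M -> tvec -> tvec) : Prop :=
  forall p0, exists (U : set M) (F1 F2 : M -> C),
    [/\ open U, U p0 &
    [/\ forall p, U p -> csmooth_at p F1 /\ csmooth_at p F2,
        forall p, U p -> F1 p * (F1 p)^* + F2 p * (F2 p)^* = 1,
        forall p q, U p -> U q -> F1 p = F1 q -> F2 p = F2 q -> p = q,
        forall p v, U p -> real_tangent p v -> v F1 = 0 -> v F2 = 0 ->
          v = (fun=> 0)
      & forall p v, U p -> xi p v ->
          [/\ v F1 * (F1 p)^* + v F2 * (F2 p)^* = 0,
              J p v F1 = 'i * v F1 & J p v F2 = 'i * v F2]]].

Definition characteristic_field (U : set M) (th : form1) (T : M -> tvec) : Prop :=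
  [/\ vfield U T, forall p, U p -> vconj (T p) = T p,
      forall p, U p -> th p (T p) = 1
    & forall X, vfield U X -> forall p, U p -> ext_d th T X p = 0].

(* {th, th1, conj th1} is dual to {T, Z1, conj Z1}, and J Z1 = i Z1. *)
Definition adapted_coframe (xi : M -> tvec -> Prop) (J : M -> tvec -> tvec)
    (th : form1) (U : set M) (T Z1 : M -> tvec) (th1 : form1) : Prop :=
  [/\ characteristic_field U th T,
      vfield U Z1,
      forall p, U p -> complexified xi p (Z1 p) /\
        J p (Z1 p) = (fun f => 'i * Z1 p f),
      is_form1 U th1
    & forall p, U p ->
        [/\ th1 p (T p) = 0, th1 p (Z1 p) = 1 & th1 p (vconj (Z1 p)) = 0]].

(* d th = i h th1 /\ conj th1 *)
Definition levi_coefficient (th : form1) (U : set M) (th1 : form1) (h : M -> R)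
    : Prop :=
  eq_form2 U (ext_d th)
    (fun X Y p => 'i * (h p)%:C%C * wedge th1 (conj1 th1) X Y p).

(* The sign of h does not depend on the local choice of Z1. *)
Definition positive_pseudohermitian (xi : M -> tvec -> Prop)
    (J : M -> tvec -> tvec) (th : form1) : Prop :=
  contact_form setT xi th /\
  forall p, exists U T Z1 th1 h,
    [/\ open U, U p, adapted_coframe xi J th U T Z1 th1,
        levi_coefficient th U th1 h & forall q, U q -> 0 < h q].

(* A local choice of Z1 with h = 1, with the data it determines; tors is
   A^1_{\bar 1} = A_{\bar 1 \bar 1}. For positive (J, th) such frames exist near
   every point and any two differ by a unitary function, so invariants are
   specified below by their expression in all of them.                        *)
Record frame := Frame {
  fdom : set M;
  charT : M -> tvec;
  Z1 : M -> tvec;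
  th1 : form1;
  omega : form1;
  tors : M -> C }.

Definition unitary_frame (xi : M -> tvec -> Prop) (J : M -> tvec -> tvec)
    (th : form1) (F : frame) : Prop :=
  let U := fdom F in
  [/\ open U, adapted_coframe xi J th U (charT F) (Z1 F) (th1 F),
      levi_coefficient th U (th1 F) (fun=> 1) &
  [/\ is_form1 U (omega F), forall p, U p -> csmooth_at p (tors F),
      eq_form2 U (ext_d (th1 F)) (fun X Y p =>
        wedge (th1 F) (omega F) X Y p +
        tors F p * wedge th (conj1 (th1 F)) X Y p)
    & forall p, U p -> forall v, tangent p v ->
        omega F p v + conj1 (omega F) p v = 0]].

Definition vanishing_torsion (xi : M -> tvec -> Prop) (J : M -> tvec -> tvec)
    (th : form1) : Prop :=
  forall F, unitary_frame xi J th F -> forall p, fdom F p -> tors F p = 0.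

(* A_11 = conj A_{\bar 1 \bar 1} and its covariant derivative
   A_{11,\bar 1} = Z_{\bar 1} A_11 - 2 omega_1^1(Z_{\bar 1}) A_11.             *)
Definition A11 (F : frame) : M -> C := fun p => (tors F p)^*.

Definition A11_1b (F : frame) : M -> C := fun p =>
  fconj (Z1 F) p (A11 F) - 2%:R * omega F p (fconj (Z1 F) p) * A11 F p.

(* d omega = W th1 /\ conj th1 + 2i Im b with b = A_{11,\bar 1} th1 /\ th, where
   2i Im b = b - conj b.                                                      *)
Definition webster_curvature (xi : M -> tvec -> Prop) (J : M -> tvec -> tvec)
    (th : form1) (W : M -> R) : Prop :=
  forall F, unitary_frame xi J th F ->
  let b : form2 := fun X Y p => A11_1b F p * wedge (th1 F) th X Y p in
  eq_form2 (fdom F) (ext_d (omega F)) (fun X Y p =>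
    (W p)%:C%C * wedge (th1 F) (conj1 (th1 F)) X Y p
    + (b X Y p - conj2 b X Y p)).

(* f_{,1}, f_{,\bar 1}, f_{,1 \bar 1} and f_{,\bar 1 1} *)
Definition d1 (F : frame) (f : M -> C) : M -> C := fun p => Z1 F p f.
Definition d1b (F : frame) (f : M -> C) : M -> C := fun p => fconj (Z1 F) p f.

Definition d11b (F : frame) (f : M -> C) : M -> C := fun p =>
  d1b F (d1 F f) p - omega F p (fconj (Z1 F) p) * d1 F f p.

Definition d1b1 (F : frame) (f : M -> C) : M -> C := fun p =>
  d1 F (d1b F f) p - conj1 (omega F) p (Z1 F p) * d1b F f p.

Definition subgradient (F : frame) (f : M -> C) : M -> tvec := fun p g =>
  d1b F f p * Z1 F p g + d1 F f p * fconj (Z1 F) p g.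

Definition sublaplacian (F : frame) (f : M -> C) : M -> C := fun p =>
  d11b F f p + d1b1 F f p.

(* For V = v_1 Z_{\bar 1} + v_{\bar 1} Z_1 in xi, v_{\bar 1} = th1(V) and
   v_1 = (conj th1)(V).                                                       *)
Definition levi_form (F : frame) (p : M) (V U : tvec) : C :=
  conj1 (th1 F) p V * th1 F p U + th1 F p V * conj1 (th1 F) p U.

Definition legendrian (xi : M -> tvec -> Prop) (eta : M -> tvec) : Prop :=
  vfield setT eta /\ forall p, xi p (eta p).

(* t is the time, W the curvature of (J, theta_(t)), F a unitary frame for it. *)
Definition harnack (F : frame) (W : M -> R) (t : R) (eta : M -> tvec) (p : M) : C :=
  let Wc : M -> C := fun q => (W q)%:C%C in
  2%:R * sublaplacian F Wc p + Wc p ^+ 2 + Wc p / t%:C%C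
  + levi_form F p (subgradient F Wc p) (eta p)
  + 8%:R^-1 * Wc p * levi_form F p (eta p) (eta p).

(* The right-hand side is -2 W theta_(t). The derivative in t is two-sided for
   t > 0 and one-sided at t = 0; real forms take real values on real vectors.  *)
Definition yamabe_flow (xi : M -> tvec -> Prop) (J : M -> tvec -> tvec)
    (tmax : \bar R) (th : R -> form1) (W : R -> M -> R) : Prop :=
  [/\ forall t, 0 <= t -> (t%:E < tmax)%E ->
        positive_pseudohermitian xi J (th t) /\
        webster_curvature xi J (th t) (W t),
      forall N X, open N -> vfield N X ->
        (forall p, N p -> vconj (X p) = X p) ->
        smooth_in_time tmax N (fun t p => complex.Re (th t p (X p)))
    & forall t p v, 0 <= t -> (t%:E < tmax)%E -> real_tangent p v ->
        (fun s : R => (s - t)^-1 *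
           (complex.Re (th s p v) - complex.Re (th t p v)))
          @ within [set s | 0 <= s] t^'
          --> - 2%:R * W t p * complex.Re (th t p v)].

End Manifold.

(* Main.v *)
(* The flow through [that] is explicit, and the inequality is read off from it.

   Write hats for [that], and [theta_t = theta_hat / u].  Vanishing torsion and
   sphericity give W_hat_{,11} = 0 and T W_hat = 0 (differentiate the CR map to
   S^3, its components being annihilated by Z_{\bar 1}, and use
   s = 1 / sum |Z F_j|^2), so that Lap W_hat + W_hat^2 and
   6 |Z W_hat|^2 - 3 (Lap W_hat + W_hat^2) W_hat + W_hat^3 are locally constant.
   On the compact open set K where they take their values at the given point,
   |Z W_hat|^2 is a cubic polynomial in W_hat whose relevant roots are the extreme
   values of W_hat, and the equation
     u_t = 4 u Lap u - 12 |Z u|^2 + 2 W_hat u^2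
   preserves functions a + b W_hat with constant coefficients: it becomes an ODE
   for (a, b), solved by quadratures.  The maximum principle on K shows that the
   given solution is this one.  Then W_t is a Moebius function of W_hat, so that
   Lap_t W_t and |Z_t W_t|^2 are again polynomials in W_t; minimizing over eta
   leaves W/t - W^2/3 - 2 d/(3 W) >= 0, which follows from t (max W - min W) <= 3/2
   for the extreme values of W_t on K. *)
From HB Require Import structures.
Require Import Defs.
From mathcomp Require Import all_boot all_order all_algebra.
From mathcomp Require Import all_classical all_reals all_analysis.
From mathcomp Require Import complex.
From mathcomp Require Import ring lra.

Set Implicit Arguments.
Unset Strict Implicit.
Unset Printing Implicit Defensive.

Import Order.TTheory GRing.Theory Num.Theory.
Import numFieldNormedType.Exports.
Local Open Scope classical_set_scope.
Local Open Scope ring_scope.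

(** * Functions of class C^k *)

(** A tangent vector is a bare derivation of germs, and [class_C] speaks of partial derivatives
    only. Hadamard's lemma is the bridge: it gives the chain rule, the components of vectors in a
    chart and the second-order conditions at an extremum. The tensor calculus is moved to
    commutative rings with three derivations: the smooth functions on an open set, extended by zero,
    form such a ring, and each identity follows from the structure equations by [ring]. The
    torsion-free structure equations are available for [that] alone, so computations take place in
    its frames, and the frames of [th t], of arbitrary torsion, enter by comparison. As M may be
    disconnected, the invariants are constant only near each point; hence the level set K. The cubic
    has roots of sum 0, and the parameters [k], [l] of the explicit solution are the distances from
    the negative root to the other two. The quadratures do not show that the time [tau] reaches t:
    if it did not, the values of u at the extremes of W_hat, whose product grows without bound with
    s, would contradict the boundedness of u on [0, t] x K. *)

Section ClassC.
Context {R : realType} {n : nat}.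
Implicit Types (U V : set 'rV[R]_n) (f g : 'rV[R]_n -> R) (k : nat).
Local Notation e_ i := (delta_mx 0 i : 'rV[R]_n).

Lemma class_C_continuous k U f : class_C k U f ->
  forall x, U x -> {for x, continuous f}.
Proof. by case: k => [|k] []. Qed.

Lemma class_CS k U f : class_C k.+1 U f -> class_C k U f.
Proof.
elim: k f => [|k IH] f; first by case.
case=> fc fd; split=> // i; have [? ?] := fd i; split=> //; exact: IH.
Qed.

Lemma class_C_sub k U V f : V `<=` U -> class_C k U f -> class_C k V f.
Proof.
move=> VU; elim: k f => [|k IH] f [fc fd]; split=> //.
- by move=> x /VU; exact: fc.
- by move=> x /VU; exact: fc.
- by move=> i; have [fd1 fd2] := fd i; split; [move=> x /VU; exact: fd1|exact: IH].
Qed.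

Lemma open_near_eq U f g : open U -> (forall x, U x -> f x = g x) ->
  forall x, U x -> \forall y \near x, f y = g y.
Proof.
move=> oU fg x Ux; have := open_nbhs_nbhs (conj oU Ux).
by apply: filterS => y; exact: fg.
Qed.

Lemma continuous_near_eq f g x : {near x, f =1 g} ->
  {for x, continuous f} -> {for x, continuous g}.
Proof.
move=> fg; rewrite /prop_for /continuous_at.
rewrite -(nbhs_singleton fg) => fx.
exact: (cvg_trans (near_eq_cvg fg) fx).
Qed.

Lemma class_C_eq k U f g : open U -> (forall x, U x -> f x = g x) ->
  class_C k U f -> class_C k U g.
Proof.
move=> oU; elim: k f g => [|k IH] f g fg [fc fd].
  split=> // x Ux; apply: continuous_near_eq (fc _ Ux); exact: (open_near_eq oU fg Ux).
split=> [x Ux|i].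
  by apply: continuous_near_eq (fc _ Ux); exact: (open_near_eq oU fg Ux).
have [fd1 fd2] := fd i; split=> [x Ux|].
  by apply: near_eq_derivable (fd1 _ Ux); exact: (open_near_eq oU fg Ux).
apply: IH fd2 => x Ux; apply: near_eq_derive; exact: (open_near_eq oU fg Ux).
Qed.

Lemma class_C_cst k U (c : R) : open U -> class_C k U (fun=> c).
Proof.
move=> oU; elim: k c => [|k IH] c; split=> //; try (by move=> x _; exact: cst_continuous).
move=> i; split; first by move=> x _; exact: derivable_cst.
apply: class_C_eq (IH 0) => // x _.
by rewrite -[RHS]/('D_(e_ i) (cst c) x) derive_cst.
Qed.

Lemma class_CD k U f g : open U -> class_C k U f -> class_C k U g ->
  class_C k U (fun x => f x + g x).
Proof.
move=> oU; elim: k f g => [|k IH] f g [fc fd] [gc gd].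
  by split=> // x Ux; apply: continuousD; [exact: fc|exact: gc].
split=> [x Ux|i]; first by apply: continuousD; [exact: fc|exact: gc].
have [fd1 fd2] := fd i; have [gd1 gd2] := gd i; split=> [x Ux|].
  by apply: derivableD; [exact: fd1|exact: gd1].
apply: class_C_eq (IH _ _ fd2 gd2) => // x Ux.
by rewrite -[RHS]/('D_(e_ i) (f + g) x) deriveD; [|exact: fd1|exact: gd1].
Qed.

Lemma class_CM k U f g : open U -> class_C k U f -> class_C k U g ->
  class_C k U (fun x => f x * g x).
Proof.
move=> oU; elim: k f g => [|k IH] f g fC gC; have [fc fd] := fC; have [gc gd] := gC.
  by split=> // x Ux; apply: continuousM; [exact: fc|exact: gc].
split=> [x Ux|i]; first by apply: continuousM; [exact: fc|exact: gc].
have [fd1 fd2] := fd i; have [gd1 gd2] := gd i; split=> [x Ux|].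
  by apply: derivableM; [exact: fd1|exact: gd1].
have := class_CD oU (IH _ _ (class_CS fC) gd2) (IH _ _ (class_CS gC) fd2).
apply: class_C_eq => // x Ux.
by rewrite -[RHS]/('D_(e_ i) (f * g) x) deriveM; [|exact: fd1|exact: gd1].
Qed.

Lemma class_CZ k U (c : R) f : open U -> class_C k U f ->
  class_C k U (fun x => c * f x).
Proof. by move=> oU; apply: class_CM => //; exact: class_C_cst. Qed.

Lemma class_C_sum k U (m : nat) (f : 'I_m -> 'rV[R]_n -> R) : open U ->
  (forall j, class_C k U (f j)) -> class_C k U (fun x => \sum_j f j x).
Proof.
move=> oU; elim: m f => [|m IH] f fC.
  apply: class_C_eq (class_C_cst k 0 oU) => // x _; by rewrite big_ord0.
apply: class_C_eq (class_CD oU (IH (fun j => f (widen_ord (leqnSn m) j)) _) (fC ord_max)) => //.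
by move=> x _; rewrite big_ord_recr.
Qed.

Lemma class_C_coord k U (j : 'I_n) : open U -> class_C k U (fun x => x 0 j).
Proof.
move=> oU; have co x : {for x, continuous (fun x : 'rV[R]_n => x 0 j)}.
  exact: coord_continuous.
have dd i (x : 'rV[R]_n) : is_derive x (e_ i) (fun x : 'rV[R]_n => x 0 j) (i == j)%:R.
  apply: DeriveDef.
    have := @derivable_id _ 'rV[R]_n x (e_ i).
    by move/derivable_mxP => /(_ 0 j).
  have := @derive_mx _ _ _ _ (fun x : 'rV[R]_n => x) x (e_ i) (@derivable_id _ 'rV[R]_n x (e_ i)).
  rewrite derive_id => /matrixP/(_ 0 j); rewrite !mxE eqxx /= => <-.
  by rewrite eq_sym.
case: k => [|k]; split=> // i; split=> [x _|]; first by case: (dd i x).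
apply: class_C_eq (class_C_cst k (i == j)%:R oU) => // x _.
by rewrite derive_val.
Qed.

Lemma class_CV k U f : open U -> (forall x, U x -> f x != 0) ->
  class_C k U f -> class_C k U (fun x => (f x)^-1).
Proof.
move=> oU f0; elim: k f f0 => [|k IH] f f0 fC; have [fc fd] := fC.
  by split=> // x Ux; apply: continuousV; [exact: f0|exact: fc].
split=> [x Ux|i]; first by apply: continuousV; [exact: f0|exact: fc].
have [fd1 fd2] := fd i; split=> [x Ux|].
  by apply: derivableV; [exact: f0|exact: fd1].
have IV := IH _ f0 (class_CS fC).
have := class_CZ (-1) oU (class_CM oU (class_CM oU IV IV) fd2).
apply: class_C_eq => // x Ux.
rewrite -[RHS]/('D_(e_ i) (fun y => (f y)^-1) x) deriveV; [|exact: f0|exact: fd1].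
by rewrite expr2 invfM /GRing.scale/= mulN1r mulNr.
Qed.

(** Directional derivatives become derivatives in one real variable, where a chain rule is at
    hand. *)
Lemma is_derive_line (V : normedModType R) (x v : V) (f : V -> R) (l : R) :
  is_derive x v f l <-> is_derive (0 : R) 1 (fun h : R => f (h *: v + x)) l.
Proof.
have E : (fun h : R => h^-1 *: ((f \o shift x) (h *: v) - f x)) =
   (fun h : R => h^-1 *: (((fun h : R => f (h *: v + x)) \o shift 0) (h *: 1) - f (0 *: v + x))).
  by apply/funext => h /=; rewrite addr0 scale0r add0r /GRing.scale /= mulr1.
have D : derivable f x v <-> derivable (fun h : R => f (h *: v + x)) 0 1.
  by rewrite /derivable E.
have Ve : 'D_v f x = 'D_1 (fun h : R => f (h *: v + x)) 0 by rewrite /derive E.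
split=> -[d val].
  by split; [exact: (D.1 d)| rewrite -Ve].
by split; [exact: (D.2 d) | rewrite Ve].
Qed.

Lemma is_derive_compl (x v : 'rV[R]_n) f (phi : R -> R) (l c : R) :
  is_derive x v f l -> is_derive (f x) 1 phi c ->
  is_derive x v (fun y => phi (f y)) (c * l).
Proof.
move=> /is_derive_line dfl dphi; apply/is_derive_line.
apply: (@is_derive1_comp _ phi (fun h : R => f (h *: v + x))).
by rewrite scale0r add0r; exact: dphi.
Qed.

Lemma class_C_sqrt k U f : open U -> (forall x, U x -> 0 < f x) ->
  class_C k U f -> class_C k U (fun x => Num.sqrt (f x)).
Proof.
move=> oU f0; have cs x : U x -> {for x, continuous f} ->
    {for x, continuous (fun y => Num.sqrt (f y))}.
  move=> Ux fx; apply: (@continuous_comp _ _ _ f (@Num.sqrt R)) => //.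
  exact: sqrt_continuous.
elim: k f f0 cs => [|k IH] f f0 cs fC; have [fc fd] := fC.
  by split=> // x Ux; apply: cs => //; exact: fc.
split=> [x Ux|i]; first by apply: cs => //; exact: fc.
have [fd1 fd2] := fd i.
have D x : U x -> is_derive x (e_ i) (fun y => Num.sqrt (f y))
    ((2 * Num.sqrt (f x))^-1 * 'D_(e_ i) f x).
  move=> Ux; apply: is_derive_compl; last exact: is_derive1_sqrt (f0 _ Ux).
  by split => //; exact: fd1.
split=> [x Ux|]; first by case: (D x Ux).
have := class_CM oU (class_CV oU _ (class_CZ 2 oU (IH _ f0 cs (class_CS fC)))) fd2.
move=> H; apply: class_C_eq (H _) => // x Ux.
  by case: (D x Ux) => _ ->.
by rewrite mulf_neq0 // lt0r_neq0 // sqrtr_gt0 f0.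
Qed.

End ClassC.

(** * Integrals over [0, 1] depending on a parameter *)

Section ParamIntegral.
Context {R : realType}.
Local Notation mu := (@lebesgue_measure R).
Local Notation I01 := (`[0, 1]%classic : set R).

Lemma integrable01 (h : R -> R) : {within I01, continuous h} ->
  mu.-integrable I01 (EFin \o h).
Proof. by apply: continuous_compact_integrable; exact: segment_compact. Qed.

Lemma Rintegral01_cst (c : R) : \int[mu]_(s in I01) c = c.
Proof.
rewrite (Rintegral_cst mu) //= lebesgue_measure_itv /= lte_fin ltr01 /=.
by rewrite oppr0 addr0 mulr1.
Qed.

(** Compactness of [0, 1] turns joint continuity at the points [(t0, s)] into convergence uniform in
    [s]. *)
Lemma continuous_Rintegral01 (T : topologicalType) (t0 : T) (g : T -> R -> R) :
  (forall s, I01 s -> {for (t0, s), continuous (fun z : T * R => g z.1 z.2)}) ->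
  (\forall t \near t0, {within I01, continuous (g t)}) ->
  (fun t => \int[mu]_(s in I01) g t s) @ t0 --> \int[mu]_(s in I01) g t0 s.
Proof.
move=> gc gw; apply/cvgrPdist_le => e e0.
have /compact_near_coveringP := @segment_compact R 0 1.
move=> /(_ T (nbhs t0) (fun t s => `|g t0 s - g t s| <= e) _) H.
have e20 : 0 < e / 2 by rewrite divr_gt0.
have {}H : \forall t \near t0, I01 `<=` (fun s => `|g t0 s - g t s| <= e).
  apply: H => s s01; have /cvgrPdist_le/(_ _ e20) := gc _ s01.
  move=> [[/= P Q] [P0 Q0] PQ]; exists (Q, P) => //= -[s' t] [/= Qs Pt].
  have h1 := PQ (t, s') (conj Pt Qs).
  have h2 := PQ (t0, s') (conj (nbhs_singleton P0) Qs).
  rewrite /= in h1 h2.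
  rewrite (splitr e) (le_trans (ler_distD (g t0 s) _ _))// lerD//.
  by rewrite distrC.
have w0 := nbhs_singleton gw.
near=> t.
have wt : {within I01, continuous (g t)} by near: t.
have Ht : I01 `<=` (fun s => `|g t0 s - g t s| <= e) by near: t.
have wd : {within I01, continuous (fun s => g t0 s - g t s)}.
  by move=> s; apply: continuousB; [exact: w0|exact: wt].
have wn : {within I01, continuous (fun s => `|g t0 s - g t s|)}.
  move=> s; apply: (@continuous_comp (subspace I01) R R (fun s => g t0 s - g t s) Num.norm).
    exact: wd.
  exact: norm_continuous.
rewrite -RintegralB //; try exact: integrable01.
apply: (le_trans (le_normr_Rintegral _ _)) => //; first exact: integrable01.
apply: (@le_trans _ _ (\int[mu]_(s in I01) e)).
  apply: le_Rintegral => //; try exact: integrable01.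
  by apply: integrable01; apply: continuous_subspaceT => x; exact: cst_continuous.
by rewrite Rintegral01_cst.
Unshelve. all: by end_near. Qed.

End ParamIntegral.

(** * Topology of row vectors *)

Section RowTopology.
Context {R : realType} {n : nat}.

Lemma ball_rV (x y : 'rV[R]_n) (e : R) :
  ball x e y <-> 0 < e /\ forall j, `|x 0 j - y 0 j| < e.
Proof.
split=> [[e0 H]|[e0 H]]; split=> //; first by move=> j; exact: (H 0 j).
by move=> i j; rewrite ord1; exact: (H j).
Qed.

Lemma cvg_rV (T : Type) (F : set_system T) (FF : Filter F) (f : T -> 'rV[R]_n)
    (l : 'rV[R]_n) :
  (forall j, (fun t => f t 0 j) @ F --> l 0 j) -> f @ F --> l.
Proof.
move=> H; apply/cvg_ballP => e e0.
have : \forall t \near F, forall j : 'I_n, `|l 0 j - f t 0 j| < e.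
  apply: filter_forall => j.
  by have /cvgrPdist_lt := H j; exact.
by apply: filterS => t Ht; apply/ball_rV.
Qed.

Lemma compact_box (p : 'rV[R]_n) (r : R) :
  compact [set y : 'rV[R]_n | forall j, `|p 0 j - y 0 j| <= r].
Proof.
have := @rV_compact R n (fun j => `[p 0 j - r, p 0 j + r]%classic) (fun j => @segment_compact R _ _).
congr compact; apply/funext => y /=; apply/propext; split=> H j; have := H j;
  by rewrite /= in_itv /= ler_distlC.
Qed.

End RowTopology.

(** * Hadamard's lemma *)

Section Seg.
Context {R : realType} {n : nat}.
Local Notation e_ i := (delta_mx 0 i : 'rV[R]_n).
Local Notation mu := (@lebesgue_measure R).
Local Notation I01 := (`[0, 1]%classic : set R).

(** Only one coordinate is contracted towards [p]. The fundamental theorem of calculus along [s]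
    then involves a single partial derivative; contracting all coordinates at once would need the
    chain rule, which is itself deduced from Hadamard's lemma below. *)
Definition seg (p : 'rV[R]_n) (j : 'I_n) (s : R) (y : 'rV[R]_n) : 'rV[R]_n :=
  \row_k (if k == j then p 0 j + s * (y 0 j - p 0 j) else y 0 k).

Lemma seg_ball p j s y e : I01 s -> ball p e y -> ball p e (seg p j s y).
Proof.
rewrite /= in_itv /= => /andP[s0 s1] /ball_rV[e0 H]; apply/ball_rV; split=> // k.
rewrite mxE; case: eqP => [->|_]; last exact: H.
apply: le_lt_trans (H j).
rewrite opprD addrA subrr add0r normrN normrM ger0_norm // [leRHS]distrC.
by rewrite ler_piMl.
Qed.

Lemma seg_shift p j s (h : R) (i : 'I_n) y : seg p j s (h *: e_ i + y) =
  (h * (if i == j then s else 1)) *: e_ i + seg p j s y.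
Proof.
apply/rowP => k; rewrite !mxE eqxx /=; case: (eqVneq k j) => [->|kj].
  rewrite eq_sym; case: (eqVneq i j) => _ /=; ring.
case: (eqVneq k i) => [ki|_]; last by rewrite /= !mulr0.
by rewrite -ki (negPf kj) /=; ring.
Qed.

Lemma seg_continuous p j (s : R) (y : 'rV[R]_n) :
  {for (y, s), continuous (fun z : 'rV[R]_n * R => seg p j z.2 z.1)}.
Proof.
apply: cvg_rV => k.
have c1 i : (fun z : 'rV[R]_n * R => z.1 0 i) @ (y, s) --> y 0 i.
  apply: (@cvg_comp _ _ _ fst (fun y : 'rV[R]_n => y 0 i) _ (nbhs y)).
    exact: cvg_fst.
  exact: coord_continuous.
have -> : (fun z : 'rV[R]_n * R => seg p j z.2 z.1 0 k) =
   (fun z => if k == j then p 0 j + z.2 * (z.1 0 j - p 0 j) else z.1 0 k).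
  by apply/funext => z; rewrite mxE.
rewrite mxE; case: eqP => _; last exact: c1.
apply: cvgD; first exact: cvg_cst.
apply: cvgM; first exact: cvg_snd.
by apply: cvgB; [exact: c1|exact: cvg_cst].
Qed.

Lemma seg1 p j y : seg p j 1 y = y.
Proof. by apply/rowP => k; rewrite !mxE mul1r; case: eqP => [->|//]; ring. Qed.

Lemma is_derive_seg p j s (f : 'rV[R]_n -> R) (i : 'I_n) y :
  derivable f (seg p j s y) (e_ i) ->
  is_derive y (e_ i) (fun y => f (seg p j s y))
    ((if i == j then s else 1) * 'D_(e_ i) f (seg p j s y)).
Proof.
set c := if _ then _ else _ => fd; apply: (iffRL (is_derive_line _ (e_ i) _ _)).
have -> : (fun h : R => f (seg p j s (h *: e_ i + y))) =
  (fun h : R => f (h *: e_ i + seg p j s y)) \o (fun h => h * c).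
  by apply/funext => h /=; rewrite seg_shift.
rewrite mulrC.
apply: (@is_derive1_comp _ (fun h : R => f (h *: e_ i + seg p j s y)) (fun h => h * c)).
  rewrite mul0r; apply: (iffLR (is_derive_line _ (e_ i) f _)); exact: DeriveDef.
have -> : *%R^~ c = c \*: (id : R -> R) by apply/funext => h /=; rewrite mulrC.
by apply: is_derive_eq; rewrite /GRing.scale /= mulr1.
Qed.

(** The weight makes the family stable under derivation: each derivative in the direction [j] brings
    out one more factor [s]. *)
Definition segint (m : nat) p j (f : 'rV[R]_n -> R) (y : 'rV[R]_n) : R :=
  \int[mu]_(s in I01) (s ^+ m * f (seg p j s y)).

End Seg.

Section Segint.
Context {R : realType} {n : nat}.
Local Notation e_ i := (delta_mx 0 i : 'rV[R]_n).
Local Notation mu := (@lebesgue_measure R).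
Local Notation I01 := (`[0, 1]%classic : set R).
Variables (p : 'rV[R]_n) (e : R).
Local Notation B := (ball p e).

Lemma seg_continuous2 (j : 'I_n) m (f : 'rV[R]_n -> R) y s :
  (forall x, B x -> {for x, continuous f}) -> B y -> I01 s ->
  {for (y, s), continuous (fun z : 'rV[R]_n * R => z.2 ^+ m * f (seg p j z.2 z.1))}.
Proof.
move=> fc By s01; apply: continuousM.
  apply: (@continuous_comp _ _ _ snd (fun s : R => s ^+ m)); first exact: cvg_snd.
  exact: exprn_continuous.
apply: (@continuous_comp _ _ _ (fun z : 'rV[R]_n * R => seg p j z.2 z.1) f).
  exact: seg_continuous.
by apply: fc; exact: seg_ball.
Qed.

Lemma seg_within (j : 'I_n) m (f : 'rV[R]_n -> R) y :
  (forall x, B x -> {for x, continuous f}) -> B y ->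
  {within I01, continuous (fun s => s ^+ m * f (seg p j s y))}.
Proof.
move=> fc By; apply: continuous_in_subspaceT => s /[!inE] s01.
apply: (@continuous_comp _ _ _ (fun s : R => (y, s))
  (fun z : 'rV[R]_n * R => z.2 ^+ m * f (seg p j z.2 z.1))).
  have cy : (fun=> y) @ s --> y by exact: cvg_cst.
  have cs : (fun s : R => s) @ s --> s by exact: cvg_id.
  exact: (cvg_pair cy cs).
exact: seg_continuous2.
Qed.

Lemma segint_continuous (j : 'I_n) m (f : 'rV[R]_n -> R) y :
  (forall x, B x -> {for x, continuous f}) -> B y ->
  {for y, continuous (segint m p j f)}.
Proof.
move=> fc By; apply: continuous_Rintegral01 => [s s01|].
  exact: (seg_continuous2 fc By s01).
have := open_nbhs_nbhs (conj (ball_open p _) By).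
by apply: filterS => z Bz; exact: seg_within.
Qed.

Lemma coord_le_norm (x : 'rV[R]_n) j : `|x 0 j| <= `|x|.
Proof.
by rewrite [leRHS]/Num.Def.normr /= mx_normrE; apply/bigmax_geP; right; exists (0, j).
Qed.

Lemma segint_derive (j i : 'I_n) m (f : 'rV[R]_n -> R) y :
  class_C 1 B f -> B y ->
  is_derive y (e_ i) (segint m p j f)
    (segint (m + (i == j)) p j (fun x => 'D_(e_ i) f x) y).
Proof.
move=> fC By; have [fc /(_ i)[fd [fdc _]]] := fC.
have e0 : 0 < e by case: By.
(* Domination: for [|h| < d] the points stay in the closed box [K] of radius [r < e], a compact
   subset of the ball, on which the partial derivative is bounded by a constant [M]. *)
pose r := (`|p - y| + e) / 2; pose d := r - `|p - y|.
have pye : `|p - y| < e by move: (By); rewrite -ball_normE.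
have d0 : 0 < d by rewrite /d /r; lra.
have re : r < e by rewrite /r; lra.
pose K := [set x : 'rV[R]_n | forall j, `|p 0 j - x 0 j| <= r].
have KB : K `<=` B by move=> x Kx; apply/ball_rV; split=> // k; exact: le_lt_trans (Kx k) re.
have [M M0 HM] : exists2 M, 0 <= M & forall x, K x -> `|'D_(e_ i) f x| <= M.
  have Kp : K p by move=> k; rewrite subrr normr0 /r divr_ge0 // addr_ge0 // ltW.
  have Kc : {within K, continuous (fun x => `|'D_(e_ i) f x|)}.
    apply: continuous_in_subspaceT => x /[!inE] /KB Bx.
    apply: (@continuous_comp _ _ _ (fun x => 'D_(e_ i) f x) Num.norm).
      exact: fdc.
    exact: norm_continuous.
  have [c _ Hc] := compact_EVT_max (ex_intro _ p Kp) (@compact_box R n p r) Kc.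
  by exists `|'D_(e_ i) f c| => // x Kx; apply: Hc; rewrite inE.
pose F (h s : R) := s ^+ m * f (seg p j s (h *: e_ i + y)).
pose c (s : R) := if i == j then s else 1.
have BH h : `]-d, d[%classic h -> K (h *: e_ i + y).
  rewrite /= in_itv /= -ltr_norml => hd k; rewrite !mxE eqxx /= opprD addrCA.
  rewrite (le_trans (ler_normD _ _)) // normrN normrM.
  have h1 : `|p 0 k - y 0 k| <= `|p - y| by have := coord_le_norm (p - y) k; rewrite !mxE.
  have h2 : `|h| * `|(k == i)%:R| <= `|h|.
    by case: (k == i); rewrite ?normr1 ?normr0 ?mulr1 ?mulr0.
  by rewrite /d in hd; lra.
have segK s x : I01 s -> K x -> K (seg p j s x).
  rewrite /= in_itv /= => /andP[s0 s1] Kx k; rewrite mxE; case: eqP => [->|_]; last exact: Kx.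
  rewrite opprD addrA subrr add0r normrN normrM ger0_norm // [X in _ * X]distrC.
  by apply: le_trans (Kx j); rewrite ler_piMl.
have DF h s : `]-d, d[%classic h -> I01 s ->
    is_derive h 1 (F ^~ s) (s ^+ m * (c s * 'D_(e_ i) f (seg p j s (h *: e_ i + y)))).
  move=> hd s01.
  have : is_derive (h *: e_ i + y) (e_ i) (fun x => f (seg p j s x))
     (c s * 'D_(e_ i) f (seg p j s (h *: e_ i + y))).
    apply: is_derive_seg; apply: fd; apply: KB; apply: segK => //; exact: BH.
  move=> /(iffLR (is_derive_line _ (e_ i) _ _)) H.
  have {}H : is_derive h 1 (fun h' => f (seg p j s (h' *: e_ i + y)))
     (c s * 'D_(e_ i) f (seg p j s (h *: e_ i + y))).
    apply: (iffRL (is_derive_line h 1 _ _)); move: H; congr is_derive; apply/funext => h'.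
    by rewrite addrA -scalerDl /GRing.scale /= mulr1.
  have -> : F ^~ s = (s ^+ m) \*: (fun h' => f (seg p j s (h' *: e_ i + y))) by [].
  exact: is_deriveZ.
have := @cvg_differentiation_under_integral R _ _ mu F I01 _ 0 (-d) d _ _ _ (fun=> M).
move=> /(_ (measurable_itv _)) H.
have {}H : h^-1 *: (\int[mu]_(s in I01) F (h + 0) s - \int[mu]_(s in I01) F 0 s) @[h --> 0^']
    --> \int[mu]_(s in I01) partial1of2 F 0 s.
  apply: H => //.
  - by rewrite /= in_itv /= oppr_lt0 d0.
  - move=> h hd; apply: integrable01; apply: seg_within => //; apply: KB; exact: BH.
  - by move=> h s hd s01; case: (DF h s hd s01).
  - by apply: integrable01; apply: continuous_subspaceT => x; exact: cst_continuous.
  - move=> h s hd s01; rewrite partial1of2E.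
    case: (DF h s hd s01) => _ ->.
    have := HM _ (segK _ _ s01 (BH _ hd)).
    move: s01; rewrite /= in_itv /= => /andP[s0 s1] HD.
    rewrite mulrA normrM; apply: le_trans HD; rewrite ler_piMl //.
    rewrite normrM normrX (ger0_norm s0) mulr_ile1 ?exprn_ge0 ?exprn_ile1 //.
    by rewrite /c; case: ifP; rewrite ?normr1 // ger0_norm.
have E : \int[mu]_(s in I01) partial1of2 F 0 s =
   segint (m + (i == j)) p j (fun x => 'D_(e_ i) f x) y.
  apply: eq_Rintegral => s /[!inE] s01; rewrite partial1of2E.
  have d0' : `]-d, d[%classic (0 : R) by rewrite /= in_itv /= oppr_lt0 d0.
  case: (DF 0 s d0' s01) => _ ->; rewrite scale0r add0r /c mulrA; congr (_ * _).
  by case: (i == j); rewrite ?addn1 ?exprSr ?addn0 ?mulr1.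
rewrite E in H.
have H' : h^-1 *: ((segint m p j f \o shift y) (h *: e_ i) - segint m p j f y) @[h --> 0^']
    --> segint (m + (i == j)) p j (fun x => 'D_(e_ i) f x) y.
  have E2 : (fun h : R => h^-1 *: (\int[mu]_(s in I01) F (h + 0) s - \int[mu]_(s in I01) F 0 s)) =
    (fun h : R => h^-1 *: ((segint m p j f \o shift y) (h *: e_ i) - segint m p j f y)).
    by apply/funext => h; congr (_ *: (_ - _)); apply: eq_Rintegral => s _;
      rewrite /F ?addr0 ?scale0r ?add0r.
  by rewrite E2 in H.
split; first exact: (cvgP _ H').
exact: (cvg_lim _ H').
Qed.

Lemma class_C_segint k (j : 'I_n) m (f : 'rV[R]_n -> R) : 0 < e ->
  class_C k B f -> class_C k B (segint m p j f).
Proof.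
move=> e0; elim: k m f => [|k IH] m f fC.
  by split=> // x Bx; apply: segint_continuous => //; case: fC.
split=> [x Bx|i]; first by apply: segint_continuous => //; case: fC.
have fC1 : class_C 1 B f.
  have [fc fd] := fC; split=> // i'; have [fd1 fd2] := fd i'; split=> //; split=> //.
  exact: class_C_continuous fd2.
split=> [x Bx|]; first by case: (segint_derive j i m fC1 Bx).
have [_ /(_ i)[_ fd2]] := fC.
apply: class_C_eq (IH (m + (i == j))%N _ fd2) => [|x Bx]; first exact: ball_open.
by case: (segint_derive j i m fC1 Bx) => _ ->.
Qed.

End Segint.

Section Hadamard.
Context {R : realType} {n : nat}.
Local Notation e_ i := (delta_mx 0 i : 'rV[R]_n).
Local Notation mu := (@lebesgue_measure R).
Local Notation I01 := (`[0, 1]%classic : set R).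
Variables (p : 'rV[R]_n) (e : R).
Hypothesis e0 : 0 < e.
Local Notation B := (ball p e).

Lemma seg_param_shift j (s h : R) (y : 'rV[R]_n) :
  seg p j (h *: 1 + s) y = (h * (y 0 j - p 0 j)) *: e_ j + seg p j s y.
Proof.
apply/rowP => k; rewrite !mxE eqxx /= /GRing.scale /= mulr1.
by case: (eqVneq k j) => _ /=; ring.
Qed.

Lemma segint_FTC j (f : 'rV[R]_n -> R) y : class_C 1 B f -> B y ->
  f y = f (seg p j 0 y) +
    (y 0 j - p 0 j) * segint 0 p j (fun x => 'D_(e_ j) f x) y.
Proof.
move=> [fc /(_ j)[fd [fdc _]]] By.
pose c := y 0 j - p 0 j; pose F (s : R) := f (seg p j s y).
have DF s : I01 s -> is_derive s 1 F (c * 'D_(e_ j) f (seg p j s y)).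
  move=> s01; apply: (iffRL (is_derive_line s 1 _ _)).
  have -> : (fun h : R => F (h *: 1 + s)) =
     (fun h : R => f (h *: e_ j + seg p j s y)) \o (fun h => h * c).
    by apply/funext => h; rewrite /F seg_param_shift.
  rewrite mulrC.
  apply: (@is_derive1_comp _ (fun h : R => f (h *: e_ j + seg p j s y)) (fun h => h * c)).
    rewrite mul0r; apply: (iffLR (is_derive_line _ (e_ j) f _)).
    apply: DeriveDef => //; apply: fd; exact: seg_ball.
  have -> : *%R^~ c = c \*: (id : R -> R) by apply/funext => h /=; rewrite mulrC.
  by apply: is_derive_eq; rewrite /GRing.scale /= mulr1.
have Fc s : I01 s -> {for s, continuous F}.
  move=> s01; have [d _] := DF s s01.
  exact/differentiable_continuous/derivable1_diffP.
have w : {within I01, continuous (fun s => 'D_(e_ j) f (seg p j s y))}.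
  have -> : (fun s => 'D_(e_ j) f (seg p j s y)) =
    (fun s => s ^+ 0 * 'D_(e_ j) f (seg p j s y)).
    by apply/funext => s; rewrite expr0 mul1r.
  exact: (seg_within (f := fun x => 'D_(e_ j) f x) fdc By).
have wc : {within I01, continuous (fun s => c * 'D_(e_ j) f (seg p j s y))}.
  move=> s; apply: (@continuous_comp (subspace I01) R R
    (fun s => 'D_(e_ j) f (seg p j s y)) (fun z => c * z)); first exact: w.
  exact: mulrl_continuous.
have oc s : s \in `]0, 1[ -> I01 s by rewrite /= !in_itv /= => /andP[? ?]; rewrite !ltW.
have dF : derivable_oo_LRcontinuous F 0 1.
  split.
  - by move=> s /oc s01; case: (DF s s01).
  - by apply: cvg_at_right_filter; apply: Fc; rewrite /= in_itv /= lexx ler01.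
  - by apply: cvg_at_left_filter; apply: Fc; rewrite /= in_itv /= lexx ler01.
have dF' : {in `]0, 1[, F^`()%classic =1 (fun s => c * 'D_(e_ j) f (seg p j s y))}.
  by move=> s /oc s01; rewrite derive1E; case: (DF s s01).
have E := @continuous_FTC2 R _ F 0 1 ltr01 wc dF dF'.
have E2 : \int[mu]_(s in I01) (c * 'D_(e_ j) f (seg p j s y)) = F 1 - F 0.
  by rewrite /Rintegral E.
have mI : measurable (I01 : set (measurableTypeR R)) by exact: measurable_itv.
rewrite (RintegralZl c mI (integrable01 w)) in E2.
have E3 : \int[mu]_(s in I01) (s ^+ 0 * 'D_(e_ j) f (seg p j s y)) =
    \int[mu]_(s in I01) ('D_(e_ j) f (seg p j s y)).
  by apply: eq_Rintegral => s _; rewrite expr0 mul1r.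
by rewrite /segint E3 -/c E2 /F seg1; ring.
Qed.

Lemma class_C_seg0 k j (f : 'rV[R]_n -> R) :
  class_C k B f -> class_C k B (fun y => f (seg p j 0 y)).
Proof.
have z01 : I01 0 by rewrite /= in_itv /= lexx ler01.
have cc (g : 'rV[R]_n -> R) : (forall x, B x -> {for x, continuous g}) -> forall x : 'rV[R]_n, B x ->
    {for x, continuous (fun y => g (seg p j 0 y))}.
  move=> gc x Bx; apply: (@continuous_comp _ _ _ (seg p j 0) g).
    apply: (@cvg_rV _ _ _ (nbhs x) _ (seg p j 0) (seg p j 0 x)) => i; rewrite mxE.
    have -> : (fun t => seg p j 0 t 0 i) = (fun t => if i == j then p 0 j else t 0 i).
      by apply/funext => t; rewrite mxE mul0r addr0.
    case: eqP => _; last exact: coord_continuous.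
    by rewrite mul0r addr0; apply: cvg_cst.
  by apply: gc; exact: seg_ball.
elim: k f => [|k IH] f [fc fd]; first by split=> //; exact: cc.
split=> [|i]; first exact: cc.
have [fd1 fd2] := fd i.
have D x : B x -> is_derive x (e_ i) (fun y => f (seg p j 0 y))
   ((if i == j then 0 else 1) * 'D_(e_ i) f (seg p j 0 x)).
  by move=> Bx; apply: is_derive_seg; apply: fd1; exact: seg_ball.
split=> [x Bx|]; first by case: (D x Bx).
have oB : open B by exact: ball_open.
apply: class_C_eq (class_CZ (if i == j then 0 else 1) oB (IH _ fd2)) => // x Bx.
by case: (D x Bx) => _ ->.
Qed.

Let frz (s : seq 'I_n) (y : 'rV[R]_n) : 'rV[R]_n :=
  \row_k (if k \in s then p 0 k else y 0 k).

(** Telescoping over the coordinates: [segint_FTC] splits off the one for [j], and induction treats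
    the function in which it is frozen at [p 0 j]. The last clause is carried along for the proof
    that functions with vanishing derivatives are locally constant. *)
Lemma hadamard_seq (s : seq 'I_n) (f : 'rV[R]_n -> R) : uniq s ->
  smooth_on B f -> exists g : 'I_n -> 'rV[R]_n -> R,
  [/\ forall j, smooth_on B (g j),
      forall y, B y -> f y = f (frz s y) + \sum_(j <- s) (y 0 j - p 0 j) * g j y
    & forall j, j \in s -> (forall y, B y -> 'D_(e_ j) f y = 0) -> forall y, B y -> g j y = 0].
Proof.
have oB : open B by exact: ball_open.
elim: s f => [|j s IH] f.
  move=> _ _; exists (fun _ _ => 0); split=> // [j k|y By].
    exact: class_C_cst.
  rewrite big_nil addr0; congr f; apply/rowP => k; by rewrite mxE.
move=> /andP[js us] fS.
have [|g [gS gE g0]] := IH (fun y => f (seg p j 0 y)) us.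
  by move=> k; apply: class_C_seg0.
exists (fun i => if i == j then segint 0 p j (fun x => 'D_(e_ j) f x) else g i); split.
- move=> i; case: eqP => _; last exact: gS.
  by move=> k; apply: class_C_segint => //; have [_ /(_ j)[]] := fS k.+1.
- move=> y By; rewrite (segint_FTC j (fS 1%N) By) (gE _ By) big_cons eqxx.
  rewrite -addrA [X in _ + X]addrC; congr (f _ + (_ + _)).
    apply/rowP => k; rewrite !mxE in_cons; case: (eqVneq k j) => [->|//] /=.
    by rewrite mul0r addr0.
  apply: eq_big_seq => i si; case: eqP => // ij.
  by move: js; rewrite -ij si.
- move=> i; rewrite in_cons; case: (eqVneq i j) => [-> _|ij /= si] fi0 y By.
    rewrite /segint -[RHS](Rintegral01_cst (R := R)).
    apply: eq_Rintegral => r /[!inE] r01; rewrite fi0 ?mulr0 //.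
    exact: seg_ball.
  apply: g0 => // z Bz.
  have z01 : I01 0 by rewrite /= in_itv /= lexx ler01.
  have Bs := seg_ball j z01 Bz.
  have : is_derive z (e_ i) (fun y => f (seg p j 0 y))
    ((if i == j then 0 else 1) * 'D_(e_ i) f (seg p j 0 z)).
    by apply: is_derive_seg; have [_ /(_ i)[]] := fS 1%N => + _; apply.
  by case=> _ ->; rewrite fi0 ?mulr0.
Qed.

Lemma hadamard (f : 'rV[R]_n -> R) : smooth_on B f ->
  exists g : 'I_n -> 'rV[R]_n -> R,
  [/\ forall j, smooth_on B (g j),
      forall y, B y -> f y = f p + \sum_j (y 0 j - p 0 j) * g j y
    & forall j, (forall y, B y -> 'D_(e_ j) f y = 0) -> forall y, B y -> g j y = 0].
Proof.
move=> fS; have [g [gS gE g0]] := hadamard_seq (enum_uniq 'I_n) fS.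
exists g; split=> // [y By|j fj]; last by apply: g0 => //; rewrite mem_enum.
rewrite (gE _ By) big_enum /=; congr (f _ + _); apply/rowP => k.
by rewrite mxE mem_enum.
Qed.

End Hadamard.

(** * Chain rule *)

Section Chain.
Context {R : realType}.

(** A product rule in which [w] is merely continuous: as [u x = 0], the difference quotient of the
    product is that of [u] times a value of [w]. It suits the summands of Hadamard's formula. *)
Lemma is_derive_mul0 (V : normedModType R) (u w : V -> R) (x v : V) (l : R) :
  u x = 0 -> is_derive x v u l -> {for x, continuous w} ->
  is_derive x v (fun y => u y * w y) (l * w x).
Proof.
move=> ux0 [du <-] wc.
have c1 : (fun h : R => h *: v + x) @ 0^' --> x.
  have : (fun h : R => h *: v + x) @ nbhs (0 : R) --> 0 *: v + x.
    apply: cvgD; last exact: cvg_cst.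
    by apply: cvgZr_tmp; exact: cvg_id.
  rewrite scale0r add0r; apply: cvg_trans; apply: cvg_app; exact: nbhs_dnbhs.
have c2 : (fun h : R => w (h *: v + x)) @ 0^' --> w x by exact: cvg_comp c1 wc.
have c3 : h^-1 *: ((u \o shift x) (h *: v) - u x) @[h --> 0^'] --> 'D_v u x by [].
have := cvgM c3 c2.
have -> : ((fun h : R => h^-1 *: ((u \o shift x) (h *: v) - u x)) \* (fun h : R => w (h *: v + x)))
   = (fun h : R => h^-1 *: (((fun y => u y * w y) \o shift x) (h *: v) - u x * w x)).
  by apply/funext => h /=; rewrite ux0 mul0r !subr0 /GRing.scale /= mulrA.
have FF : Filter (0 : R)^' by apply: dnbhs_filter.
move=> /(_ FF) H; split; first exact: (cvgP _ H).
exact: (cvg_lim _ H).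
Qed.

Context {n m : nat}.
Local Notation e_ i := (delta_mx 0 i).

Lemma is_derive_chain (f : 'rV[R]_m -> R) (U : set 'rV[R]_m)
    (phi : 'rV[R]_n -> 'rV[R]_m) (x v : 'rV[R]_n) (l : 'I_m -> R) :
  open U -> smooth_on U f -> U (phi x) -> {for x, continuous phi} ->
  (forall j, is_derive x v (fun y => phi y 0 j) (l j)) ->
  is_derive x v (fun y => f (phi y))
    (\sum_j l j * 'D_(e_ j) f (phi x)).
Proof.
move=> oU fS Ux phic dphi; set p := phi x.
have /nbhs_ballP[e /= e0 eU] : nbhs p U by exact: open_nbhs_nbhs.
have oB : open (ball p e) by exact: ball_open.
have [g [gS gE _]] := hadamard e0 (fun k => class_C_sub eU (fS k)).
have gc j : {for p, continuous (g j)}.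
  by have [+ _] := gS j 0%N; apply; exact: ballxx.
(* Stated for an arbitrary [psi] in order to be used twice: for [phi], and for the identity, which
   identifies [g j p] as the partial derivative of [f]. *)
have key k (y w : 'rV[R]_k) (psi : 'rV[R]_k -> 'rV[R]_m) (l' : 'I_m -> R) :
  psi y = p -> {for y, continuous psi} ->
  (forall j, is_derive y w (fun y => psi y 0 j) (l' j)) ->
  is_derive y w (fun y => f (psi y)) (\sum_j l' j * g j p).
  move=> yp psic dpsi.
  pose F y' := f p + \sum_j (psi y' 0 j - p 0 j) * g j (psi y').
  apply: (@near_eq_is_derive _ _ _ F).
    have : nbhs y (psi @^-1` ball p e).
      by apply: psic; rewrite yp; apply: open_nbhs_nbhs; split=> //; exact: ballxx.
    by apply: filterS => z Bz; rewrite /F (gE (psi z)).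
  have -> : F = cst (f p) + (\sum_j (fun y' => (psi y' 0 j - p 0 j) * g j (psi y'))).
    by apply/funext => z; rewrite /F fctE fct_sumE.
  rewrite -[X in is_derive _ _ _ X]add0r; apply: is_deriveD.
  apply: is_derive_sum => j.
  rewrite -yp; apply: is_derive_mul0.
  - by rewrite yp subrr.
  - rewrite -[l' j]subr0; apply: is_deriveB.
  - apply: (@continuous_comp _ _ _ psi (g j)) => //; rewrite yp; exact: gc.
rewrite (eq_bigr (fun j => l j * g j p)); first exact: key.
move=> j _; congr (_ * _).
have : is_derive p (e_ j) f (\sum_i (i == j)%:R * g i p).
  apply: (key m p (e_ j) id (fun i => (i == j)%:R)) => //.
    move=> i; apply: DeriveDef.
      have := @derivable_id _ 'rV[R]_m p (e_ j).
      by move/derivable_mxP => /(_ 0 i).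
    have := @derive_mx _ _ _ _ (fun x : 'rV[R]_m => x) p (e_ j) (@derivable_id _ 'rV[R]_m p (e_ j)).
    by rewrite derive_id => /matrixP/(_ 0 i); rewrite !mxE eqxx /= => <-.
case=> _ ->; rewrite (bigD1 j) //= eqxx mul1r big1 ?addr0 // => i /negPf ->.
by rewrite mul0r.
Qed.

Lemma class_C_comp k (f : 'rV[R]_m -> R) (U : set 'rV[R]_m) (V : set 'rV[R]_n)
    (phi : 'rV[R]_n -> 'rV[R]_m) :
  open U -> open V -> smooth_on U f -> (forall x, V x -> U (phi x)) ->
  (forall j, class_C k V (fun x => phi x 0 j)) ->
  class_C k V (fun x => f (phi x)).
Proof.
move=> oU oV fS VU.
have pc k' : (forall j, class_C k' V (fun x => phi x 0 j)) ->
    forall x : 'rV[R]_n, V x -> {for x, continuous phi}.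
  move=> phiC x Vx; apply: (@cvg_rV _ _ _ (nbhs x)) => j.
  exact: class_C_continuous (phiC j) x Vx.
have cc k' : (forall j, class_C k' V (fun x => phi x 0 j)) ->
    forall x : 'rV[R]_n, V x -> {for x, continuous (fun x => f (phi x))}.
  move=> phiC x Vx; apply: (@continuous_comp _ _ _ phi f); first exact: pc phiC x Vx.
  by have [+ _] := fS 0%N; apply; exact: VU.
elim: k f fS cc => [|k IH] f fS cc phiC; first by split=> //; exact: cc phiC.
have phiC' j : class_C k V (fun x => phi x 0 j) by exact: class_CS.
split=> [|i]; first exact: cc phiC.
have D x : V x -> is_derive x (e_ i) (fun y => f (phi y))
    (\sum_j 'D_(e_ i) (fun y => phi y 0 j) x * 'D_(e_ j) f (phi x)).
  move=> Vx; apply: (is_derive_chain oU fS (VU _ Vx) (pc _ phiC _ Vx)) => j.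
  apply: DeriveDef => //; have [_ /(_ i)[+ _]] := phiC j; exact.
split=> [x Vx|]; first by case: (D x Vx).
apply: (@class_C_eq _ _ _ _ (fun x => \sum_j 'D_(e_ i) (fun y => phi y 0 j) x * 'D_(e_ j) f (phi x))) => //.
  by move=> x Vx; case: (D x Vx) => _ ->.
apply: class_C_sum => // j; apply: class_CM => //.
  by have [_ /(_ i)[_ ]] := phiC j.
have fjS : smooth_on U (fun y => 'D_(e_ j) f y).
  by move=> k'; have [_ /(_ j)[_]] := fS k'.+1.
apply: (IH (fun y => 'D_(e_ j) f y)) => // k' phiC2 x Vx.
apply: (@continuous_comp _ _ _ phi (fun y => 'D_(e_ j) f y)); first exact: pc phiC2 x Vx.
by have [+ _] := fjS 0%N; apply; exact: VU.
Qed.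

End Chain.

(** * Smooth functions and tangent vectors *)

Section Smooth.
Context {R : realType} {M : manifold3 R}.
Local Notation C := R[i].
Implicit Types (p q : M) (c : chart R M).

Lemma chart_at p : exists2 c, atlas M c & chart_dom c p.
Proof. by have [H _] := atlas_smooth M; exact: H. Qed.

Lemma chart_pre_nbhs c p (A : set M) : chart_dom c p -> nbhs p A ->
  exists2 V, open_nbhs (chart_map c p) V & forall x, V x ->
    [/\ chart_dom c (chart_inv c x), A (chart_inv c x)
      & chart_map c (chart_inv c x) = x].
Proof.
move=> cp Ap; set x0 := chart_map c p.
have I0 : (chart_map c @` chart_dom c) x0 by exists p.
have n1 : nbhs x0 (chart_inv c @^-1` A).
  by apply: (chart_inv_cont I0); rewrite chart_mapK.
have n2 : nbhs x0 (chart_map c @` chart_dom c).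
  by apply: open_nbhs_nbhs; split=> //; exact: chart_img_open.
exists ((chart_inv c @^-1` A)^° `&` (chart_map c @` chart_dom c)).
  split; last by split=> //; exact: nbhs_singleton (nbhs_interior n1).
  by apply: openI; [exact: open_interior|exact: chart_img_open].
move=> x [/interior_subset Ax [q cq qx]]; rewrite -qx chart_mapK //; split=> //.
by move: Ax; rewrite /= -qx chart_mapK.
Qed.

Lemma chart_dom_nbhs c p : chart_dom c p -> nbhs p (chart_dom c).
Proof. by move=> cp; apply: open_nbhs_nbhs; split=> //; exact: chart_dom_open. Qed.

Lemma chart_map_nbhs c p (V : set 'rV[R]_3) : chart_dom c p ->
  nbhs (chart_map c p) V ->
  nbhs p [set q | chart_dom c q /\ V (chart_map c q)].
Proof.
move=> cp Vp; apply: filterI; first exact: chart_dom_nbhs.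
exact: (chart_map_cont cp).
Qed.

(** [smooth_at] provides some chart; the smooth transition maps and [class_C_comp] carry the
    property to any other. *)
Lemma smooth_at_chart c p (f : M -> R) : atlas M c -> chart_dom c p ->
  smooth_at p f ->
  exists V, [/\ open_nbhs (chart_map c p) V,
    forall x, V x -> chart_dom c (chart_inv c x) /\ chart_map c (chart_inv c x) = x
    & smooth_on V (f \o chart_inv c)].
Proof.
move=> ac cp [c0 [ac0 c0p [V0 [oV0 V0p] fS]]].
have nA : nbhs p [set q | chart_dom c0 q /\ V0 (chart_map c0 q)].
  by apply: chart_map_nbhs => //; apply: open_nbhs_nbhs.
have [V [oV Vp] HV] := chart_pre_nbhs cp nA.
exists V; split=> [//|x /HV[]//|k].
have C : class_C k V ((f \o chart_inv c0) \o (chart_map c0 \o chart_inv c)).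
  apply: (class_C_comp (U := V0)) => // [x /HV[_ []]//|j].
  have [_ /(_ c c0 ac ac0 j k)] := atlas_smooth M.
  apply: class_C_sub => x Vx; have [cx [c0x _] xK] := HV x Vx.
  by exists (chart_inv c x).
apply: class_C_eq C => // x Vx /=; have [cx [c0x _] xK] := HV x Vx.
by rewrite chart_mapK.
Qed.

Lemma smooth_at_chartW c p (f : M -> R) V : atlas M c -> chart_dom c p ->
  nbhs (chart_map c p) V -> smooth_on V (f \o chart_inv c) -> smooth_at p f.
Proof.
move=> ac cp Vp fS; exists c; split=> //; exists V^°.
  by split; [exact: open_interior|exact: nbhs_singleton (nbhs_interior Vp)].
by move=> k; apply: class_C_sub (fS k); exact: interior_subset.
Qed.

Lemma smooth_at_near p (f : M -> R) : smooth_at p f ->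
  \forall q \near p, smooth_at q f.
Proof.
move=> [c [ac cp [V [oV Vp] fS]]].
have : nbhs p [set q | chart_dom c q /\ V (chart_map c q)].
  by apply: chart_map_nbhs => //; apply: open_nbhs_nbhs.
by apply: filterS => q [cq Vq]; exists c; split=> //; exists V.
Qed.

Lemma smooth_at_eq p (f g : M -> R) : (\forall q \near p, f q = g q) ->
  smooth_at p f -> smooth_at p g.
Proof.
move=> fg fS; have [c ac cp] := chart_at p.
have [V [[oV Vp] _ {}fS]] := smooth_at_chart ac cp fS.
have [V' [oV' V'p] HV'] := chart_pre_nbhs cp fg.
apply: (@smooth_at_chartW c p _ (V `&` V')) => //.
  by apply: filterI; apply: open_nbhs_nbhs.
have oVV' : open (V `&` V') by exact: openI.
move=> k; apply: (@class_C_eq _ _ _ _ (f \o chart_inv c)) => //.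
  by move=> x [_ /HV'[]].
by apply: class_C_sub (fS k); exact: subIsetl.
Qed.

Lemma smooth_at_continuous p (f : M -> R) : smooth_at p f -> {for p, continuous f}.
Proof.
move=> fS; have [c ac cp] := chart_at p.
have [V [[oV Vp] _ {}fS]] := smooth_at_chart ac cp fS.
have E : {near p, (f \o chart_inv c) \o chart_map c =1 f}.
  by apply: filterS (chart_dom_nbhs cp) => q cq /=; rewrite chart_mapK.
rewrite /prop_for /continuous_at -(nbhs_singleton E).
have c1 : {for p, continuous ((f \o chart_inv c) \o chart_map c)}.
  apply: continuous_comp; first exact: chart_map_cont.
  by have [+ _] := fS 0%N; apply.
exact: (cvg_trans (near_eq_cvg E) c1).
Qed.

Lemma smooth_at_cst p (a : R) : smooth_at p (fun=> a).
Proof.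
have [c ac cp] := chart_at p; exists c; split=> //.
exists setT; first by split=> //; exact: openT.
by move=> k; apply: class_C_cst; exact: openT.
Qed.

Lemma smooth_at_coord c p j : atlas M c -> chart_dom c p ->
  smooth_at p (fun q => chart_map c q 0 j).
Proof.
move=> ac cp; apply: (@smooth_at_chartW c p _ (chart_map c @` chart_dom c)) => //.
  by apply: open_nbhs_nbhs; split; [exact: chart_img_open|exists p].
have oI : open (chart_map c @` chart_dom c) by exact: chart_img_open.
move=> k; apply: class_C_eq (class_C_coord k j oI) => // x [q cq <-] /=.
by rewrite chart_mapK.
Qed.

Lemma smooth_at_op2 (op : R -> R -> R) p (f g : M -> R) :
  (forall (U : set 'rV[R]_3) f g k, open U -> class_C k U f -> class_C k U g ->
     class_C k U (fun x => op (f x) (g x))) ->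
  smooth_at p f -> smooth_at p g -> smooth_at p (fun q => op (f q) (g q)).
Proof.
move=> H fS gS; have [c ac cp] := chart_at p.
have [V [[oV Vp] _ {}fS]] := smooth_at_chart ac cp fS.
have [V' [[oV' V'p] _ {}gS]] := smooth_at_chart ac cp gS.
apply: (@smooth_at_chartW c p _ (V `&` V')) => //.
  by apply: filterI; apply: open_nbhs_nbhs.
have oVV' : open (V `&` V') by exact: openI.
move=> k; apply: (H _ (f \o chart_inv c) (g \o chart_inv c)) => //.
  by apply: class_C_sub (fS k); exact: subIsetl.
by apply: class_C_sub (gS k); exact: subIsetr.
Qed.

Lemma smooth_atD p (f g : M -> R) :
  smooth_at p f -> smooth_at p g -> smooth_at p (fun q => f q + g q).
Proof. by apply: smooth_at_op2 => *; exact: class_CD. Qed.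

Lemma smooth_atM p (f g : M -> R) :
  smooth_at p f -> smooth_at p g -> smooth_at p (fun q => f q * g q).
Proof. by apply: smooth_at_op2 => *; exact: class_CM. Qed.

Lemma smooth_atN p (f : M -> R) : smooth_at p f -> smooth_at p (fun q => - f q).
Proof.
move=> fS; have := smooth_atM (smooth_at_cst p (-1)) fS.
by apply: smooth_at_eq; apply: nearW => q; rewrite mulN1r.
Qed.

Lemma smooth_at_op1 (op : R -> R) (P : R -> Prop) p (f : M -> R) :
  (forall (U : set 'rV[R]_3) f k, open U -> (forall x, U x -> P (f x)) ->
     class_C k U f -> class_C k U (fun x => op (f x))) ->
  (\forall q \near p, P (f q)) ->
  smooth_at p f -> smooth_at p (fun q => op (f q)).
Proof.
move=> H nP fS; have [c ac cp] := chart_at p.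
have [V [[oV Vp] _ {}fS]] := smooth_at_chart ac cp fS.
have [V' [oV' V'p] HV'] := chart_pre_nbhs cp nP.
apply: (@smooth_at_chartW c p _ (V `&` V')) => //.
  by apply: filterI; apply: open_nbhs_nbhs.
have oVV' : open (V `&` V') by exact: openI.
move=> k; apply: (H _ (f \o chart_inv c)) => //; first by move=> x [_ /HV'[]].
by apply: class_C_sub (fS k); exact: subIsetl.
Qed.

Lemma smooth_atV p (f : M -> R) : f p != 0 ->
  smooth_at p f -> smooth_at p (fun q => (f q)^-1).
Proof.
move=> f0 fS; have fc := smooth_at_continuous fS.
apply: (smooth_at_op1 (P := fun x => x != 0)) fS.
  by move=> *; exact: class_CV.
have : nbhs (f p) [set x : R | x != 0] by apply: open_nbhs_nbhs; split=> //; exact: open_neq.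
by move/fc.
Qed.

Lemma smooth_at_sqrt p (f : M -> R) : 0 < f p ->
  smooth_at p f -> smooth_at p (fun q => Num.sqrt (f q)).
Proof.
move=> f0 fS; have fc := smooth_at_continuous fS.
apply: (smooth_at_op1 (P := fun x => 0 < x)) fS.
  by move=> *; exact: class_C_sqrt.
have : nbhs (f p) [set x : R | 0 < x] by apply: open_nbhs_nbhs; split=> //; exact: open_gt.
by move/fc.
Qed.

Lemma eqC (x y : C) : complex.Re x = complex.Re y -> complex.Im x = complex.Im y -> x = y.
Proof. by case: x y => [a b] [a' b'] /= -> ->. Qed.

Lemma csmooth_eq p (f g : M -> C) : (\forall q \near p, f q = g q) ->
  csmooth_at p f -> csmooth_at p g.
Proof.
by move=> fg [f1 f2]; split; [move: f1|move: f2]; apply: smooth_at_eq;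
  apply: filterS fg => q ->.
Qed.

Lemma csmooth_near p (f : M -> C) : csmooth_at p f -> \forall q \near p, csmooth_at q f.
Proof. by move=> [f1 f2]; apply: filterI; apply: smooth_at_near. Qed.

Lemma csmooth_cst p (a : C) : csmooth_at p (fun=> a).
Proof. by split; exact: smooth_at_cst. Qed.

Lemma csmoothD p (f g : M -> C) :
  csmooth_at p f -> csmooth_at p g -> csmooth_at p (fun q => f q + g q).
Proof.
move=> [f1 f2] [g1 g2]; split.
  have := smooth_atD f1 g1; apply: smooth_at_eq; apply: nearW => q.
  by case: (f q) (g q) => ? ? [].
have := smooth_atD f2 g2; apply: smooth_at_eq; apply: nearW => q.
by case: (f q) (g q) => ? ? [].
Qed.

Lemma csmoothM p (f g : M -> C) :
  csmooth_at p f -> csmooth_at p g -> csmooth_at p (fun q => f q * g q).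
Proof.
move=> [f1 f2] [g1 g2]; split.
  have := smooth_atD (smooth_atM f1 g1) (smooth_atN (smooth_atM f2 g2)).
  apply: smooth_at_eq; apply: nearW => q.
  by case: (f q) (g q) => ? ? [].
have := smooth_atD (smooth_atM f1 g2) (smooth_atM f2 g1).
apply: smooth_at_eq; apply: nearW => q.
by case: (f q) (g q) => ? ? [].
Qed.

Lemma csmoothN p (f : M -> C) : csmooth_at p f -> csmooth_at p (fun q => - f q).
Proof.
move=> fS; have := csmoothM (csmooth_cst p (-1)) fS.
by apply: csmooth_eq; apply: nearW => q; rewrite mulN1r.
Qed.

Lemma csmooth_conj p (f : M -> C) : csmooth_at p f -> csmooth_at p (fun q => (f q)^*).
Proof.
move=> [f1 f2]; split.
  by move: f1; apply: smooth_at_eq; apply: nearW => q; case: (f q).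
have := smooth_atN f2; apply: smooth_at_eq; apply: nearW => q.
by case: (f q).
Qed.

Lemma csmooth_real p (f : M -> R) : smooth_at p f -> csmooth_at p (fun q => (f q)%:C%C).
Proof. by move=> fS; split=> //=; exact: smooth_at_cst. Qed.

End Smooth.

Lemma hadamard_derive (R : realType) (n : nat) (p : 'rV[R]_n) (e : R)
    (f : 'rV[R]_n -> R) (g : 'I_n -> 'rV[R]_n -> R) (i : 'I_n) : 0 < e ->
  (forall j, {for p, continuous (g j)}) ->
  (forall y, ball p e y -> f y = f p + \sum_j (y 0 j - p 0 j) * g j y) ->
  'D_(delta_mx 0 i) f p = g i p.
Proof.
move=> e0 gc gE; pose F (y : 'rV[R]_n) := f p + \sum_j (y 0 j - p 0 j) * g j y.
have d0 j : is_derive p (delta_mx 0 i) (fun y : 'rV[R]_n => y 0 j) (j == i)%:R.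
  apply: DeriveDef.
    have := @derivable_id _ 'rV[R]_n p (delta_mx 0 i).
    by move/derivable_mxP => /(_ 0 j).
  have := @derive_mx _ _ _ _ (fun x : 'rV[R]_n => x) p (delta_mx 0 i) (@derivable_id _ 'rV[R]_n p _).
  by rewrite derive_id => /matrixP/(_ 0 j); rewrite !mxE eqxx /= => <-.
have : is_derive p (delta_mx 0 i) f (0 + \sum_j (j == i)%:R * g j p).
  apply: (@near_eq_is_derive _ _ _ F).
    have : nbhs p (ball p e).
      by apply: open_nbhs_nbhs; split; [exact: ball_open|exact: ballxx].
    by apply: filterS => z Bz; rewrite /F (gE z).
  have -> : F = cst (f p) + (\sum_j (fun y : 'rV[R]_n => (y 0 j - p 0 j) * g j y)).
    by apply/funext => z; rewrite /F fctE fct_sumE.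
  apply: is_deriveD; apply: is_derive_sum => j.
  apply: is_derive_mul0 => //; first by rewrite subrr.
  by rewrite -[(j == i)%:R]subr0; apply: is_deriveB.
case=> _ ->; rewrite add0r (bigD1 i) //= eqxx mul1r big1 ?addr0 // => j /negPf ->.
by rewrite mul0r.
Qed.

(** * Tangent vectors in charts *)

Section Tangent.
Context {R : realType} {M : manifold3 R}.
Local Notation C := R[i].
Implicit Types (p q : M) (c : chart R M) (v w : tvec M).

Definition rl (f : M -> R) : M -> C := fun q => (f q)%:C%C.

Lemma conjD (x y : C) : (x + y)^* = x^* + y^*. Proof. exact: rmorphD. Qed.
Lemma conjM (x y : C) : (x * y)^* = x^* * y^*. Proof. exact: rmorphM. Qed.
Lemma conjK (x : C) : x^*^* = x. Proof. exact: conjCK. Qed.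

Lemma tanD p v (f g : M -> C) : tangent p v -> csmooth_at p f -> csmooth_at p g ->
  v (fun q => f q + g q) = v f + v g.
Proof.
move=> [_ vl _] fS gS; have := vl 1 f g fS gS; rewrite mul1r => <-.
by congr v; apply/funext => q; rewrite /lcomb mul1r.
Qed.

Lemma tanM p v (f g : M -> C) : tangent p v -> csmooth_at p f -> csmooth_at p g ->
  v (fun q => f q * g q) = v f * g p + f p * v g.
Proof. by move=> [_ _ vl]; exact: vl. Qed.

Lemma tan_cst p v (a : C) : tangent p v -> v (fun=> a) = 0.
Proof.
move=> tv; have S1 := csmooth_cst p (1 : C); have Sa := csmooth_cst p a.
have v1 : v (fun=> 1) = 0.
  have E : (fun _ : M => 1 * 1 : C) = (fun=> 1) by apply/funext => ?; rewrite mulr1.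
  have := tanM tv S1 S1; rewrite E mulr1 mul1r.
  by move/eqP; rewrite -subr_eq0 opprD addNKr oppr_eq0 => /eqP.
have [_ vl _] := tv; have := vl a _ _ S1 S1; rewrite v1 mulr0 add0r => v2.
have := vl (-1) _ _ S1 (csmooth_cst p (1 + a)).
have -> : lcomb (-1) (fun _ : M => 1) (fun=> 1 + a) = (fun=> a).
  by apply/funext => q; rewrite /lcomb mulr1 addKr.
move=> ->; rewrite v1 mulr0 add0r.
have -> : (fun _ : M => 1 + a) = lcomb a (fun=> 1) (fun=> 1).
  by apply/funext => q; rewrite /lcomb mulr1 addrC.
by [].
Qed.

Lemma tanZ p v (a : C) (f : M -> C) : tangent p v -> csmooth_at p f ->
  v (fun q => a * f q) = a * v f.
Proof.
move=> tv fS; rewrite (tanM tv (csmooth_cst p a) fS) (tan_cst _ tv).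
by rewrite mul0r add0r.
Qed.

Lemma tanN p v (f : M -> C) : tangent p v -> csmooth_at p f ->
  v (fun q => - f q) = - v f.
Proof.
move=> tv fS; rewrite -mulN1r -(tanZ _ tv fS); congr v.
by apply/funext => q; rewrite mulN1r.
Qed.

Lemma tanB p v (f g : M -> C) : tangent p v -> csmooth_at p f -> csmooth_at p g ->
  v (fun q => f q - g q) = v f - v g.
Proof. by move=> tv fS gS; rewrite (tanD tv fS (csmoothN gS)) (tanN tv gS). Qed.

(** Locality without bump functions: the difference [h] equals [h * chi], with [chi] the indicator
    of [h != 0]. Both factors vanish near [p], so [chi] is smooth at [p] and the Leibniz rule gives
    0. *)
Lemma tan_near p v (f g : M -> C) : tangent p v ->
  (\forall q \near p, f q = g q) -> v f = v g.
Proof.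
move=> tv fg; have [v0 _ _] := tv.
have gf : \forall q \near p, g q = f q by apply: filterS fg => q ->.
have [fS|fS] := pselect (csmooth_at p f); last first.
  rewrite !v0 // => gS; apply: fS; exact: csmooth_eq gf gS.
have gS := csmooth_eq fg fS.
apply/eqP; rewrite -subr_eq0 -(tanB tv fS gS); apply/eqP.
pose h q := f q - g q; pose chi q : C := if `[<h q = 0>] then 0 else 1.
have hS : csmooth_at p h by apply: csmoothD => //; exact: csmoothN.
have h0 : \forall q \near p, h q = 0 by apply: filterS fg => q; rewrite /h => ->; rewrite subrr.
have chiS : csmooth_at p chi.
  apply: csmooth_eq (csmooth_cst p 0); apply: filterS h0 => q hq.
  by rewrite /chi asboolT.
have -> : (fun q => f q - g q) = (fun q => h q * chi q).
  apply/funext => q; rewrite /chi -/(h q); case: asboolP => [->|_]; by rewrite ?mul0r ?mulr1.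
have hp := nbhs_singleton h0.
by rewrite (tanM tv hS chiS) hp mul0r addr0 /chi asboolT // mulr0.
Qed.

Lemma tan_sum p v (n : nat) (f : 'I_n -> M -> C) : tangent p v ->
  (forall j, csmooth_at p (f j)) ->
  csmooth_at p (fun q => \sum_j f j q) /\ v (fun q => \sum_j f j q) = \sum_j v (f j).
Proof.
move=> tv; elim: n f => [|n IH] f fS.
  have -> : (fun q => \sum_(j < 0) f j q) = (fun=> 0) by apply/funext => q; rewrite big_ord0.
  by split; [exact: csmooth_cst|rewrite big_ord0 (tan_cst _ tv)].
have -> : (fun q => \sum_(j < n.+1) f j q) =
    (fun q => \sum_(j < n) f (widen_ord (leqnSn n) j) q + f ord_max q).
  by apply/funext => q; rewrite big_ord_recr.
have [S E] := IH _ (fun j => fS (widen_ord (leqnSn n) j)).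
split; first exact: csmoothD.
by rewrite (tanD tv S (fS _)) E big_ord_recr.
Qed.

Lemma smooth_at_sum p (n : nat) (f : 'I_n -> M -> R) :
  (forall j, smooth_at p (f j)) -> smooth_at p (fun q => \sum_j f j q).
Proof.
elim: n f => [|n IH] f fS.
  apply: smooth_at_eq (smooth_at_cst p 0); apply: nearW => q; by rewrite big_ord0.
apply: smooth_at_eq (smooth_atD (IH _ (fun j => fS (widen_ord (leqnSn n) j))) (fS ord_max)).
by apply: nearW => q; rewrite big_ord_recr.
Qed.

Lemma csmooth_sum p (n : nat) (f : 'I_n -> M -> C) :
  (forall j, csmooth_at p (f j)) -> csmooth_at p (fun q => \sum_j f j q).
Proof.
elim: n f => [|n IH] f fS.
  apply: csmooth_eq (csmooth_cst p 0); apply: nearW => q; by rewrite big_ord0.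
apply: csmooth_eq (csmoothD (IH _ (fun j => fS (widen_ord (leqnSn n) j))) (fS ord_max)).
by apply: nearW => q; rewrite big_ord_recr.
Qed.

Lemma hadamard_at c p (f : M -> R) : atlas M c -> chart_dom c p -> smooth_at p f ->
  exists g : 'I_3 -> M -> R, [/\ forall j, smooth_at p (g j),
    forall j, g j p = 'D_(delta_mx 0 j) (f \o chart_inv c) (chart_map c p) &
    \forall q \near p, f q = f p + \sum_j (chart_map c q 0 j - chart_map c p 0 j) * g j q].
Proof.
move=> ac cp fS; have [V [[oV Vp] _ {}fS]] := smooth_at_chart ac cp fS.
have /nbhs_ballP[e /= e0 eV] : nbhs (chart_map c p) V by exact: open_nbhs_nbhs.
have [g [gS gE _]] := hadamard e0 (fun k => class_C_sub eV (fS k)).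
have nB : nbhs (chart_map c p) (ball (chart_map c p) e).
  by apply: open_nbhs_nbhs; split; [exact: ball_open|exact: ballxx].
exists (fun j q => g j (chart_map c q)); split=> [j|j|].
  apply: (@smooth_at_chartW _ _ c p _ ((chart_map c @` chart_dom c) `&` ball (chart_map c p) e)) => //.
    by apply: filterI => //; apply: open_nbhs_nbhs; split; [exact: chart_img_open|exists p].
  move=> k; apply: (@class_C_eq _ _ _ _ (g j)).
  - by apply: openI; [exact: chart_img_open|exact: ball_open].
  - by move=> x [[q cq <-] _] /=; rewrite chart_mapK.
  - by apply: class_C_sub (gS j k); exact: subIsetr.
  have gc i : {for chart_map c p, continuous (g i)}.
    by have [gc _] := gS i 0%N; apply: gc; exact: ballxx.
  by have /= -> := @hadamard_derive R 3 (chart_map c p) e (f \o chart_inv c) g j e0 gc gE.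
have := chart_map_nbhs cp nB; apply: filterS => q [cq Bq].
by have := gE _ Bq; rewrite /= !chart_mapK.
Qed.

Local Notation xc c j := (rl (fun q => chart_map c q 0 j)).

Lemma csmooth_coord c p j : atlas M c -> chart_dom c p -> csmooth_at p (xc c j).
Proof. by move=> ac cp; apply: csmooth_real; exact: smooth_at_coord. Qed.

Lemma tan_hadamard c p v (f : M -> R) (g : 'I_3 -> M -> R) : atlas M c ->
  chart_dom c p -> tangent p v -> (forall j, smooth_at p (g j)) ->
  (\forall q \near p, f q = f p + \sum_j (chart_map c q 0 j - chart_map c p 0 j) * g j q) ->
  v (rl f) = \sum_j v (xc c j) * (g j p)%:C%C.
Proof.
move=> ac cp tv gS fE.
pose h j := fun q => (xc c j q - xc c j p) * rl (g j) q.
have xS j := csmooth_coord j ac cp.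
have gC j : csmooth_at p (rl (g j)) by exact: csmooth_real.
have dS j : csmooth_at p (fun q => xc c j q - xc c j p).
  by apply: csmoothD => //; exact: csmooth_cst.
have hS j : csmooth_at p (h j) by exact: csmoothM.
have -> : v (rl f) = v (fun q => (f p)%:C%C + \sum_j h j q).
  apply: (tan_near tv); apply: filterS fE => q; rewrite /rl => ->.
  rewrite rmorphD rmorph_sum; congr (_ + _); apply: eq_bigr => j _.
  by rewrite rmorphM rmorphB.
rewrite (tanD tv (csmooth_cst _ _) (csmooth_sum hS)) (tan_cst _ tv) add0r.
rewrite (tan_sum tv hS).2; apply: eq_bigr => j _.
rewrite /h (tanM tv (dS j) (gC j)) subrr mul0r addr0; congr (_ * _).
by rewrite (tanB tv (xS j) (csmooth_cst _ _)) (tan_cst _ tv) subr0.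
Qed.

Lemma csplit p v (f : M -> C) : tangent p v -> csmooth_at p f ->
  v f = v (rl (fun q => complex.Re (f q))) + 'i * v (rl (fun q => complex.Im (f q))).
Proof.
move=> tv [f1 f2]; have S1 := csmooth_real f1; have S2 := csmooth_real f2.
rewrite -(tanZ _ tv S2) -(tanD tv S1 (csmoothM (csmooth_cst p 'i) S2)); congr v.
apply/funext => q; rewrite /rl; case: (f q) => a b /=.
by apply: eqC => /=; ring.
Qed.

Lemma tan_inj c p v w : atlas M c -> chart_dom c p -> tangent p v -> tangent p w ->
  (forall j, v (xc c j) = w (xc c j)) -> v = w.
Proof.
move=> ac cp tv tw vw; apply/funext => f.
have [fS|fS] := pselect (csmooth_at p f); last first.
  by have [v0 _ _] := tv; have [w0 _ _] := tw; rewrite v0 ?w0.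
have K (h : M -> R) : smooth_at p h -> v (rl h) = w (rl h).
  move=> hS; have [g [gS _ gE]] := hadamard_at ac cp hS.
  rewrite (tan_hadamard ac cp tv gS gE) (tan_hadamard ac cp tw gS gE).
  by apply: eq_bigr => j _; rewrite vw.
have [f1 f2] := fS.
by rewrite (csplit tv fS) (csplit tw fS) !K.
Qed.

Lemma tangent0 p : tangent p (fun=> 0).
Proof. by split=> // *; rewrite ?mulr0 ?mul0r ?addr0. Qed.

Lemma tangent_lcomb p (k : C) v w : tangent p v -> tangent p w ->
  tangent p (lcomb k v w).
Proof.
move=> [v0 vl vm] [w0 wl wm]; split.
- by move=> f fS; rewrite /lcomb v0 ?w0 // mulr0 addr0.
- by move=> a f g fS gS; rewrite /lcomb vl ?wl //; ring.
- by move=> f g fS gS; rewrite /lcomb vm ?wm //; ring.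
Qed.

Lemma tangent_vconj p v : tangent p v -> tangent p (vconj v).
Proof.
have cS f : csmooth_at p (fun q => (f q)^*) -> csmooth_at p f.
  move=> H; have := csmooth_conj H; apply: csmooth_eq; apply: nearW => q.
  by rewrite conjK.
move=> tv; have [v0 vl vm] := tv; split; rewrite /vconj.
- by move=> f fS; rewrite v0 ?conjC0 // => /cS.
- move=> a f g fS gS; have fS' := csmooth_conj fS; have gS' := csmooth_conj gS.
  have -> : (fun q => (lcomb a f g q)^*) = lcomb a^* (fun q => (f q)^*) (fun q => (g q)^*).
    by apply/funext => q; rewrite /lcomb conjD conjM.
  by rewrite vl // conjD conjM conjK.
- move=> f g fS gS; have fS' := csmooth_conj fS; have gS' := csmooth_conj gS.
  have -> : (fun q => (f q * g q)^*) = (fun q => (f q)^* * (g q)^*).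
    by apply/funext => q; rewrite conjM.
  by rewrite vm // conjD !conjM !conjK.
Qed.

Lemma vconjK v : vconj (vconj v) = v.
Proof.
apply/funext => f; rewrite /vconj conjK; congr v.
by apply/funext => q; rewrite conjK.
Qed.

Definition lin_on p (phi : tvec M -> C) := forall k v w, tangent p v -> tangent p w ->
  phi (lcomb k v w) = k * phi v + phi w.

Lemma lin_on0 p (phi : tvec M -> C) : lin_on p phi -> phi (fun=> 0) = 0.
Proof.
move=> H; have := H (-1) _ _ (tangent0 p) (tangent0 p).
have -> : lcomb (-1) (fun _ : M -> C => 0) (fun=> 0) = (fun=> 0 : C).
  by apply/funext => f; rewrite /lcomb mulr0 addr0.
by rewrite mulN1r addNr.
Qed.

(** Written with nested [lcomb], the operation in which [tangent_lcomb] and [lin_on] are stated. *)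
Definition comb3 (a : 'I_3 -> C) (e : 'I_3 -> tvec M) : tvec M :=
  let i1 : 'I_3 := lift ord0 ord0 in let i2 : 'I_3 := lift ord0 (lift ord0 ord0) in
  lcomb (a ord0) (e ord0) (lcomb (a i1) (e i1) (lcomb (a i2) (e i2) (fun=> 0))).

Lemma comb3E a e f : comb3 a e f = \sum_k a k * e k f.
Proof.
by rewrite /comb3 /lcomb !big_ord_recl big_ord0.
Qed.

Lemma tangent_comb3 p a e : (forall k, tangent p (e k)) -> tangent p (comb3 a e).
Proof. by move=> te; do 3! apply: tangent_lcomb => //; exact: tangent0. Qed.

Lemma lin_comb3 p phi a e : lin_on p phi -> (forall k, tangent p (e k)) ->
  phi (comb3 a e) = \sum_k a k * phi (e k).
Proof.
move=> lp te; have t0 := tangent0 p; rewrite /comb3 !lp ?(lin_on0 lp) //; last first.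
- by do 2! apply: tangent_lcomb => //.
- by do 1! apply: tangent_lcomb => //.
by rewrite !big_ord_recl big_ord0.
Qed.

(** A row in the kernel yields a combination of the [e k] that kills the coordinates, hence is 0 by
    [tan_inj]; the dual forms then read off its coefficients. *)
Lemma tan_dual_unit c p (e : 'I_3 -> tvec M) (phi : 'I_3 -> tvec M -> C) :
  atlas M c -> chart_dom c p ->
  (forall k, tangent p (e k)) -> (forall k, lin_on p (phi k)) ->
  (forall k l, phi k (e l) = (k == l)%:R) ->
  (\matrix_(k, j) e k (xc c j) : 'M[C]_3) \in unitmx.
Proof.
move=> ac cp te lphi dual; set E := (X in X \in _).
rewrite -row_free_unit -kermx_eq0; apply/eqP/row_matrixP => i.
set r := row i _; rewrite row0.
have rE : r *m E = 0 by rewrite /r -row_mul mulmx_ker row0.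
have z : comb3 (fun k => r 0 k) e = (fun=> 0).
  apply: (tan_inj ac cp); [exact: tangent_comb3|exact: tangent0|move=> j].
  rewrite comb3E; have := congr1 (fun A : 'rV[C]_3 => A 0 j) rE; rewrite !mxE => {2}<-.
  by apply: eq_bigr => k _; congr (_ * _); rewrite mxE.
apply/rowP => k; have := lin_comb3 (fun k => r 0 k) (lphi k) te.
rewrite z (lin_on0 (lphi k)) (bigD1 k) //= dual eqxx mulr1 big1 ?addr0.
  by move=> <-; rewrite [RHS]mxE.
by move=> l lk; rewrite dual eq_sym (negPf lk) mulr0.
Qed.

(** A dimension count: a tangent vector is determined by its three values on the coordinates, and by
    [tan_dual_unit] combinations of the [e k] attain all such triples. *)
Lemma tan_dual_basis p (e : 'I_3 -> tvec M) (phi : 'I_3 -> tvec M -> C) v :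
  (forall k, tangent p (e k)) -> (forall k, lin_on p (phi k)) ->
  (forall k l, phi k (e l) = (k == l)%:R) -> tangent p v ->
  v = comb3 (fun k => phi k v) e.
Proof.
move=> te lphi dual tv; have [c ac cp] := chart_at p.
have uE := tan_dual_unit ac cp te lphi dual.
set E := (X in X \in _) in uE.
pose r : 'rV[C]_3 := (\row_j v (xc c j)) *m invmx E.
have vE : v = comb3 (fun k => r 0 k) e.
  apply: (tan_inj ac cp) => //; first exact: tangent_comb3.
  move=> j; rewrite comb3E.
  have : r *m E = \row_j v (xc c j) by rewrite mulmxKV.
  move/rowP/(_ j); rewrite !mxE => <-; apply: eq_bigr => k _; congr (_ * _); by rewrite mxE.
have -> : comb3 (fun k => phi k v) e = comb3 (fun k => r 0 k) e; last by [].
congr comb3; apply/funext => k; rewrite vE (lin_comb3 _ (lphi k) te).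
rewrite (bigD1 k) //= dual eqxx mulr1 big1 ?addr0 // => l lk.
by rewrite dual eq_sym (negPf lk) mulr0.
Qed.

Lemma chart_line c p (a : 'rV[R]_3) :
  atlas M c -> chart_dom c p ->
  exists q : R -> M, [/\ q 0 = p, q @ (0 : R) --> p &
    \forall h \near (0 : R), chart_map c (q h) = chart_map c p + h *: a].
Proof.
move=> ac cp; have I0 : (chart_map c @` chart_dom c) (chart_map c p) by exists p.
have c1 : (fun h : R => chart_map c p + h *: a) @ (0 : R) --> chart_map c p.
  rewrite -[X in _ --> X]addr0 -[X in _ + X](scale0r a).
  by apply: cvgD; [exact: cvg_cst|apply: cvgZr_tmp; exact: cvg_id].
exists (fun h => chart_inv c (chart_map c p + h *: a)); split.
- by rewrite scale0r addr0 chart_mapK.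
- rewrite -[X in _ --> X](chart_mapK cp).
  by apply: (cvg_comp _ _ c1); exact: chart_inv_cont.
have n2 : nbhs (chart_map c p) (chart_map c @` chart_dom c).
  by apply: open_nbhs_nbhs; split=> //; exact: chart_img_open.
have n3 : \forall h \near (0 : R), (chart_map c @` chart_dom c) (chart_map c p + h *: a).
  exact: c1 _ n2.
by apply: filterS n3 => h [q cq <-]; rewrite chart_mapK.
Qed.

Lemma near0_sign_odd (k : R -> R) : {for 0, continuous k} ->
  (\forall h \near (0 : R), h * k h <= 0) -> k 0 = 0.
Proof.
move=> kc kn; apply/eqP; rewrite eq_le; apply/andP; split; rewrite leNgt; apply/negP => k0.
  have /nbhs_ballP[e /= e0 eP] : \forall h \near (0 : R), 0 < k h /\ h * k h <= 0.
    have n : nbhs (k 0) [set x : R | 0 < x] by apply: open_nbhs_nbhs; split=> //; exact: open_gt.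
    have kn2 : \forall h \near (0 : R), 0 < k h by exact: kc _ n.
    by apply: filterS2 kn2 kn.
  have [] := eP (e / 2); first by rewrite /ball /= sub0r normrN gtr0_norm; lra.
  by move=> h1; rewrite leNgt mulr_gt0 //; lra.
have /nbhs_ballP[e /= e0 eP] : \forall h \near (0 : R), k h < 0 /\ h * k h <= 0.
  have n : nbhs (k 0) [set x : R | x < 0] by apply: open_nbhs_nbhs; split=> //; exact: open_lt.
  have kn2 : \forall h \near (0 : R), k h < 0 by exact: kc _ n.
  by apply: filterS2 kn2 kn.
have [] := eP (- (e / 2)); first by rewrite /ball /= sub0r normrN normrN gtr0_norm; lra.
by move=> h1; rewrite leNgt nmulr_rgt0 //; lra.
Qed.

Lemma near0_sign_even (k : R -> R) : {for 0, continuous k} ->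
  (\forall h \near (0 : R), h ^+ 2 * k h <= 0) -> k 0 <= 0.
Proof.
move=> kc kn; rewrite leNgt; apply/negP => k0.
have /nbhs_ballP[e /= e0 eP] : \forall h \near (0 : R), 0 < k h /\ h ^+ 2 * k h <= 0.
  have n : nbhs (k 0) [set x : R | 0 < x] by apply: open_nbhs_nbhs; split=> //; exact: open_gt.
  have kn2 : \forall h \near (0 : R), 0 < k h by exact: kc _ n.
  by apply: filterS2 kn2 kn.
have [] := eP (e / 2); first by rewrite /ball /= sub0r normrN gtr0_norm; lra.
by move=> h1; rewrite leNgt mulr_gt0 // exprn_gt0 //; lra.
Qed.

(* Hadamard's lemma twice: the linear terms vanish at a maximum, and the quadratic
   form of the remainders is nonpositive there. *)
Lemma local_max_real c p (f : M -> R) : atlas M c -> chart_dom c p ->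
  smooth_at p f -> (\forall q \near p, f q <= f p) ->
  exists G : 'I_3 -> 'I_3 -> M -> R,
  [/\ forall j k, smooth_at p (G j k),
      \forall q \near p, f q = f p + \sum_j \sum_k
        (chart_map c q 0 j - chart_map c p 0 j) * ((chart_map c q 0 k - chart_map c p 0 k) * G j k q)
    & forall a : 'rV[R]_3, \sum_j \sum_k a 0 j * (a 0 k * G j k p) <= 0].
Proof.
move=> ac cp fS fmax; have [g [gS _ gE]] := hadamard_at ac cp fS.
have line (a : 'rV[R]_3) : exists q : R -> M, [/\ q 0 = p, q @ (0 : R) --> p &
    \forall h \near (0 : R), forall j, chart_map c (q h) 0 j - chart_map c p 0 j = h * a 0 j].
  have [q [q0 qp qE]] := chart_line a ac cp; exists q; split=> //.
  by apply: filterS qE => h -> j; rewrite !mxE; ring.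
have g0 j : g j p = 0.
  have [q [q0 qp qE]] := line (delta_mx 0 j).
  have kc : {for (0 : R), continuous (fun h => g j (q h))}.
    rewrite /prop_for /continuous_at q0.
    apply: (cvg_comp _ _ qp); exact: smooth_at_continuous.
  rewrite -q0; apply: (near0_sign_odd kc).
  near=> h.
  have hE : forall k, chart_map c (q h) 0 k - chart_map c p 0 k = h * (delta_mx 0 j : 'rV[R]_3) 0 k by near: h.
  have fE : f (q h) = f p + \sum_k (chart_map c (q h) 0 k - chart_map c p 0 k) * g k (q h).
    by near: h; exact: qp _ gE.
  have : f (q h) <= f p by near: h; exact: qp _ fmax.
  rewrite fE gerDl (bigD1 j) //= big1 => [|k kj]; rewrite hE !mxE eqxx.
    by rewrite eqxx mulr1 addr0.
  by rewrite (negPf kj) mulr0 mul0r.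
have gH j := hadamard_at ac cp (gS j).
have [G GH] := choice gH.
have fE : \forall q \near p, f q = f p + \sum_j \sum_k
        (chart_map c q 0 j - chart_map c p 0 j) * ((chart_map c q 0 k - chart_map c p 0 k) * G j k q).
  have GE : \forall q \near p, forall j : 'I_3, g j q = g j p + \sum_k (chart_map c q 0 k - chart_map c p 0 k) * G j k q.
    by apply: filter_forall => j; have [] := GH j.
  apply: filterS2 gE GE => q -> GE; congr (_ + _); apply: eq_bigr => j _.
  by rewrite GE g0 add0r mulr_sumr.
exists G; split=> // [j k|a]; first by have [] := GH j.
have [q [q0 qp qE]] := line a.
have kc : {for (0 : R), continuous (fun h => \sum_j \sum_k a 0 j * (a 0 k * G j k (q h)))}.
  have S : smooth_at p (fun q' => \sum_j \sum_k a 0 j * (a 0 k * G j k q')).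
    apply: smooth_at_sum => j; apply: smooth_at_sum => k.
    apply: smooth_atM; first exact: smooth_at_cst.
    by apply: smooth_atM; [exact: smooth_at_cst|have [] := GH j].
  rewrite /prop_for /continuous_at q0.
  exact: (cvg_comp _ _ qp (smooth_at_continuous S)).
rewrite -q0; apply: (near0_sign_even kc).
near=> h.
have hE : forall k, chart_map c (q h) 0 k - chart_map c p 0 k = h * a 0 k by near: h.
have : f (q h) = f p + \sum_j \sum_k
  (chart_map c (q h) 0 j - chart_map c p 0 j) * ((chart_map c (q h) 0 k - chart_map c p 0 k) * G j k (q h)).
  by near: h; exact: qp _ fE.
have fm : f (q h) <= f p by near: h; exact: qp _ fmax.
move=> E; move: fm; rewrite E gerDl; congr (_ <= 0).
rewrite mulr_sumr; apply: eq_bigr => j _; rewrite mulr_sumr; apply: eq_bigr => k _.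
by rewrite !hE; ring.
Unshelve. all: by end_near. Qed.

(** The matrix of the frame in the coordinates is invertible, so all partial derivatives of [f]
    vanish in a ball, and so do the remainders in Hadamard's formula by its last clause. *)
Lemma frame_locally_constant p (f : M -> R) (e : 'I_3 -> M -> tvec M)
    (phi : 'I_3 -> M -> tvec M -> C) :
  smooth_at p f ->
  (\forall q \near p, [/\ forall k, tangent q (e k q), forall k, lin_on q (phi k q),
     forall k l, phi k q (e l q) = (k == l)%:R & forall k, e k q (rl f) = 0]) ->
  \forall q \near p, f q = f p.
Proof.
move=> fS H; have [c ac cp] := chart_at p.
have [V [[oV Vp] _ VS]] := smooth_at_chart ac cp fS.
have [V' [oV' V'p] HV'] := chart_pre_nbhs cp (filterI H (smooth_at_near fS)).
have /nbhs_ballP[r /= r0 rV] : nbhs (chart_map c p) (V `&` V').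
  by apply: open_nbhs_nbhs; split=> //; exact: openI.
have rV1 : ball (chart_map c p) r `<=` V by move=> x /rV[].
have [g [gS gE g0]] := hadamard r0 (fun k => class_C_sub rV1 (VS k)).
have D0 j y : ball (chart_map c p) r y -> 'D_(delta_mx 0 j) (f \o chart_inv c) y = 0.
  move=> /rV[_ /HV'[cq [[te lphi dual ef] qS] yE]].
  set q := chart_inv c y in cq te lphi dual ef qS yE.
  have [g' [gS' gD gE']] := hadamard_at ac cq qS.
  have uE := tan_dual_unit ac cq te lphi dual.
  set E := (X in X \in _) in uE.
  have : E *m (\col_j (g' j q)%:C%C) = 0.
    apply/colP => k; rewrite !mxE -[RHS](ef k) (tan_hadamard ac cq (te k) gS' gE').
    by apply: eq_bigr => i _; rewrite !mxE.
  move/(congr1 (mulmx (invmx E))); rewrite mulKmx // mulmx0 => /colP/(_ j).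
  by rewrite !mxE gD yE => /eqP; rewrite fmorph_eq0 => /eqP.
have nB : nbhs (chart_map c p) (ball (chart_map c p) r).
  by apply: open_nbhs_nbhs; split; [exact: ball_open|exact: ballxx].
apply: filterS (chart_map_nbhs cp nB) => q [cq Bq].
have := gE _ Bq; rewrite /= !chart_mapK // => ->; rewrite big1 ?addr0 // => j _.
by rewrite (g0 j) ?mulr0 // => y; exact: D0.
Qed.

End Tangent.

(** * The ring of smooth functions on an open set *)

Section SmoothRing.
Context {R : realType} {M : manifold3 R} (U : set M).
Local Notation C := R[i].

(* Smooth functions on U, extended by 0: equality on U is Leibniz equality. *)
Record sfun (oU : open U) := SFun {
  sf :> M -> C;
  sf_smooth : forall q, U q -> csmooth_at q sf;
  sf_out : forall q, ~ U q -> sf q = 0 }.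

Variable oU : open U.
Local Notation A := (sfun oU).

HB.instance Definition _ := gen_eqMixin A.
HB.instance Definition _ := gen_choiceMixin A.

Lemma sfun_eq (f g : A) : (forall q, U q -> f q = g q) -> f = g.
Proof.
case: f g => [f f1 f0] [g g1 g0] /= fg.
have E : f = g.
  by apply/funext => q; have [/fg//|nU] := pselect (U q); rewrite f0 ?g0.
by subst g; congr SFun; exact: Prop_irrelevance.
Qed.

Lemma open_near q : U q -> \forall z \near q, U z.
Proof. by move=> Uq; apply: open_nbhs_nbhs. Qed.

Lemma csmooth_eqU q (f g : M -> C) : U q -> (forall z, U z -> f z = g z) ->
  csmooth_at q f -> csmooth_at q g.
Proof. by move=> Uq fg; apply: csmooth_eq; apply: filterS (open_near Uq). Qed.

Definition cut (f : M -> C) : M -> C := fun q => if `[<U q>] then f q else 0.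

Lemma cutE f q : U q -> cut f q = f q.
Proof. by move=> Uq; rewrite /cut asboolT. Qed.

Lemma cut_smooth f : (forall q, U q -> csmooth_at q f) ->
  forall q, U q -> csmooth_at q (cut f).
Proof.
move=> fS q Uq; apply: csmooth_eqU (fS q Uq) => // z Uz; by rewrite cutE.
Qed.

Lemma cut_out f q : ~ U q -> cut f q = 0.
Proof. by move=> nU; rewrite /cut asboolF. Qed.

Definition mkS f (fS : forall q, U q -> csmooth_at q f) : A :=
  SFun oU (cut_smooth fS) (@cut_out f).

Lemma mkSE f fS q : U q -> @mkS f fS q = f q.
Proof. exact: cutE. Qed.

Definition sadd (f g : A) : A :=
  mkS (fun q Uq => csmoothD (sf_smooth f Uq) (sf_smooth g Uq)).
Definition smul (f g : A) : A :=
  mkS (fun q Uq => csmoothM (sf_smooth f Uq) (sf_smooth g Uq)).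
Definition sopp (f : A) : A := mkS (fun q Uq => csmoothN (sf_smooth f Uq)).
Definition scst (a : C) : A := mkS (fun q _ => csmooth_cst q a).
Definition scj (f : A) : A := mkS (fun q Uq => csmooth_conj (sf_smooth f Uq)).

Ltac sf_tac := move=> *; apply: sfun_eq => q Uq; rewrite /= !cutE //; ring.

Fact saddA : associative sadd. Proof. by sf_tac. Qed.
Fact saddC : commutative sadd. Proof. by sf_tac. Qed.
Fact sadd0 : left_id (scst 0) sadd. Proof. by sf_tac. Qed.
Fact saddN : left_inverse (scst 0) sopp sadd. Proof. by sf_tac. Qed.
HB.instance Definition _ := GRing.isZmodule.Build A saddA saddC sadd0 saddN.
Fact smulA : associative smul. Proof. by sf_tac. Qed.
Fact smulC : commutative smul. Proof. by sf_tac. Qed.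
Fact smul1 : left_id (scst 1) smul. Proof. by sf_tac. Qed.
Fact smulD : left_distributive smul +%R. Proof. by sf_tac. Qed.
HB.instance Definition _ := GRing.Zmodule_isComPzRing.Build A smulA smulC smul1 smulD.

Lemma sfD (f g : A) q : (f + g) q = f q + g q.
Proof.
have [Uq|nU] := pselect (U q); first exact: (@cutE (fun z => f z + g z)).
by rewrite !sf_out // addr0.
Qed.
Lemma sfM (f g : A) q : (f * g) q = f q * g q.
Proof.
have [Uq|nU] := pselect (U q); first exact: (@cutE (fun z => f z * g z)).
by rewrite !sf_out // mulr0.
Qed.
Lemma sfN (f : A) q : (- f) q = - f q.
Proof.
have [Uq|nU] := pselect (U q); first exact: (@cutE (fun z => - f z)).
by rewrite !sf_out // oppr0.
Qed.
Lemma sf0 q : (0 : A) q = 0.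
Proof. by rewrite /= /cut; case: asboolP. Qed.
Lemma sf1 q : U q -> (1 : A) q = 1.
Proof. exact: cutE. Qed.
Lemma sf_cst a q : U q -> scst a q = a.
Proof. exact: cutE. Qed.
Lemma sf_cj (f : A) q : scj f q = (f q)^*.
Proof.
have [Uq|nU] := pselect (U q); first exact: (@cutE (fun z => (f z)^*)).
by rewrite !sf_out // conjC0.
Qed.
Lemma sfX (f : A) n q : U q -> (f ^+ n) q = f q ^+ n.
Proof. by move=> Uq; elim: n => [|n IH]; rewrite ?expr0 ?sf1 // !exprS sfM IH. Qed.
Lemma sf_nat n q : U q -> (n%:R : A) q = n%:R.
Proof. by move=> Uq; elim: n => [|n IH]; rewrite ?mulr0n ?sf0 // !mulrS sfD sf1 // IH. Qed.

Lemma scjD f g : scj (f + g) = scj f + scj g.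
Proof. by apply: sfun_eq => q Uq; rewrite sf_cj !sfD !sf_cj conjD. Qed.
Lemma scjM f g : scj (f * g) = scj f * scj g.
Proof. by apply: sfun_eq => q Uq; rewrite sf_cj !sfM !sf_cj conjM. Qed.
Lemma scjK f : scj (scj f) = f.
Proof. by apply: sfun_eq => q Uq; rewrite !sf_cj conjK. Qed.

Section Derivation.
Variable X : M -> tvec M.
Hypothesis fX : vfield U X.

Definition sder (f : A) : A :=
  mkS (fun q (Uq : U q) => (fX Uq).2 f (sf_smooth f Uq)).

Lemma sderE (f : A) q : U q -> sder f q = X q f.
Proof. exact: cutE. Qed.

Lemma sderD f g : sder (f + g) = sder f + sder g.
Proof.
apply: sfun_eq => q Uq; rewrite sfD !sderE //; have [tX _] := fX Uq.
rewrite -(tanD tX (sf_smooth f Uq) (sf_smooth g Uq)); congr (X q _).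
by apply/funext => z; rewrite sfD.
Qed.

Lemma sderM f g : sder (f * g) = sder f * g + f * sder g.
Proof.
apply: sfun_eq => q Uq; rewrite sfD !sfM !sderE //; have [tX _] := fX Uq.
rewrite -(tanM tX (sf_smooth f Uq) (sf_smooth g Uq)); congr (X q _).
by apply/funext => z; rewrite sfM.
Qed.

Lemma field_near q (f g : M -> C) : U q -> (forall z, U z -> f z = g z) -> X q f = X q g.
Proof.
move=> Uq fg; have [tX _] := fX Uq; apply: (tan_near tX).
by apply: filterS (open_near Uq).
Qed.

Lemma sder_cst a : sder (scst a) = 0.
Proof.
apply: sfun_eq => q Uq; rewrite sderE // sf0; have [tX _] := fX Uq.
rewrite -(tan_cst a tX); apply: field_near => // z Uz; exact: sf_cst.
Qed.

Lemma sder_mk f fS q : U q -> sder (@mkS f fS) q = X q f.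
Proof. by move=> Uq; rewrite sderE //; apply: field_near => // z; exact: mkSE. Qed.

End Derivation.

End SmoothRing.

(** * Vector fields and brackets *)

Section Fields.
Context {R : realType} {M : manifold3 R}.
Local Notation C := R[i].

Lemma vfield_sub (U V : set M) X : V `<=` U -> vfield U X -> vfield V X.
Proof. by move=> VU H q /VU; exact: H. Qed.

Lemma vfield_fconj (U : set M) X : vfield U X -> vfield U (fconj X).
Proof.
move=> H q Uq; have [tX sX] := H q Uq; split; first exact: tangent_vconj.
move=> f fS; rewrite /fconj /vconj; apply: csmooth_conj; apply: sX; exact: csmooth_conj.
Qed.

Lemma vfield_lcomb (U : set M) (a : M -> C) X Y :
  (forall q, U q -> csmooth_at q a) -> vfield U X -> vfield U Y ->
  vfield U (fun q => lcomb (a q) (X q) (Y q)).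
Proof.
move=> aS HX HY q Uq; have [tX sX] := HX q Uq; have [tY sY] := HY q Uq.
split; first exact: tangent_lcomb.
move=> f fS; apply: csmoothD; last exact: sY.
by apply: csmoothM; [exact: aS|exact: sX].
Qed.

Lemma vfield0 (U : set M) : vfield U (fun _ => (fun=> 0)).
Proof. by move=> q _; split; [exact: tangent0|move=> *; exact: csmooth_cst]. Qed.

Lemma csmooth_lcomb q (a : C) (f g : M -> C) : csmooth_at q f -> csmooth_at q g ->
  csmooth_at q (lcomb a f g).
Proof.
by move=> fS gS; apply: csmoothD => //; apply: csmoothM => //; exact: csmooth_cst.
Qed.

Lemma vfield_bracket (U : set M) X Y : open U -> vfield U X -> vfield U Y ->
  vfield U (bracket X Y).
Proof.
move=> oU HX HY q Uq; have [tX sX] := HX q Uq; have [tY sY] := HY q Uq.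
have nU := open_near oU Uq.
have D Z Z' : vfield U Z -> vfield U Z' -> forall a f g, csmooth_at q f -> csmooth_at q g ->
  Z q (fun z => Z' z (lcomb a f g)) = a * Z q (fun z => Z' z f) + Z q (fun z => Z' z g).
  move=> HZ HZ' a f g fS gS; have [tZ _] := HZ q Uq; have [tZ' sZ'] := HZ' q Uq.
  have [_ zl _] := tZ; rewrite -(zl a _ _ (sZ' _ fS) (sZ' _ gS)); apply: (tan_near tZ).
  apply: filterS3 nU (csmooth_near fS) (csmooth_near gS) => z Uz fz gz.
  by have [[_ zl' _] _] := HZ' z Uz; exact: zl'.
(* The products of two first derivatives are symmetric in [Z] and [Z'], hence cancel in the
   bracket. *)
have L Z Z' : vfield U Z -> vfield U Z' -> forall f g, csmooth_at q f -> csmooth_at q g ->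
  Z q (fun z => Z' z (fun y => f y * g y)) = Z q (fun z => Z' z f) * g q + Z' q f * Z q g
     + (Z q f * Z' q g + f q * Z q (fun z => Z' z g)).
  move=> HZ HZ' f g fS gS; have [tZ _] := HZ q Uq; have [tZ' sZ'] := HZ' q Uq.
  have Sf := sZ' _ fS; have Sg := sZ' _ gS.
  rewrite -(tanM tZ Sf gS) -(tanM tZ fS Sg) -(tanD tZ (csmoothM Sf gS) (csmoothM fS Sg)).
  apply: (tan_near tZ).
  apply: filterS3 nU (csmooth_near fS) (csmooth_near gS) => z Uz fz gz.
  exact: tanM (HZ' z Uz).1 fz gz.
split; first split.
- by move=> f fS; rewrite /bracket asboolF.
- move=> a f g fS gS; rewrite /bracket !asboolT //; last exact: csmooth_lcomb.
  by rewrite (D X Y) // (D Y X) //; ring.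
- move=> f g fS gS; rewrite /bracket !asboolT //; last exact: csmoothM.
  by rewrite (L X Y) // (L Y X) //; ring.
move=> f fS; have : csmooth_at q (fun z => X z (fun y => Y y f) - Y z (fun y => X y f)).
  by apply: csmoothD; [|apply: csmoothN]; [apply: sX; apply: sY|apply: sY; apply: sX].
apply: csmooth_eq; have nS := csmooth_near fS; apply: filterS nS => z zS.
by rewrite /bracket asboolT.
Qed.

Lemma bracketE (U : set M) (oU : open U) X Y (fX : vfield U X) (fY : vfield U Y)
    (f : sfun oU) q : U q ->
  bracket X Y q f = (sder fX (sder fY f) - sder fY (sder fX f)) q.
Proof.
move=> Uq; rewrite /bracket asboolT; last exact: sf_smooth.
by rewrite sfD sfN !sder_mk.
Qed.

End Fields.

(** * Differential algebra of a torsion-free unitary frame *)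

Section DiffAlgebra.
Context {A : comPzRingType}.

(** [lc1] and [lc2] derive an equation from one or two known ones: the differences of the sides are
    matched by [ring], with the multiplier [c] given by hand. *)
Lemma lc1 (x y a b : A) : a = b -> x - y = a - b -> x = y.
Proof. by move=> -> /eqP; rewrite subrr subr_eq0 => /eqP. Qed.
Lemma lc2 (c x y a b a' b' : A) : a = b -> a' = b' ->
  x - y = (a - b) + c * (a' - b') -> x = y.
Proof. by move=> -> -> /eqP; rewrite !subrr mulr0 addr0 subr_eq0 => /eqP. Qed.

Definition derivation (D : A -> A) : Prop :=
  (forall f g, D (f + g) = D f + D g) /\
  (forall f g, D (f * g) = D f * g + f * D g).

Section Rules.
Variables (D : A -> A) (dD : derivation D).
Lemma derD f g : D (f + g) = D f + D g. Proof. exact: dD.1. Qed.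
Lemma derM f g : D (f * g) = D f * g + f * D g. Proof. exact: dD.2. Qed.
Lemma der0 : D 0 = 0.
Proof. by apply: (addrI (D 0)); rewrite -derD !addr0. Qed.
Lemma der1 : D 1 = 0.
Proof. by apply: (addrI (D 1)); rewrite addr0 -{3}[1]mulr1 derM mulr1 mul1r. Qed.
Lemma derN f : D (- f) = - D f.
Proof. by apply/eqP; rewrite -addr_eq0 -derD addNr der0. Qed.
Lemma derB f g : D (f - g) = D f - D g.
Proof. by rewrite derD derN. Qed.
Lemma der_nat n : D n%:R = 0.
Proof. by elim: n => [|n IH]; rewrite ?mulr0n ?der0 // mulrS derD der1 IH addr0. Qed.
Lemma der2 f : D (f ^+ 2) = 2 * f * D f.
Proof. by rewrite expr2 derM; ring. Qed.
Lemma der3 f : D (f ^+ 3) = 3 * f ^+ 2 * D f.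
Proof. by rewrite exprS derM der2; ring. Qed.
Definition derE := (derM, derB, derD, derN, der2, der3, der_nat, der0, der1).
End Rules.

(* Structure equations of a torsion-free unitary frame Z = Z_1, Zb = Z_{\bar 1},
   with p = omega(Z), pb = conj p = - omega(Zb), r = omega(T). *)
Record torsion_free (Z Zb T : A -> A) (io p pb r W : A) : Prop := TorsionFree {
  tfZ : derivation Z; tfZb : derivation Zb; tfT : derivation T;
  tf_io : io * io = -1; tf_Zio : Z io = 0; tf_Zbio : Zb io = 0; tf_Tio : T io = 0;
  tf_ZZb : forall f, Z (Zb f) = Zb (Z f) - io * T f + pb * Z f - p * Zb f;
  tf_TZ : forall f, T (Z f) = Z (T f) + r * Z f;
  tf_TZb : forall f, T (Zb f) = Zb (T f) - r * Zb f;
  tf_Tp : T p = Z r + r * p;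
  tf_Tpb : T pb = - Zb r - r * pb;
  tf_W : W = - Z pb - Zb p + io * r - 2 * p * pb }.

(* The Jacobi identity for T, Z, Zb forces omega(T) to be imaginary. *)
Lemma jacobi_T (Z Zb T : A -> A) (io p pb r rb t tb : A) :
  derivation Z -> derivation Zb -> derivation T -> io * io = -1 ->
  Z io = 0 -> Zb io = 0 -> T io = 0 ->
  (forall f, Z (Zb f) = Zb (Z f) - io * T f + pb * Z f - p * Zb f) ->
  (forall f, Z (T f) = T (Z f) - r * Z f + tb * Zb f) ->
  (forall f, Zb (T f) = T (Zb f) - rb * Zb f + t * Z f) ->
  (forall a b c : A, (forall f, a * T f + b * Z f + c * Zb f = 0) -> a = 0) ->
  rb = - r.
Proof.
move=> dZ dZb dT io2 Zio Zbio Tio c1 c2 c3 indep.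
have : io * (r + rb) = 0.
  apply: (indep _ (T pb - (r + rb) * pb + Z t + Zb r + pb * r + p * t)
    (- T p + (r + rb) * p - Z rb - Zb tb - pb * tb - p * rb)) => f.
  have := c1 (T f); rewrite c3 c2.
  rewrite [Z (_ + _)]derD // [Z (_ - _)]derB // [Z (rb * _)]derM // [Z (t * _)]derM //.
  rewrite c2 c1 [T (_ - _)]derB // [T (_ + _)]derD // [T (_ - _)]derB // !(derM dT) Tio.
  rewrite [Zb (_ + _)]derD // [Zb (_ - _)]derB // [Zb (r * _)]derM // [Zb (tb * _)]derM //.
  rewrite c3 => h; apply: (lc1 h); ring.
move/(congr1 (fun x => io * x)); rewrite mulr0 mulrA io2 mulN1r => /eqP.
by rewrite oppr_eq0 addrC addr_eq0 => /eqP.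
Qed.

Section TorsionFree.
Variables (Z Zb T : A -> A) (io p pb r W : A).
Hypothesis tf : torsion_free Z Zb T io p pb r W.
Let dZ := tfZ tf. Let dZb := tfZb tf. Let dT := tfT tf.
Let ZE := derE dZ. Let ZbE := derE dZb. Let TE := derE dT.
Let io2 := tf_io tf. Let Zio := tf_Zio tf. Let Zbio := tf_Zbio tf. Let Tio := tf_Tio tf.
Let ZZb := tf_ZZb tf. Let TZ := tf_TZ tf. Let TZb := tf_TZb tf.
Let Tp := tf_Tp tf. Let Tpb := tf_Tpb tf. Let WE := tf_W tf.

(** The two summands are [f_{,1 \bar 1}] and [f_{,\bar 1 1}]: the signs come from omega(Zb) = - pb
    and conj omega(Z) = - p. *)
Definition lap (f : A) := Zb (Z f) + pb * Z f + (Z (Zb f) + p * Zb f).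

(** The Bianchi identity in the absence of torsion: after moving [T] inwards, the commutator of [Z]
    and [Zb] on [r] cancels the term [io * T r]. *)
Lemma tf_TW : T W = 0.
Proof.
rewrite WE !TE Tio !TZ !TZb !Tp !Tpb !ZE !ZbE ZZb.
have e : io * (io * T r) = - T r by rewrite mulrA io2 mulN1r.
ring.
Qed.

Section Potential.
Variable w : A.
Hypothesis Zw : Z (Z w) = p * Z w.
Hypothesis Zbw : Zb (Zb w) = pb * Zb w.

(** Since [w_{,11} = 0], the derivative [w_{,1 \bar 1 1}] comes from commuting covariant derivatives
    only, which produces the curvature and a [T] term. *)
Lemma tf_Zh : Z (Zb (Z w) + pb * Z w) = - W * Z w - io * Z (T w).
Proof. by rewrite WE !ZE ZZb Zw !ZbE TZ; ring. Qed.

Lemma tf_ZZT : Z (Z (T w)) = p * Z (T w).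
Proof.
have e : Z (T w) = T (Z w) - r * Z w by rewrite TZ; ring.
by rewrite {1}e !ZE -[Z (T (Z w))](addrK (r * Z (Z w))) -TZ Zw !TE Tp TZ; ring.
Qed.

Section Invariant.
Hypothesis Tw : T w = 0.

Lemma tf_Zbh : Zb (Zb (Z w) + pb * Z w) = - W * Zb w.
Proof.
have -> : Zb (Z w) + pb * Z w = Z (Zb w) + p * Zb w by rewrite ZZb Tw; ring.
have e : Zb (Z (Zb w)) = Z (Zb (Zb w)) + io * T (Zb w) - pb * Z (Zb w) + p * Zb (Zb w).
  by rewrite [Z (Zb (Zb w))]ZZb; ring.
by rewrite !ZbE e Zbw !ZE TZb Tw WE !ZbE; ring.
Qed.

Lemma tf_Th : T (Zb (Z w) + pb * Z w) = 0.
Proof. by rewrite !TE TZb TZ Tw Tpb !ZE !ZbE; ring. Qed.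

Lemma tf_lap : lap w = 2 * (Zb (Z w) + pb * Z w).
Proof. by rewrite /lap ZZb Tw; ring. Qed.
End Invariant.
End Potential.

Section Curvature.
Hypothesis Zw : Z (Z W) = p * Z W.
Hypothesis Zbw : Zb (Zb W) = pb * Zb W.
Local Notation c2 := (lap W + W ^+ 2).
Local Notation d6 := (6 * Z W * Zb W - 3 * c2 * W + W ^+ 3).

(** As T W = 0, [lap W] is twice [h = Zb (Z W) + pb * Z W], and [tf_Zh] reads Z h = - W Z W, which
    is minus half of Z (W^2). *)
Lemma tf_c2 : [/\ Z c2 = 0, Zb c2 = 0 & T c2 = 0].
Proof.
have TW := tf_TW; rewrite (tf_lap TW); split.
- by rewrite [Z (_ + _)]derD // [Z (2 * _)]derM // der_nat // tf_Zh // TW !ZE; ring.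
- by rewrite [Zb (_ + _)]derD // [Zb (2 * _)]derM // der_nat // tf_Zbh // !ZbE; ring.
- by rewrite [T (_ + _)]derD // [T (2 * _)]derM // der_nat // tf_Th // !TE TW; ring.
Qed.

(** An energy integral: Z (Z W * Zb W) is Z W times (c2 - W^2) / 2, an exact derivative because [c2]
    is annihilated by the frame. *)
Lemma tf_d6 : [/\ Z d6 = 0, Zb d6 = 0 & T d6 = 0].
Proof.
have [c1 c1b c0] := tf_c2; have TW := tf_TW.
have lE : lap W = 2 * (Zb (Z W) + pb * Z W) by exact: tf_lap.
set c := c2 in c1 c1b c0 *.
have cE : c = 2 * (Zb (Z W) + pb * Z W) + W ^+ 2 by rewrite /c lE.
clearbody c; split.
- by rewrite !ZE c1 Zw ZZb TW cE; ring.
- by rewrite !ZbE c1b Zbw cE; ring.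
- by rewrite !TE c0 TZ TZb TW !ZE !ZbE; ring.
Qed.
End Curvature.

(** * Structures modelled on the sphere *)

Section Sphere.
Variables (f1 f2 g1 g2 N s : A).
Hypotheses (Zbf1 : Zb f1 = 0) (Zbf2 : Zb f2 = 0) (Zg1 : Z g1 = 0) (Zg2 : Z g2 = 0).
Hypothesis fg : f1 * g1 + f2 * g2 = 1.
Hypothesis NE : N = Z f1 * Zb g1 + Z f2 * Zb g2.
Hypothesis sN : s * N = 1.

(** The complex tangent space of the sphere in C^2 is a line, spanned by [(Z f1, Z f2)]; pairing
    with [(Zb g1, Zb g2)] gives the coefficient, because that pairing is [N] on the spanning
    vector. *)
Lemma sphere_par (b1 b2 : A) : b1 * g1 + b2 * g2 = 0 ->
  Z f1 * g1 + Z f2 * g2 = 0 ->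
  b1 = s * (b1 * Zb g1 + b2 * Zb g2) * Z f1 /\
  b2 = s * (b1 * Zb g1 + b2 * Zb g2) * Z f2.
Proof.
move=> bg ag.
have w : b1 * Z f2 = b2 * Z f1.
  apply/eqP; rewrite -subr_eq0; apply/eqP; rewrite -[LHS]mulr1 -fg.
  have -> : (b1 * Z f2 - b2 * Z f1) * (f1 * g1 + f2 * g2) =
    (b1 * g1 + b2 * g2) * (f1 * Z f2 - f2 * Z f1)
    - (Z f1 * g1 + Z f2 * g2) * (f1 * b2 - f2 * b1) by ring.
  by rewrite bg ag; ring.
split.
  have -> : s * (b1 * Zb g1 + b2 * Zb g2) * Z f1 =
    s * (b1 * (Z f1 * Zb g1) + (b2 * Z f1) * Zb g2) by ring.
  rewrite -w; have -> : s * (b1 * (Z f1 * Zb g1) + b1 * Z f2 * Zb g2) =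
    (s * (Z f1 * Zb g1 + Z f2 * Zb g2)) * b1 by ring.
  by rewrite -NE sN mul1r.
have -> : s * (b1 * Zb g1 + b2 * Zb g2) * Z f2 =
  s * ((b1 * Z f2) * Zb g1 + b2 * (Z f2 * Zb g2)) by ring.
rewrite w; have -> : s * (b2 * Z f1 * Zb g1 + b2 * (Z f2 * Zb g2)) =
  (s * (Z f1 * Zb g1 + Z f2 * Zb g2)) * b2 by ring.
by rewrite -NE sN mul1r.
Qed.

Let ag : Z f1 * g1 + Z f2 * g2 = 0.
Proof. by have := congr1 Z fg; rewrite !ZE Zg1 Zg2 !mulr0 !addr0. Qed.

Let fbg : f1 * Zb g1 + f2 * Zb g2 = 0.
Proof. by have := congr1 Zb fg; rewrite !ZbE Zbf1 Zbf2 !mul0r !add0r. Qed.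

Let ioK a : io * (io * a) = - a. Proof. by rewrite mulrA io2 mulN1r. Qed.

Let ZbZf f : Zb f = 0 -> Zb (Z f) = io * T f - pb * Z f.
Proof.
move=> h; have := ZZb f; rewrite h !ZE mulr0 subr0 => h2.
have -> : Zb (Z f) = Zb (Z f) - io * T f + pb * Z f + io * T f - pb * Z f by ring.
by rewrite -h2; ring.
Qed.

Let ZZbg g : Z g = 0 -> Z (Zb g) = - (io * T g) - p * Zb g.
Proof. by move=> h; rewrite ZZb h !ZbE; ring. Qed.

Let Tfg : T f1 * g1 + T f2 * g2 = io * N.
Proof.
have := congr1 Zb ag; rewrite !ZbE !ZbZf // => h.
have h' : io * (T f1 * g1 + T f2 * g2) = - N.
  by apply: (lc2 (c := pb) h ag); rewrite NE; ring.
by apply: oppr_inj; rewrite -[LHS]ioK h'; ring.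
Qed.

Let TZfg : T (Z f1) * g1 + T (Z f2) * g2 = io * Z N.
Proof.
have := congr1 Z Tfg; rewrite !ZE Zg1 Zg2 Zio => h.
have -> : io * Z N = 0 * N + io * Z N by ring.
rewrite -h !TZ.
have -> : (Z (T f1) + r * Z f1) * g1 + (Z (T f2) + r * Z f2) * g2 =
  Z (T f1) * g1 + Z (T f2) * g2 + r * (Z f1 * g1 + Z f2 * g2) by ring.
by rewrite ag; ring.
Qed.

Let ZfTg : Z f1 * T g1 + Z f2 * T g2 = - (io * Z N).
Proof.
have := congr1 T ag; rewrite !TE => h; by apply: (lc2 (c := -1) h TZfg); ring.
Qed.

Let b_g : (Z (Z f1) - p * Z f1) * g1 + (Z (Z f2) - p * Z f2) * g2 = 0.
Proof.
have := congr1 Z ag; rewrite !ZE Zg1 Zg2 => h.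
by apply: (lc2 (c := - p) h ag); ring.
Qed.

Let alphaE : (Z (Z f1) - p * Z f1) * Zb g1 + (Z (Z f2) - p * Z f2) * Zb g2 = 2 * Z N.
Proof.
have e : Z N = Z (Z f1) * Zb g1 + Z (Z f2) * Zb g2 - io * (Z f1 * T g1 + Z f2 * T g2)
    - p * (Z f1 * Zb g1 + Z f2 * Zb g2).
  by rewrite NE !ZE !ZZbg //; ring.
rewrite ZfTg mulrN ioK opprK in e.
have -> : 2 * Z N = Z N + Z N by ring.
by rewrite {1}e; ring.
Qed.

Let ZZf : Z (Z f1) = (p + 2 * s * Z N) * Z f1 /\ Z (Z f2) = (p + 2 * s * Z N) * Z f2.
Proof.
have [e1 e2] := sphere_par b_g ag; rewrite alphaE in e1 e2.
split; [rewrite -[LHS](subrK (p * Z f1)) e1|rewrite -[LHS](subrK (p * Z f2)) e2]; ring.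
Qed.

(** [Tfg] fixes the component of [T f] along [f]; what remains is complex tangent, and [sphere_par]
    recovers it from its pairing with [Zb g]. *)
Let Tf : T f1 = io * N * f1 + io * s * Zb N * Z f1 /\ T f2 = io * N * f2 + io * s * Zb N * Z f2.
Proof.
have h0 : (T f1 - io * N * f1) * g1 + (T f2 - io * N * f2) * g2 = 0.
  have -> : (T f1 - io * N * f1) * g1 + (T f2 - io * N * f2) * g2 =
    (T f1 * g1 + T f2 * g2) - io * N * (f1 * g1 + f2 * g2) by ring.
  by rewrite Tfg fg; ring.
have [e1 e2] := sphere_par h0 ag.
have h1 : f1 * T g1 + f2 * T g2 = - (io * N).
  have := congr1 T fg; rewrite !TE => h; by apply: (lc2 (c := -1) h Tfg); ring.
have h2 : f1 * T (Zb g1) + f2 * T (Zb g2) = - (io * Zb N).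
  have := congr1 Zb h1; rewrite !ZbE Zbf1 Zbf2 Zbio => h.
  rewrite !TZb.
  have -> : f1 * (Zb (T g1) - r * Zb g1) + f2 * (Zb (T g2) - r * Zb g2) =
    (0 * T g1 + f1 * Zb (T g1) + (0 * T g2 + f2 * Zb (T g2))) - r * (f1 * Zb g1 + f2 * Zb g2).
    by ring.
  by rewrite h fbg; ring.
have h3 : (T f1 - io * N * f1) * Zb g1 + (T f2 - io * N * f2) * Zb g2 = io * Zb N.
  have := congr1 T fbg; rewrite !TE => h.
  have -> : (T f1 - io * N * f1) * Zb g1 + (T f2 - io * N * f2) * Zb g2 =
    (T f1 * Zb g1 + f1 * T (Zb g1) + (T f2 * Zb g2 + f2 * T (Zb g2)))
     - (f1 * T (Zb g1) + f2 * T (Zb g2)) - io * N * (f1 * Zb g1 + f2 * Zb g2) by ring.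
  by rewrite h h2 fbg; ring.
rewrite h3 in e1 e2.
split; [rewrite -[LHS](subrK (io * N * f1)) e1|rewrite -[LHS](subrK (io * N * f2)) e2]; ring.
Qed.

Let ZN : Z N = - N ^+ 2 * Z s /\ Zb N = - N ^+ 2 * Zb s.
Proof.
split.
  have := congr1 Z sN; rewrite !ZE => h.
  have -> : Z N = N * (Z s * N + s * Z N) - N ^+ 2 * Z s - Z N * (s * N - 1) by ring.
  by rewrite h sN; ring.
have := congr1 Zb sN; rewrite !ZbE => h.
have -> : Zb N = N * (Zb s * N + s * Zb N) - N ^+ 2 * Zb s - Zb N * (s * N - 1) by ring.
by rewrite h sN; ring.
Qed.

Let R1 f : f = f1 \/ f = f2 -> Z (Z f) = (p - 2 * N * Z s) * Z f.
Proof.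
have [e1 e2] := ZZf; have [n1 n2] := ZN.
have e : 2 * s * Z N = - (2 * N * Z s).
  rewrite n1; have -> : 2 * s * (- N ^+ 2 * Z s) = - (2 * (s * N) * N * Z s) by ring.
  by rewrite sN; ring.
by move=> [->|->]; rewrite ?e1 ?e2 e; ring.
Qed.

Let R2 f : f = f1 \/ f = f2 -> T f = io * N * f - io * N * Zb s * Z f.
Proof.
have [e1 e2] := Tf; have [n1 n2] := ZN.
have e : io * s * Zb N = - (io * N * Zb s).
  rewrite n2; have -> : io * s * (- N ^+ 2 * Zb s) = - (io * (s * N) * N * Zb s) by ring.
  by rewrite sN; ring.
by move=> [->|->]; rewrite ?e1 ?e2 e; ring.
Qed.

(** [f] and [Z f] are independent vectors of C^2: against [g] they pair to 1 and 0, against [Zb g]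
    to 0 and [N]. *)
Let extract (a b : A) : (forall f, f = f1 \/ f = f2 -> a * f + b * Z f = 0) ->
  a = 0 /\ b = 0.
Proof.
move=> h; have h1 := h f1 (or_introl erefl); have h2 := h f2 (or_intror erefl).
have a0 : a = 0.
  have -> : a = a * (f1 * g1 + f2 * g2) by rewrite fg mulr1.
  have -> : a * (f1 * g1 + f2 * g2) = (a * f1 + b * Z f1) * g1 + (a * f2 + b * Z f2) * g2
    - b * (Z f1 * g1 + Z f2 * g2) by ring.
  by rewrite h1 h2 ag; ring.
split=> //; have -> : b = s * (b * (Z f1 * Zb g1 + Z f2 * Zb g2)).
  rewrite -NE; have -> : s * (b * N) = (s * N) * b by ring.
  by rewrite sN mul1r.
have -> : b * (Z f1 * Zb g1 + Z f2 * Zb g2) = (a * f1 + b * Z f1) * Zb g1 + (a * f2 + b * Z f2) * Zb g2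
  - a * (f1 * Zb g1 + f2 * Zb g2) by ring.
by rewrite h1 h2 fbg; ring.
Qed.

Let zt := io * N - io * Z (N * Zb s) - io * N * Zb s * (p - 2 * N * Z s).

Let ZTf f : f = f1 \/ f = f2 -> Z (T f) = io * Z N * f + zt * Z f.
Proof. by move=> hf; rewrite (R2 hf) /zt !ZE Zio (R1 hf); ring. Qed.

(** [th / s] is the pull-back of the standard contact form of the sphere. Both forms being
    torsion-free, the factor satisfies [s_{,11} = 0]; here this is the [f]-component of the relation
    between [T] and [Z] applied to [Z f]. *)
Lemma sphere_Zs : Z (Z s) = p * Z s.
Proof.
have [n1 _] := ZN; have n11 : Z (Z N) = 2 * N ^+ 3 * Z s ^+ 2 - N ^+ 2 * Z (Z s).
  by rewrite n1 !ZE n1; ring.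
pose k := p - 2 * N * Z s.
have [] := @extract (k * (io * Z N) - io * Z (Z N))
  (T k + k * (zt + r) - (io * Z N + Z zt + zt * k + Z r + r * k + r * k)).
  move=> f hf; have := TZ (Z f).
  rewrite (R1 hf) -/k [T (k * Z f)]derM // !TZ (ZTf hf) !(derD dZ, derM dZ) Zio (R1 hf) -/k => h.
  by apply: (lc1 h); ring.
rewrite n11 n1 /k => h _.
have e : N ^+ 2 * (Z (Z s) - p * Z s) = 0.
  have -> : N ^+ 2 * (Z (Z s) - p * Z s) = - (io * (io * (N ^+ 2 * (Z (Z s) - p * Z s)))).
    by rewrite ioK opprK.
  have -> : io * (N ^+ 2 * (Z (Z s) - p * Z s)) = 0 by rewrite -h; ring.
  by rewrite mulr0 oppr0.
have := congr1 (fun x => s ^+ 2 * x) e; rewrite mulrA -exprMn sN expr1n mul1r mulr0.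
by move/eqP; rewrite subr_eq0 => /eqP.
Qed.

(** The conformal law of the curvature for [th / s], the pull-back of a form of curvature 2. It is
    the [Z f]-component of the commutator of [Z] and [Zb] applied to [Z f]. *)
Lemma sphere_W : W = N * (2 - 2 * lap s + 6 * N * Z s * Zb s).
Proof.
have [n1 n2] := ZN; pose k := p - 2 * N * Z s; pose q := N * Zb s - pb.
have Zbf f : f = f1 \/ f = f2 -> Zb f = 0 by move=> [->|->].
have ZbZ f : f = f1 \/ f = f2 -> Zb (Z f) = - (N * f) + q * Z f.
  move=> hf; rewrite ZbZf ?Zbf // (R2 hf) /q.
  have -> : io * (io * N * f - io * N * Zb s * Z f) = io * (io * (N * f)) - io * (io * (N * Zb s * Z f)) by ring.
  by rewrite !ioK; ring.
have [] := @extract (- Z N - (- (k * N) + Z N + p * N))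
  (- N + Z q + q * k - (Zb k + k * q - io * (zt + r) + pb * k - p * q)).
  move=> f hf; have := ZZb (Z f).
  rewrite (ZbZ _ hf) (R1 hf) -/k TZ (ZTf hf) !(derD dZ, derM dZ, derN dZ) (R1 hf) -/k.
  rewrite [Zb (k * Z f)]derM // (ZbZ _ hf) => h.
  apply: (lc1 h); have -> : io * (io * Z N * f + zt * Z f + r * Z f) =
    io * (io * (Z N * f)) + io * (zt * Z f + r * Z f) by ring.
  by rewrite ioK; ring.
move=> _ h; apply: (lc1 h); rewrite /zt /q /k /lap !ZE !ZbE n1 n2 WE.
have e1 x : io * (io * x) = - x := ioK x.
have -> : io * (io * N - io * (- N ^+ 2 * Z s * Zb s + N * Z (Zb s)) -
   io * N * Zb s * (p - 2 * N * Z s) + r) =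
  io * (io * (N - (- N ^+ 2 * Z s * Zb s + N * Z (Zb s)) - N * Zb s * (p - 2 * N * Z s))) + io * r by ring.
by rewrite e1; ring.
Qed.


(** [sphere_W] expresses [W] through [s]. By [s_{,11} = 0], with its consequences [tf_Zh] and
    [tf_ZZT], the derivatives that arise under [Z] reduce to finitely many expressions in [s], [h]
    and [T s], and [ring] compares polynomials. *)
Lemma sphere_ZZW : Z (Z W) = p * Z W.
Proof.
have [n1 n2] := ZN; have Zs := sphere_Zs.
pose h := Zb (Z s) + pb * Z s.
have lE : lap s = 2 * h - io * T s by rewrite /lap /h ZZb; ring.
have ZbE' : Z (Zb s) = h - io * T s - p * Zb s by rewrite /h ZZb; ring.
have Zh : Z h = - W * Z s - io * Z (T s) by exact: tf_Zh.
have ZZTs : Z (Z (T s)) = p * Z (T s) by exact: tf_ZZT.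
have W' : W = N * (2 - 4 * h + 2 * io * T s + 6 * N * Z s * Zb s).
  by rewrite sphere_W lE; ring.
clearbody h.
have V : Z W = N * (3 * W * Z s + 6 * io * Z (T s) - 6 * N ^+ 2 * Z s ^+ 2 * Zb s
    + 6 * N * Z s * (h - io * T s)).
  by rewrite {1}W' !ZE n1 Zio Zh ZbE' Zs; rewrite W'; ring.
by rewrite {1}V !ZE n1 Zio Zh ZbE' Zs ZZTs V; rewrite W'; ring.
Qed.
End Sphere.
End TorsionFree.

(** * Transformation laws under a change of contact form *)

Section Conformal.
Variables (Z Zb T : A -> A) (io p pb r W : A).
Hypothesis tf : torsion_free Z Zb T io p pb r W.
Let dZ := tfZ tf. Let dZb := tfZb tf. Let dT := tfT tf.
Let ZE := derE dZ. Let ZbE := derE dZb. Let TE := derE dT.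
Let io2 := tf_io tf. Let Zio := tf_Zio tf. Let Zbio := tf_Zbio tf. Let Tio := tf_Tio tf.
Let ZZb := tf_ZZb tf. Let TZ := tf_TZ tf. Let TZb := tf_TZb tf.
Let WE := tf_W tf.
Let ioK a : io * (io * a) = - a. Proof. by rewrite mulrA io2 mulN1r. Qed.

Hypothesis indep : forall a b c : A,
  (forall f, a * T f + b * Z f + c * Zb f = 0) -> [/\ a = 0, b = 0 & c = 0].

(* A frame Z' = z Z, Zb' = zb Zb, T' = u T + x Z + xb Zb of the contact form th / u. *)
Variables (z zb v u x xb p' pb' r' tb' W' : A).
Hypothesis vu : v * u = 1.
Hypothesis c1 : forall f, z * Z (zb * Zb f) = zb * Zb (z * Z f)
  - io * (u * T f + x * Z f + xb * Zb f) + pb' * (z * Z f) - p' * (zb * Zb f).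
Hypothesis c2 : forall f, z * Z (u * T f + x * Z f + xb * Zb f) =
  u * T (z * Z f) + x * Z (z * Z f) + xb * Zb (z * Z f) - r' * (z * Z f) + tb' * (zb * Zb f).

Let eqs1 : [/\ u = z * zb, pb' * z = z * zb * pb - zb * Zb z + io * x
   & p' * zb = z * zb * p - z * Z zb - io * xb].
Proof.
have [h0 h1 h2] := indep (a := io * (z * zb) - io * u)
    (b := pb' * z - z * zb * pb + zb * Zb z - io * x) (c := z * zb * p - z * Z zb - io * xb - p' * zb)
    (fun f => ltac:(have := c1 f; rewrite !ZE !ZbE ZZb => h; apply: (lc1 (esym h)); ring)).
split; last 2 first.
- by apply: (lc1 h1); ring.
- by apply: (lc1 (esym h2)); ring.
- have := congr1 (fun w => io * w) h0; rewrite mulrBr !ioK mulr0 => h.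
  by apply: (lc1 h); ring.
Qed.

Lemma conformal_u : u = z * zb. Proof. by case: eqs1. Qed.

Let y := v * zb. Let yb := v * z.
Let yz : y * z = 1. Proof. by rewrite -vu conformal_u /y; ring. Qed.
Let ybzb : yb * zb = 1. Proof. by rewrite -vu conformal_u /yb; ring. Qed.

Let cancz a b : z * a = z * b -> a = b.
Proof. by move=> h; rewrite -[a]mul1r -[b]mul1r -yz -!mulrA h. Qed.
Let canczb a b : zb * a = zb * b -> a = b.
Proof. by move=> h; rewrite -[a]mul1r -[b]mul1r -ybzb -!mulrA h. Qed.

(** As in [eqs1], the commutation relation of the new frame is expanded in the old one and its
    coefficients are separated by [indep]. The coefficient of [Zb] is the transformation law of the
    torsion. *)
Let eqs2 : xb = - (io * Z u) /\
   r' * z = z * u * r - z * Z x - z * xb * pb + u * T z + x * Z z + xb * Zb z.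
Proof.
have [h3 h4 _] := indep (a := z * Z u - io * (z * xb))
  (b := - (z * u * r) + z * Z x + z * xb * pb - u * T z - x * Z z - xb * Zb z + r' * z)
  (c := z * Z xb - z * xb * p - tb' * zb)
  (fun f => ltac:(have := c2 f; rewrite !ZE !TE !ZbE ZZb TZ => h; apply: (lc1 h); ring)).
split; last by apply: (lc1 h4); ring.
have e : z * Z u = io * (z * xb) by apply: (lc1 h3); ring.
apply: cancz; have -> : z * - (io * Z u) = - (io * (z * Z u)) by ring.
by rewrite e ioK opprK.
Qed.

Lemma conformal_xb : xb = - (io * Z u). Proof. by case: eqs2. Qed.

Hypothesis xE : x = io * Zb u.

Section Log.
Variables (a1 b1 a2 b2 t1 : A).
Hypotheses (Zz : Z z = z * a1) (Zzb : Z zb = zb * b1) (Zbz : Zb z = z * a2)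
  (Zbzb : Zb zb = zb * b2) (Tz : T z = z * t1).

Let uE := conformal_u.
Let xbE := conformal_xb.
Let Zu : Z u = u * (a1 + b1). Proof. by rewrite uE !ZE Zz Zzb; ring. Qed.
Let Zbu : Zb u = u * (a2 + b2). Proof. by rewrite uE !ZbE Zbz Zbzb; ring. Qed.

Let p'E : p' = z * (p - a1 - 2 * b1).
Proof.
have [_ _ h] := eqs1; apply: canczb; rewrite [zb * p']mulrC h xbE mulrN opprK ioK Zzb Zu uE.
ring.
Qed.

Let pb'E : pb' = zb * (pb - b2 - 2 * a2).
Proof.
have [_ h _] := eqs1; apply: cancz; rewrite [z * pb']mulrC h xE ioK Zbz Zbu uE.
ring.
Qed.

Let r'E : r' = u * (r + t1) - Z x + x * a1 - xb * pb + xb * a2.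
Proof.
by have [_ h] := eqs2; apply: cancz; rewrite [z * r']mulrC h Tz Zz Zbz; ring.
Qed.

(** The commutator of [Z] and [Zb] on [z]: the integrability relation between its logarithmic
    derivatives. *)
Let Za2 : Z a2 = Zb a1 - io * t1 + pb * a1 - p * a2.
Proof.
apply: cancz; have := ZZb z; rewrite Zbz Zz Tz !ZE !ZbE Zz Zbz => h.
by apply: (lc1 h); ring.
Qed.

Lemma conformal_lap_log f :
  zb * Zb (z * Z f) + pb' * (z * Z f) + (z * Z (zb * Zb f) + p' * (zb * Zb f)) =
  u * (Zb (Z f) + pb * Z f + (Z (Zb f) + p * Zb f)) - (Z u * Zb f + Zb u * Z f).
Proof. by rewrite !ZE !ZbE Zbz Zzb p'E pb'E Zu Zbu uE; ring. Qed.

Let ior' : io * r' = io * (u * (r + t1)) + Z (Zb u) - a1 * Zb u - pb * Z u + a2 * Z u.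
Proof.
rewrite r'E xbE xE !ZE Zio.
have -> : io * (u * (r + t1) - (0 * Zb u + io * Z (Zb u)) + io * Zb u * a1
   - - (io * Z u) * pb + - (io * Z u) * a2) = io * (u * (r + t1))
   - io * (io * (Z (Zb u) - Zb u * a1 - Z u * pb + Z u * a2)) by ring.
by rewrite ioK; ring.
Qed.

(** With the logarithmic derivatives of [z] and [zb] as unknowns, no inverse appears and both sides
    are polynomials; [conformal_W] supplies them through [y] and [yb], the inverses of [z] and
    [zb]. *)
Lemma conformal_W_log (W'E : W' = - (z * Z pb') - zb * Zb p' + io * r' - 2 * p' * pb') : u * W' = u * (u * W
  + 2 * (Zb (Z u) + pb * Z u + (Z (Zb u) + p * Zb u))) - 6 * Z u * Zb u.
Proof.
have -> : W' = u * W + 2 * (Zb (Z u) + pb * Z u + (Z (Zb u) + p * Zb u))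
    - 6 * u * (a1 + b1) * (a2 + b2).
  rewrite W'E ior' p'E pb'E WE !Zu !Zbu !ZE !ZbE Zbz Zzb ?Zu ?Zbu Za2 uE.
  ring.
by rewrite Zu Zbu; ring.
Qed.
End Log.

Let logz (D : A -> A) : D z = z * (y * D z).
Proof. by rewrite mulrA [z * y]mulrC yz mul1r. Qed.
Let logzb (D : A -> A) : D zb = zb * (yb * D zb).
Proof. by rewrite mulrA [zb * yb]mulrC ybzb mul1r. Qed.

Lemma conformal_lap f :
  zb * Zb (z * Z f) + pb' * (z * Z f) + (z * Z (zb * Zb f) + p' * (zb * Zb f)) =
  u * (Zb (Z f) + pb * Z f + (Z (Zb f) + p * Zb f)) - (Z u * Zb f + Zb u * Z f).
Proof. exact: conformal_lap_log (logz Z) (logzb Z) (logz Zb) (logzb Zb) f. Qed.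

Lemma conformal_W : W' = - (z * Z pb') - zb * Zb p' + io * r' - 2 * p' * pb' ->
  u * W' = u * (u * W + 2 * (Zb (Z u) + pb * Z u + (Z (Zb u) + p * Zb u))) - 6 * Z u * Zb u.
Proof. exact: conformal_W_log (logz Z) (logzb Z) (logz Zb) (logzb Zb) (logz T). Qed.

End Conformal.
End DiffAlgebra.

(** * Adapted coframes and unitary frames *)

Section Brackets.
Context {R : realType} {M : manifold3 R}.
Local Notation C := R[i].
Implicit Types (U : set M) (X Y : M -> tvec M) (a : form1 M).

Lemma is_form1_lin U a q : is_form1 U a -> U q -> lin_on q (a q).
Proof. by case=> la _ Uq k v w; exact: la. Qed.

Lemma is_form1_smooth U a X q : open U -> is_form1 U a -> vfield U X -> U q ->
  csmooth_at q (fun z => a z (X z)).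
Proof. by move=> oU [_ sa] HX Uq; apply: (sa U). Qed.

Lemma is_form1_sub U V a : V `<=` U -> is_form1 U a -> is_form1 V a.
Proof.
move=> VU [la sa]; split; first by move=> q /VU; exact: la.
by move=> N X oN NV; apply: sa => //; exact: subset_trans VU.
Qed.

Lemma vconj_lcomb (k : C) (v w : tvec M) :
  vconj (lcomb k v w) = lcomb k^* (vconj v) (vconj w).
Proof. by apply/funext => f; rewrite /vconj /lcomb conjD conjM. Qed.

Lemma lin_on_conj1 q a : lin_on q (a q) -> lin_on q (conj1 a q).
Proof.
move=> la k v w tv tw; rewrite /conj1 vconj_lcomb la; try exact: tangent_vconj.
by rewrite conjD conjM conjK.
Qed.

Lemma conj1_smooth U a X q : open U -> is_form1 U a -> vfield U X -> U q ->
  csmooth_at q (fun z => conj1 a z (X z)).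
Proof.
move=> oU fa HX Uq; apply: csmooth_conj.
exact: (is_form1_smooth oU fa (vfield_fconj HX) Uq).
Qed.

Lemma linZ q (phi : tvec M -> C) k (v : tvec M) : lin_on q phi -> tangent q v ->
  phi (fun f => k * v f) = k * phi v.
Proof.
move=> lp tv; have := lp k v _ tv (tangent0 q); rewrite (lin_on0 lp) addr0 => <-.
by congr phi; apply/funext => f; rewrite /lcomb addr0.
Qed.

Lemma vconj_bracket X Y q : vconj (bracket X Y q) = bracket (fconj X) (fconj Y) q.
Proof.
have E (V V' : M -> tvec M) f : (V q (fun z => V' z (fun y => (f y)^*)))^* =
    fconj V q (fun z => fconj V' z f).
  rewrite /fconj /vconj; congr (_ ^*); congr (V q _); apply/funext => z.
  by rewrite conjK.
have cS (f : M -> C) : csmooth_at q f <-> csmooth_at q (fun z => (f z)^*).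
  split; first exact: csmooth_conj.
  by move/csmooth_conj; apply: csmooth_eq; apply: nearW => z; rewrite conjK.
apply/funext => f; rewrite /vconj /bracket.
have [fS|fS] := pselect (csmooth_at q f); last first.
  have fS' : ~ csmooth_at q (fun z => (f z)^*) by move/(cS f).2.
  by rewrite (asboolF fS) (asboolF fS') conjC0.
rewrite (asboolT fS) (asboolT ((cS f).1 fS)) -!E.
by rewrite [LHS]rmorphB.
Qed.

Lemma bracket_anti X Y q : bracket X Y q = (fun f => -1 * bracket Y X q f).
Proof.
by apply/funext => f; rewrite /bracket; case: asboolP => _; rewrite ?mulr0 // mulN1r opprB.
Qed.

Lemma ext_const U a X Y q (k l : C) : open U -> vfield U X -> vfield U Y -> U q ->
  (forall z, U z -> a z (X z) = k) -> (forall z, U z -> a z (Y z) = l) ->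
  a q (bracket X Y q) = - ext_d a X Y q.
Proof.
move=> oU HX HY Uq ak al; rewrite /ext_d.
have [tX _] := HX q Uq; have [tY _] := HY q Uq.
rewrite (field_near oU HX (g := fun=> l)) // (field_near oU HY (g := fun=> k)) //.
by rewrite (tan_cst _ tX) (tan_cst _ tY) subrr add0r opprK.
Qed.

End Brackets.

(* The part of the data of an adapted coframe that restricts to smaller domains. *)
Record pre_adapted {R : realType} {M : manifold3 R} (xi : M -> tvec M -> Prop)
    (J : M -> tvec M -> tvec M) (th : form1 M) (U : set M) (T Z : M -> tvec M)
    (th1 : form1 M) : Prop := PreAdapted {
  pa_T : vfield U T;
  pa_Treal : forall q, U q -> vconj (T q) = T q;
  pa_thT : forall q, U q -> th q (T q) = 1;
  pa_Z : vfield U Z;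
  pa_xi : forall q, U q -> complexified xi q (Z q);
  pa_J : forall q, U q -> J q (Z q) = (fun f => 'i * Z q f);
  pa_th1 : is_form1 U th1;
  pa_dual : forall q, U q ->
    [/\ th1 q (T q) = 0, th1 q (Z q) = 1 & th1 q (vconj (Z q)) = 0];
  pa_dth : forall q, U q -> ext_d th Z (fconj Z) q = 'i /\ ext_d th Z T q = 0 }.

Section Adapted.
Context {R : realType} {M : manifold3 R}.
Local Notation C := R[i].
Variables (xi : M -> tvec M -> Prop) (J : M -> tvec M -> tvec M) (th : form1 M).
Hypothesis cf : contact_form setT xi th.
Variables (U : set M) (oU : open U) (T Z : M -> tvec M) (th1 : form1 M).
Hypothesis ad : pre_adapted xi J th U T Z th1.
Local Notation A := (sfun oU).
Local Notation Zb := (fconj Z).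

Lemma ad_T : vfield U T. Proof. exact: pa_T ad. Qed.
Lemma ad_Z : vfield U Z. Proof. exact: pa_Z ad. Qed.
Lemma ad_Zb : vfield U Zb. Proof. exact: vfield_fconj ad_Z. Qed.
Lemma ad_tT q : U q -> tangent q (T q). Proof. by move/ad_T=> []. Qed.
Lemma ad_tZ q : U q -> tangent q (Z q). Proof. by move/ad_Z=> []. Qed.
Lemma ad_tZb q : U q -> tangent q (Zb q). Proof. by move/ad_Zb=> []. Qed.
Lemma ad_th1 : is_form1 U th1. Proof. exact: pa_th1 ad. Qed.
Lemma ad_th : is_form1 U th. Proof. by case: cf => H *; apply: is_form1_sub H. Qed.
Lemma ad_thl q : U q -> lin_on q (th q). Proof. exact: is_form1_lin ad_th. Qed.
Lemma ad_th1l q : U q -> lin_on q (th1 q). Proof. exact: is_form1_lin ad_th1. Qed.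
Lemma ad_th1bl q : U q -> lin_on q (conj1 th1 q).
Proof. by move=> Uq; apply: lin_on_conj1; exact: ad_th1l. Qed.
Lemma ad_Treal q : U q -> vconj (T q) = T q. Proof. exact: pa_Treal ad q. Qed.

Lemma th_conj q v : tangent q v -> th q (vconj v) = (th q v)^*.
Proof.
case: cf => _ re _ _ tv; have := re q I v tv; rewrite /conj1 => <-.
by rewrite conjK.
Qed.

Lemma ad_thZ q : U q -> th q (Z q) = 0.
Proof.
move=> Uq; have [u [w [xu xw ->]]] := pa_xi ad Uq.
case: cf => [[lth _] _ kx _].
have [[tu _] u0] := (kx q I u).1 xu; have [[tw _] w0] := (kx q I w).1 xw.
by rewrite lth // u0 w0 mulr0 addr0.
Qed.

Lemma ad_thZb q : U q -> th q (Zb q) = 0.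
Proof. by move=> Uq; rewrite /fconj th_conj ?ad_thZ ?conjC0 //; exact: ad_tZ. Qed.

Lemma ad_thT q : U q -> th q (T q) = 1. Proof. exact: pa_thT ad q. Qed.

Lemma ad_1 q : U q -> [/\ th1 q (T q) = 0, th1 q (Z q) = 1 & th1 q (Zb q) = 0].
Proof. exact: pa_dual ad q. Qed.

Lemma ad_1b q : U q ->
  [/\ conj1 th1 q (T q) = 0, conj1 th1 q (Z q) = 0 & conj1 th1 q (Zb q) = 1].
Proof.
move=> Uq; have [h1 h2 h3] := ad_1 Uq; rewrite /conj1 ad_Treal // h1 h3 conjC0.
by split=> //; rewrite /fconj vconjK h2 conjC1.
Qed.

Definition tri3 (D : Type) (a b c : D) (k : 'I_3) : D := nth a [:: a; b; c] k.

Lemma tri3P (D : Type) (P : D -> Prop) (a b c : D) : P a -> P b -> P c ->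
  forall k, P (tri3 a b c k).
Proof. by move=> Pa Pb Pc [[|[|[|]]]]. Qed.

Definition fr q := tri3 (T q) (Z q) (Zb q).
Definition cofr q := tri3 (th q) (th1 q) (conj1 th1 q).

Lemma fr_tan q : U q -> forall k, tangent q (fr q k).
Proof. by move=> Uq; apply: tri3P; [exact: ad_tT|exact: ad_tZ|exact: ad_tZb]. Qed.

Lemma cofr_lin q : U q -> forall k, lin_on q (cofr q k).
Proof. by move=> Uq; apply: tri3P; [exact: ad_thl|exact: ad_th1l|exact: ad_th1bl]. Qed.

Lemma fr_dual q : U q -> forall k l, cofr q k (fr q l) = (k == l)%:R.
Proof.
move=> Uq; have [h1 h2 h3] := ad_1 Uq; have [g1 g2 g3] := ad_1b Uq.
have f1 := ad_thT Uq; have f2 := ad_thZ Uq; have f3 := ad_thZb Uq.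
by move=> [[|[|[|//]]] ?] [[|[|[|//]]] ?]; rewrite /cofr /fr /tri3 /=.
Qed.

Lemma ad_expand q v f : U q -> tangent q v ->
  v f = th q v * T q f + th1 q v * Z q f + conj1 th1 q v * Zb q f.
Proof.
move=> Uq tv; rewrite {1}(tan_dual_basis (fr_tan Uq) (cofr_lin Uq) (fr_dual Uq) tv).
by rewrite /comb3 /lcomb /cofr /fr /tri3 /= addr0 addrA.
Qed.

(** The hypothesis is tested on the coordinate functions, which belong to the ring because [U] lies
    in one chart domain. *)
Lemma ad_indep (c : chart R M) : atlas M c -> U `<=` chart_dom c ->
  forall a b e : A, (forall f : A, a * sder ad_T f + b * sder ad_Z f
     + e * sder ad_Zb f = 0) -> [/\ a = 0, b = 0 & e = 0].
Proof.
move=> ac Uc a b e H.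
have K q : U q -> comb3 (tri3 (a q) (b q) (e q)) (fr q) = (fun=> 0).
  move=> Uq; apply: (tan_inj ac (Uc q Uq)); [|exact: tangent0|].
    by apply: tangent_comb3; exact: fr_tan.
  move=> j; pose x := mkS oU (fun z (Uz : U z) => csmooth_coord j ac (Uc z Uz)).
  have := congr1 (fun g : A => g q) (H x).
  rewrite !sfD !sfM sf0 !sder_mk // => h.
  by rewrite /comb3 /lcomb /fr /tri3 /= addr0 addrA.
have L q k : U q -> tri3 (a q) (b q) (e q) k = 0.
  move=> Uq; have := lin_comb3 (tri3 (a q) (b q) (e q)) (cofr_lin Uq k) (fr_tan Uq).
  rewrite K // (lin_on0 (cofr_lin Uq k)) (bigD1 k) //= fr_dual // eqxx mulr1 big1 ?addr0 //.
  by move=> l lk; rewrite fr_dual // eq_sym (negPf lk) mulr0.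
split; apply: sfun_eq => q Uq; rewrite sf0.
- exact: (L q (Ordinal (isT : 0 < 3)%N)).
- exact: (L q (Ordinal (isT : 1 < 3)%N)).
- exact: (L q (Ordinal (isT : 2 < 3)%N)).
Qed.

Section Coef.
Variables (X Y : M -> tvec M) (HX : vfield U X) (HY : vfield U Y).
Let HB := vfield_bracket oU HX HY.
Definition bc0 : A := mkS oU (fun q (Uq : U q) => is_form1_smooth oU ad_th HB Uq).
Definition bc1 : A := mkS oU (fun q (Uq : U q) => is_form1_smooth oU ad_th1 HB Uq).
Definition bc2 : A := mkS oU (fun q (Uq : U q) => conj1_smooth oU ad_th1 HB Uq).

Lemma bracket_expand (f : A) : sder HX (sder HY f) - sder HY (sder HX f) =
  bc0 * sder ad_T f + bc1 * sder ad_Z f + bc2 * sder ad_Zb f.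
Proof.
apply: sfun_eq => q Uq; rewrite -bracketE // (ad_expand _ Uq (HB Uq).1).
by rewrite !sfD !sfM !mkSE.
Qed.
End Coef.

Lemma sder_conj (f : A) : sder ad_Zb f = scj (sder ad_Z (scj f)).
Proof.
apply: sfun_eq => q Uq; rewrite sf_cj sderE // sderE // /fconj /vconj; congr (_ ^*).
by congr (Z q _); apply/funext => z; rewrite sf_cj.
Qed.

Lemma sder_Tconj (f : A) : sder ad_T (scj f) = scj (sder ad_T f).
Proof.
apply: sfun_eq => q Uq; rewrite sf_cj sderE // sderE // -{2}(ad_Treal Uq) /vconj conjK.
by congr (T q _); apply/funext => z; rewrite sf_cj.
Qed.

Definition sio : A := scst oU 'i.

Lemma sio2 : sio * sio = -1.
Proof.
apply: sfun_eq => q Uq; rewrite sfM sfN sf1 // !sf_cst //.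
by apply: eqC => /=; ring.
Qed.

(** [adp], [adr] and [adt] are omega(Z), omega(T) and A_11, read off from brackets, so that they
    exist before any connection form. *)
Definition adp : A := - bc2 ad_Z ad_Zb.
Definition adr : A := - bc1 ad_Z ad_T.
Definition adt : A := bc2 ad_Z ad_T.

Lemma ad_bc0 : bc0 ad_Z ad_Zb = - sio /\ bc0 ad_Z ad_T = 0.
Proof.
have vT z : U z -> th z (T z) = 1 := @ad_thT z.
have vZ z : U z -> th z (Z z) = 0 := @ad_thZ z.
have vZb z : U z -> th z (Zb z) = 0 := @ad_thZb z.
split; apply: sfun_eq => q Uq; rewrite mkSE //.
  by rewrite (ext_const oU ad_Z ad_Zb Uq vZ vZb) (pa_dth ad Uq).1 sfN sf_cst.
by rewrite (ext_const oU ad_Z ad_T Uq vZ vT) (pa_dth ad Uq).2 oppr0 sf0.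
Qed.

Lemma ad_bc1 : bc1 ad_Z ad_Zb = scj adp.
Proof.
apply: sfun_eq => q Uq; rewrite sf_cj sfN !mkSE // rmorphN /=.
rewrite /conj1 conjK vconj_bracket.
have -> : fconj Zb = Z by apply/funext => z; rewrite /fconj vconjK.
rewrite bracket_anti (linZ _ (ad_th1l Uq)) ?mulN1r //.
exact: (vfield_bracket oU ad_Zb ad_Z Uq).1.
Qed.

Lemma ad_comm1 (f : A) : sder ad_Z (sder ad_Zb f) = sder ad_Zb (sder ad_Z f)
  - sio * sder ad_T f + scj adp * sder ad_Z f - adp * sder ad_Zb f.
Proof.
have := bracket_expand ad_Z ad_Zb f; rewrite ad_bc0.1 ad_bc1.
have -> : bc2 ad_Z ad_Zb = - adp by rewrite /adp opprK.
by move=> h; apply: (lc1 h); ring.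
Qed.

Lemma ad_comm2 (f : A) : sder ad_Z (sder ad_T f) = sder ad_T (sder ad_Z f)
  - adr * sder ad_Z f + adt * sder ad_Zb f.
Proof.
have := bracket_expand ad_Z ad_T f; rewrite ad_bc0.2 -/adt.
have -> : bc1 ad_Z ad_T = - adr by rewrite /adr opprK.
by move=> h; apply: (lc1 h); ring.
Qed.

Lemma ad_comm3 (f : A) : sder ad_Zb (sder ad_T f) = sder ad_T (sder ad_Zb f)
  - scj adr * sder ad_Zb f + scj adt * sder ad_Z f.
Proof.
have := congr1 (@scj _ _ _ oU) (ad_comm2 (scj f)).
rewrite sder_Tconj !sder_conj => ->.
have cN (g : A) : scj (- g) = - scj g.
  by apply: sfun_eq => q Uq; rewrite sf_cj !sfN sf_cj rmorphN.
by rewrite scjK sder_Tconj !scjD cN !scjM scjK.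
Qed.

Lemma sder_deriv X (HX : vfield U X) : derivation (sder (oU := oU) HX).
Proof. by split; [exact: sderD|exact: sderM]. Qed.

(** This makes the form in [frame_of] a connection form: omega + conj omega = 0 requires an
    imaginary value on [T]. *)
Lemma ad_rimag c : atlas M c -> U `<=` chart_dom c -> scj adr = - adr.
Proof.
move=> ac Uc; apply: (jacobi_T (sder_deriv ad_Z) (sder_deriv ad_Zb) (sder_deriv ad_T)
  sio2 _ _ _ ad_comm1 ad_comm2 ad_comm3); try exact: sder_cst.
by move=> a b e H; case: (ad_indep ac Uc H).
Qed.

End Adapted.

(** * Exterior derivatives and existence of unitary frames *)

Section FrameExistence.
Context {R : realType} {M : manifold3 R}.
Local Notation C := R[i].
Variables (xi : M -> tvec M -> Prop) (J : M -> tvec M -> tvec M).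
Implicit Types (th : form1 M) (U V : set M) (T Z X Y : M -> tvec M).

Lemma pa_of_adapted th U T Z (th1 : form1 M) : adapted_coframe xi J th U T Z th1 ->
  levi_coefficient th U th1 (fun=> 1) -> pre_adapted xi J th U T Z th1.
Proof.
move=> [[HT Tr thT _] HZ xJ f1 d1] lev.
have Hb := vfield_fconj HZ.
split=> // [q /xJ[] //|q /xJ[] //|q Uq].
have [h1 h2 h3] := d1 q Uq.
split.
  rewrite (lev _ _ HZ Hb q Uq) /wedge /conj1 /fconj vconjK h2 h3.
  by rewrite conjC0 conjC1 mul0r subr0 !mulr1.
rewrite (lev _ _ HZ HT q Uq) /wedge /conj1 (Tr q Uq) -/(fconj Z q) h1 [th1 q (fconj Z q)]h3.
by rewrite conjC0 mulr0 mul0r subr0 mulr0.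
Qed.

Lemma pa_sub th U V T Z (th1 : form1 M) : V `<=` U -> pre_adapted xi J th U T Z th1 ->
  pre_adapted xi J th V T Z th1.
Proof.
move=> VU [a b c d e f g h i]; split; try (by move=> q /VU; auto).
exact: is_form1_sub VU g.
Qed.

Section ExtD.
Variables (U : set M) (oU : open U) (a : form1 M).
Hypothesis fa : is_form1 U a.

Lemma ext_d_eqU X X' Y q : vfield U X -> vfield U Y -> U q ->
  (forall z, U z -> X z = X' z) -> ext_d a X Y q = ext_d a X' Y q.
Proof.
move=> HX HY Uq XX'; rewrite /ext_d -(XX' q Uq); congr (_ - _ - a q _).
  by apply: (field_near oU HY Uq) => z Uz; rewrite XX'.
apply/funext => f; rewrite /bracket; case: asboolP => // _; rewrite (XX' q Uq).
by congr (_ - _); apply: (field_near oU HY Uq) => z Uz; rewrite XX'.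
Qed.

Lemma ext_d_anti X Y q : vfield U X -> vfield U Y -> U q ->
  ext_d a X Y q = - ext_d a Y X q.
Proof.
move=> HX HY Uq; rewrite /ext_d bracket_anti (linZ _ (is_form1_lin fa Uq)); last first.
  exact: (vfield_bracket oU HY HX Uq).1.
by ring.
Qed.

(** Tensoriality: the term [Y q f * a q (X q)] from differentiating the pairing is cancelled by the
    one from the bracket. *)
Lemma ext_d_lin (f : sfun oU) X X' Y q : vfield U X -> vfield U X' -> vfield U Y -> U q ->
  ext_d a (fun z => lcomb (f z) (X z) (X' z)) Y q = f q * ext_d a X Y q + ext_d a X' Y q.
Proof.
move=> HX HX' HY Uq; have la := is_form1_lin fa.
have fS := fun z (Uz : U z) => sf_smooth f Uz.
have [tX sX] := HX q Uq; have [tX' sX'] := HX' q Uq; have [tY sY] := HY q Uq.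
have aX := is_form1_smooth oU fa HX Uq; have aX' := is_form1_smooth oU fa HX' Uq.
have E1 : Y q (fun z => a z (lcomb (f z) (X z) (X' z))) =
    Y q f * a q (X q) + f q * Y q (fun z => a z (X z)) + Y q (fun z => a z (X' z)).
  rewrite (field_near oU HY Uq (g := fun z => f z * a z (X z) + a z (X' z))); last first.
    by move=> z Uz; apply: la => //; [exact: (HX z Uz).1|exact: (HX' z Uz).1].
  by rewrite (tanD tY (csmoothM (fS q Uq) aX) aX') (tanM tY (fS q Uq) aX).
have tB := (vfield_bracket oU HX HY Uq).1; have tB' := (vfield_bracket oU HX' HY Uq).1.
have E2 : bracket (fun z => lcomb (f z) (X z) (X' z)) Y q =
   lcomb (f q) (bracket X Y q) (lcomb (- Y q f) (X q) (bracket X' Y q)).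
  apply/funext => g; rewrite /lcomb /bracket; case: asboolP => gS; last first.
    have [t0 _ _] := tX; by rewrite t0 //; ring.
  have := tanM tY (fS q Uq) (sX _ gS).
  have -> : Y q (fun z => f z * X z g + X' z g) =
     Y q (fun z => f z * X z g) + Y q (fun z => X' z g).
    by rewrite (tanD tY (csmoothM (fS q Uq) (sX _ gS)) (sX' _ gS)).
  by move=> ->; ring.
have tL : tangent q (lcomb (- Y q f) (X q) (bracket X' Y q)) by exact: tangent_lcomb.
by rewrite /ext_d E1 E2 !(la q Uq) // /lcomb; ring.
Qed.

Lemma ext_d0 Y q : vfield U Y -> U q -> ext_d a (fun=> (fun=> 0)) Y q = 0.
Proof.
move=> HY Uq; have a0 z : U z -> a z (fun=> 0) = 0.
  by move=> Uz; exact: lin_on0 (is_form1_lin fa Uz).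
have [tY _] := HY q Uq.
have E : bracket (fun=> (fun=> 0)) Y q = (fun=> 0).
  apply/funext => f; rewrite /bracket; case: asboolP => // fS.
  by rewrite (tan_cst 0 tY) subrr.
rewrite /ext_d E a0 // (field_near oU HY Uq (g := fun=> 0)) //.
by rewrite (tan_cst 0 tY) !subr0.
Qed.

Lemma ext_d_same X q : vfield U X -> U q -> ext_d a X X q = 0.
Proof.
move=> HX Uq; have /eqP := ext_d_anti HX HX Uq.
by rewrite -addr_eq0 -mulr2n mulrn_eq0 /= => /eqP.
Qed.

End ExtD.

Section Tensor.
Variables (th : form1 M).
Hypothesis cf : contact_form setT xi th.
Variables (U : set M) (oU : open U) (T Z : M -> tvec M) (th1 : form1 M).
Hypothesis ad : pre_adapted xi J th U T Z th1.

Lemma ext_d_frame a X Y q : is_form1 U a -> vfield U X -> vfield U Y -> U q ->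
  ext_d a X Y q =
    (th1 q (X q) * conj1 th1 q (Y q) - conj1 th1 q (X q) * th1 q (Y q))
      * ext_d a Z (fconj Z) q
  + (th1 q (X q) * th q (Y q) - th q (X q) * th1 q (Y q)) * ext_d a Z T q
  + (conj1 th1 q (X q) * th q (Y q) - th q (X q) * conj1 th1 q (Y q))
      * ext_d a (fconj Z) T q.
Proof.
move=> fa HX HY Uq.
have HT := ad_T ad; have HZ := ad_Z ad; have Hb := ad_Zb ad.
have K W W' : vfield U W -> vfield U W' -> ext_d a W W' q =
  th q (W q) * ext_d a T W' q + th1 q (W q) * ext_d a Z W' q
   + conj1 th1 q (W q) * ext_d a (fconj Z) W' q.
  move=> HW HW'.
  pose x0 := mkS oU (fun z (Uz : U z) => is_form1_smooth oU (ad_th cf U) HW Uz).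
  pose x1 := mkS oU (fun z (Uz : U z) => is_form1_smooth oU (ad_th1 ad) HW Uz).
  pose x2 := mkS oU (fun z (Uz : U z) => conj1_smooth oU (ad_th1 ad) HW Uz).
  have H0 : vfield U (fun z => lcomb (x2 z) (fconj Z z) (fun=> 0)).
    apply: vfield_lcomb => // [z|]; [exact: sf_smooth|exact: vfield0].
  have H1 : vfield U (fun z => lcomb (x1 z) (Z z) (lcomb (x2 z) (fconj Z z) (fun=> 0))).
    by apply: vfield_lcomb => // z; exact: sf_smooth.
  rewrite (ext_d_eqU oU a (X' := fun z => lcomb (x0 z) (T z)
     (lcomb (x1 z) (Z z) (lcomb (x2 z) (fconj Z z) (fun=> 0)))) HW HW' Uq); last first.
    move=> z Uz; apply/funext => f; rewrite (ad_expand cf ad f Uz (HW z Uz).1).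
    by rewrite /lcomb /x0 /x1 /x2 !mkSE // addr0 addrA.
  rewrite (ext_d_lin fa x0 HT H1 HW' Uq) (ext_d_lin fa x1 HZ H0 HW' Uq).
  rewrite (ext_d_lin fa x2 Hb (@vfield0 _ _ U) HW' Uq) (ext_d0 oU fa HW' Uq).
  by rewrite /x0 /x1 /x2 !mkSE //; ring.
have an W W' (HW : vfield U W) (HW' : vfield U W') := ext_d_anti oU fa HW HW' Uq.
rewrite (K X Y) // (an T Y) // (an Z Y) // (an (fconj Z) Y) //.
rewrite (K Y T) // (K Y Z) // (K Y (fconj Z)) //.
rewrite (ext_d_same oU fa HT Uq) (ext_d_same oU fa HZ Uq) (ext_d_same oU fa Hb Uq).
by rewrite (an (fconj Z) Z) // (an T Z) // (an T (fconj Z)) //; ring.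
Qed.

Local Notation A := (sfun oU).

Lemma ad_ext_th1 q : U q -> [/\ ext_d th1 Z (fconj Z) q = - (adp oU ad q)^*,
   ext_d th1 Z T q = adr oU ad q & ext_d th1 (fconj Z) T q = - (adt oU ad q)^*].
Proof.
move=> Uq; have HT := ad_T ad; have HZ := ad_Z ad; have Hb := ad_Zb ad.
have v1 z : U z -> th1 z (T z) = 0 by case/(ad_1 ad).
have v2 z : U z -> th1 z (Z z) = 1 by case/(ad_1 ad).
have v3 z : U z -> th1 z (fconj Z z) = 0 by case/(ad_1 ad).
have e1 := ext_const oU HZ Hb Uq v2 v3; have e2 := ext_const oU HZ HT Uq v2 v1.
have e3 := ext_const oU Hb HT Uq v3 v1.
split.
- rewrite -[LHS]opprK -e1; congr (- _).
  by rewrite -sf_cj -ad_bc1 mkSE.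
- by rewrite -[LHS]opprK -e2 sfN mkSE.
- rewrite -[LHS]opprK -e3; congr (- _); rewrite mkSE // /conj1 conjK vconj_bracket.
  congr (th1 q _); apply/funext => f; rewrite /bracket; case: asboolP => // _.
  have ET z : U z -> fconj T z = T z := @ad_Treal _ _ _ _ _ _ _ _ _ ad z.
  rewrite (ET q Uq); congr (_ - _).
  by apply: (field_near oU Hb Uq) => z Uz; rewrite (ET z Uz).
Qed.

Lemma ad_rimag_pt q : U q -> (adr oU ad q)^* = - adr oU ad q.
Proof.
move=> Uq; have [c ac cq] := chart_at q.
have oV : open (U `&` chart_dom c) by apply: openI => //; exact: chart_dom_open.
have VU : U `&` chart_dom c `<=` U by exact: subIsetl.
have adV := pa_sub VU ad.
have Vc : U `&` chart_dom c `<=` chart_dom c by exact: subIsetr.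
have := congr1 (fun g : sfun oV => g q) (ad_rimag cf oV adV ac Vc).
have E : adr oV adV q = adr oU ad q by rewrite !sfN !mkSE.
by rewrite sf_cj sfN E.
Qed.

Definition frame_of (p r t : M -> C) : frame M := Frame U T Z th1
  (fun q v => r q * th q v + p q * th1 q v - (p q)^* * conj1 th1 q v)
  (fun q => (t q)^*).

Lemma frame_of_unitary (p r t : A) : adapted_coframe xi J th U T Z th1 ->
  levi_coefficient th U th1 (fun=> 1) ->
  (forall q, U q -> [/\ ext_d th1 Z (fconj Z) q = - (p q)^*,
     ext_d th1 Z T q = r q & ext_d th1 (fconj Z) T q = - (t q)^*]) ->
  (forall q, U q -> (r q)^* = - r q) ->
  unitary_frame xi J th (frame_of p r t).
Proof.
move=> adc lev dth1 rim; split=> //; split=> /=.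
- split=> [q Uq k v w tv tw|N X oN NU HX q Nq].
    by rewrite (ad_thl cf Uq) // (ad_th1l ad Uq) // (ad_th1bl ad Uq) //; ring.
  have Uq := NU q Nq.
  have fs (b : form1 M) : is_form1 U b -> csmooth_at q (fun z => b z (X z)).
    by move=> fb; apply: (is_form1_smooth oN (is_form1_sub NU fb) HX Nq).
  have fsb : csmooth_at q (fun z => conj1 th1 z (X z)).
    exact: (conj1_smooth oN (is_form1_sub NU (ad_th1 ad)) HX Nq).
  have s1 := sf_smooth p Uq; have s2 := sf_smooth r Uq.
  exact: (csmoothD (csmoothD (csmoothM s2 (fs th (ad_th cf U)))
    (csmoothM s1 (fs th1 (ad_th1 ad)))) (csmoothN (csmoothM (csmooth_conj s1) fsb))).
- by move=> q Uq; exact: (csmooth_conj (sf_smooth t Uq)).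
- move=> X Y HX HY q Uq; rewrite (ext_d_frame (ad_th1 ad) HX HY Uq).
  have [-> -> ->] := dth1 q Uq; rewrite /wedge; ring.
- move=> q Uq v tv; have tv' := tangent_vconj tv.
  rewrite /conj1 /= -/(conj1 th1 q _) !(conjD, conjM, conjK, rmorphN) /=.
  by rewrite vconjK conjM !conjK (th_conj cf tv) conjK rim // /conj1; ring.
Qed.

Lemma frame_exists : adapted_coframe xi J th U T Z th1 ->
  levi_coefficient th U th1 (fun=> 1) ->
  exists2 F, unitary_frame xi J th F & fdom F = U.
Proof.
move=> adc lev; exists (frame_of (adp oU ad) (adr oU ad) (adt oU ad)) => //.
apply: (frame_of_unitary (p := adp oU ad) (r := adr oU ad) (t := adt oU ad)) => //.
  exact: ad_ext_th1.
exact: ad_rimag_pt.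
Qed.

End Tensor.
End FrameExistence.

(** * Complexified contact planes *)

Section Complexified.
Context {R : realType} {M : manifold3 R}.
Local Notation C := R[i].
Variables (xi : M -> tvec M -> Prop) (J : M -> tvec M -> tvec M).
Hypothesis hJ : cr_structure xi J.
Variable th : form1 M.
Hypothesis cf : contact_form setT xi th.

Lemma xi_kernel q v : xi q v <-> real_tangent q v /\ th q v = 0.
Proof. by case: cf => _ _ + _; apply. Qed.

Lemma th_lin q : lin_on q (th q).
Proof. by case: cf => H _ _ _; exact: is_form1_lin H I. Qed.

Lemma complexifiedP q v : complexified xi q v <-> tangent q v /\ th q v = 0.
Proof.
split=> [[u [w [/xi_kernel[[tu _] u0] /xi_kernel[[tw _] w0] ->]]]|[tv v0]].
  by split; [exact: tangent_lcomb|rewrite (@th_lin q) // u0 w0 mulr0 addr0].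
have tb := tangent_vconj tv; have t0 := tangent0 q.
have b0 : th q (vconj v) = 0 by rewrite (th_conj cf tv) v0 conjC0.
have i2 : 'i * 'i = -1 :> C by apply: eqC => /=; ring.
have ci : 'i^* = - 'i :> C by apply: eqC => /=; ring.
have c2 : (2%:R^-1 : C)^* = 2%:R^-1 by rewrite rmorphV ?unitfE ?pnatr_eq0 // rmorph_nat.
have n2 : (2%:R : C) != 0 by rewrite pnatr_eq0.
pose comb a b : tvec M := lcomb a v (lcomb b (vconj v) (fun=> 0)).
have tc a b : tangent q (comb a b) by exact: tangent_lcomb tv (tangent_lcomb b tb t0).
have th0 a b : th q (comb a b) = 0.
  rewrite /comb th_lin //; last exact: tangent_lcomb.
  by rewrite (@th_lin q) // v0 b0 (lin_on0 (@th_lin q)); ring.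
have cc a b : a^* = b -> vconj (comb a b) = comb a b.
  move=> ab; rewrite /comb !vconj_lcomb vconjK -ab conjK.
  by apply/funext => f; rewrite /lcomb /vconj conjC0; ring.
exists (comb 2%:R^-1 2%:R^-1), (comb (- 'i / 2%:R) ('i / 2%:R)); split.
- by apply/xi_kernel; split=> //; split=> //; exact: cc.
- apply/xi_kernel; split=> //; split=> //; apply: cc.
  by rewrite conjM c2 rmorphN /= ci opprK.
- apply/funext => f; rewrite /comb /lcomb.
  have -> : 'i * (- 'i / 2%:R * v f + ('i / 2%:R * vconj v f + 0)) +
    (2%:R^-1 * v f + (2%:R^-1 * vconj v f + 0)) =
    2%:R^-1 * (v f + vconj v f - 'i * 'i * (v f - vconj v f)) by ring.
  by rewrite i2; field.
Qed.

Lemma J_conj q v : complexified xi q v -> J q (vconj v) = vconj (J q v).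
Proof.
case: hJ => J1 _ Jl _ [u [w [xu xw ->]]].
have cx v' : xi q v' -> complexified xi q v'.
  by move=> /xi_kernel[[t' _] z']; apply/complexifiedP.
have [[_ ru] _] := (xi_kernel q u).1 xu; have [[_ rw] _] := (xi_kernel q w).1 xw.
have [[_ rJu] _] := (xi_kernel q _).1 (J1 q u xu).
have [[_ rJw] _] := (xi_kernel q _).1 (J1 q w xw).
rewrite vconj_lcomb ru rw !Jl; try exact: cx.
by rewrite vconj_lcomb rJu rJw.
Qed.

Lemma J_scale q k v : complexified xi q v -> J q (fun f => k * v f) = (fun f => k * J q v f).
Proof.
case: hJ => _ _ Jl _ cv.
have -> : (fun f => k * v f) = lcomb (k - 1) v v by apply/funext => f; rewrite /lcomb; ring.
by rewrite Jl //; apply/funext => f; rewrite /lcomb; ring.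
Qed.

Section Eigen.
Variables (U : set M) (T Z : M -> tvec M) (th1 : form1 M).
Hypothesis ad : pre_adapted xi J th U T Z th1.

Lemma holomorphic_vector q v : U q -> complexified xi q v ->
  J q v = (fun f => 'i * v f) -> conj1 th1 q v = 0.
Proof.
move=> Uq cv Jv; have [tv v0] := (complexifiedP q v).1 cv.
have tZ := ad_tZ ad Uq; have tZb := ad_tZb ad Uq.
have cZ : complexified xi q (Z q) by exact: pa_xi ad q Uq.
have cZb : complexified xi q (fconj Z q).
  by apply/complexifiedP; split=> //; exact: (ad_thZb cf ad Uq).
have JZ := pa_J ad Uq.
have JZb : J q (fconj Z q) = (fun f => - 'i * fconj Z q f).
  rewrite /fconj J_conj // JZ; apply/funext => f; rewrite /vconj conjM.
  by congr (_ * _); apply: eqC => /=; ring.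
set a := th1 q v; set b := conj1 th1 q v.
have vE : v = lcomb a (Z q) (fun f => b * fconj Z q f).
  apply/funext => f; rewrite (ad_expand cf ad f Uq tv) v0 mul0r add0r.
  by rewrite /lcomb.
have cb : complexified xi q (fun f => b * fconj Z q f).
  apply/complexifiedP; split.
    have := tangent_lcomb b tZb (tangent0 q); congr tangent.
    by apply/funext => f; rewrite /lcomb addr0.
  by rewrite (linZ _ (@th_lin q)) // (ad_thZb cf ad Uq) mulr0.
have Jv2 : J q v = lcomb a (fun f => 'i * Z q f) (fun f => b * (- 'i * fconj Z q f)).
  by case: hJ => _ _ Jl _; rewrite {1}vE Jl // JZ J_scale // JZb.
have tl : lin_on q (conj1 th1 q) := ad_th1bl ad Uq.
have [g1 g2 g3] := ad_1b ad Uq.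
have tiZ : tangent q (fun f => 'i * Z q f).
  have := tangent_lcomb 'i tZ (tangent0 q); congr tangent.
  by apply/funext => f; rewrite /lcomb addr0.
have tibZ k : tangent q (fun f => k * fconj Z q f).
  have := tangent_lcomb k tZb (tangent0 q); congr tangent.
  by apply/funext => f; rewrite /lcomb addr0.
have E1 : conj1 th1 q (J q v) = 'i * b by rewrite Jv (linZ _ tl tv).
have E2 : conj1 th1 q (J q v) = - 'i * b.
  rewrite Jv2.
  have -> : (fun f => b * (- 'i * fconj Z q f)) = (fun f => (- 'i * b) * fconj Z q f).
    by apply/funext => f; ring.
  rewrite tl; [|exact: tiZ|exact: tibZ].
  by rewrite (linZ _ tl tZ) (linZ _ tl tZb) g2 g3; ring.
have : 2%:R * 'i * b = 0.
  have -> : 2%:R * 'i * b = 'i * b - (- 'i * b) by ring.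
  by rewrite -E1 -E2 subrr.
have i2 : 'i * 'i = -1 :> C by apply: eqC => /=; ring.
move=> /(congr1 (fun x => - 'i * x)) h; have : b * 2%:R = 0 by apply: (lc2 (c := 2%:R * b) h i2); ring.
by move/eqP; rewrite mulf_eq0 pnatr_eq0 orbF => /eqP.
Qed.

Lemma holomorphic_vectorE q v f : U q -> complexified xi q v ->
  J q v = (fun f => 'i * v f) -> v f = th1 q v * Z q f.
Proof.
move=> Uq cv Jv; have [tv v0] := (complexifiedP q v).1 cv.
rewrite (ad_expand cf ad f Uq tv) v0 (holomorphic_vector Uq cv Jv).
by rewrite !mul0r add0r addr0.
Qed.

End Eigen.

Lemma positive_frame p : positive_pseudohermitian xi J th ->
  exists2 F, unitary_frame xi J th F & fdom F p.
Proof.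
move=> [_ /(_ p)[U [T [Z [th1 [h [oU Up [ch HZ xJ f1 d1] lev hpos]]]]]]].
have [HT Tr thT _] := ch.
have Hb := vfield_fconj HZ.
have fth : is_form1 U th by case: cf => H _ _ _; exact: is_form1_sub H.
(* Smoothness of [h] is read off from the Levi equation: evaluated on [Z] and its conjugate, it
   gives [h] as i times [th] of their bracket. The field can then be divided by the square root of
   [h]. *)
have hS q : U q -> smooth_at q h.
  move=> Uq.
  have H : csmooth_at q (fun z => 'i * th z (bracket Z (fconj Z) z)).
    apply: csmoothM; first exact: csmooth_cst.
    exact: (is_form1_smooth oU fth (vfield_bracket oU HZ Hb) Uq).
  have [H1 _] := H; move: H1; apply: smooth_at_eq; apply: filterS (open_near oU Uq) => z Uz.
  have v1 y : U y -> th y (Z y) = 0.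
    by move=> Uy; have [c0 _] := xJ y Uy; have [] := (complexifiedP _ _).1 c0.
  have v2 y : U y -> th y (fconj Z y) = 0.
    by move=> Uy; rewrite /fconj (th_conj cf) ?v1 ?conjC0 //; have [] := HZ y Uy.
  rewrite (ext_const oU HZ Hb Uz v1 v2) (lev _ _ HZ Hb z Uz) /wedge.
  have [h1 h2 h3] := d1 z Uz.
  rewrite /conj1 /fconj vconjK h2 h3 conjC0 conjC1.
  by rewrite /= ; ring.
pose c q := ((Num.sqrt (h q))^-1)%:C%C.
have sq q : U q -> 0 < Num.sqrt (h q) by move=> Uq; rewrite sqrtr_gt0; exact: hpos.
have sS q : U q -> smooth_at q (fun z => Num.sqrt (h z)).
  by move=> Uq; apply: smooth_at_sqrt; [exact: hpos|exact: hS].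
have cS q : U q -> csmooth_at q c.
  by move=> Uq; apply: csmooth_real; apply: smooth_atV; [rewrite gt_eqF // sq|exact: sS].
pose k q := (Num.sqrt (h q))%:C%C.
have kS q : U q -> csmooth_at q k by move=> Uq; apply: csmooth_real; exact: sS.
have kc q : U q -> k q * c q = 1.
  by move=> Uq; rewrite /k /c -rmorphM /= mulfV ?gt_eqF ?sq.
have kr q : (k q)^* = k q by apply: eqC => /=; ring.
have cr q : (c q)^* = c q by apply: eqC => /=; ring.
have kh q : U q -> k q * k q = (h q)%:C%C.
  by move=> Uq; rewrite /k -rmorphM /= -expr2 sqr_sqrtr // ltW // hpos.
pose Z' q : tvec M := lcomb (c q) (Z q) (fun=> 0).
pose th1' : form1 M := fun q v => k q * th1 q v.
have HZ' : vfield U Z' by apply: vfield_lcomb => //; exact: vfield0.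
have Z'E q : Z' q = (fun f => c q * Z q f) by apply/funext => f; rewrite /Z' /lcomb addr0.
have f1' : is_form1 U th1'.
  split=> [q Uq l v w tv tw|N X oN NU HX q Nq].
    by rewrite /th1' (is_form1_lin f1 Uq) //; ring.
  apply: csmoothM; first exact: kS (NU q Nq).
  exact: (is_form1_smooth oN (is_form1_sub NU f1) HX Nq).
have adc : adapted_coframe xi J th U T Z' th1'.
  split=> // [q Uq|q Uq].
    have [c0 J0] := xJ q Uq; split.
      by apply/complexifiedP; split; [exact: (HZ' q Uq).1|rewrite Z'E (linZ _ (@th_lin q)) ?(((complexifiedP _ _).1 c0).2) ?mulr0 //; exact: (HZ q Uq).1].
    by rewrite Z'E J_scale // J0; apply/funext => f; ring.
  have [h1 h2 h3] := d1 q Uq; rewrite /th1' h1 mulr0; split=> //.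
    by rewrite Z'E (linZ _ (is_form1_lin f1 Uq)) ?h2 ?mulr1 ?kc //; exact: (HZ q Uq).1.
  have -> : vconj (Z' q) = (fun f => c q * vconj (Z q) f).
    by apply/funext => f; rewrite Z'E /vconj conjM cr.
  rewrite (linZ _ (is_form1_lin f1 Uq)) ?h3 ?mulr0 //.
  by apply: tangent_vconj; exact: (HZ q Uq).1.
have lev' : levi_coefficient th U th1' (fun=> 1).
  move=> X Y HX HY q Uq; rewrite (lev X Y HX HY q Uq) /wedge /conj1 /th1' -kh //.
  by rewrite !conjM kr /=; ring.
have [F uF FU] := frame_exists cf oU (pa_of_adapted adc lev') adc lev'.
by exists F => //; rewrite FU.
Qed.

End Complexified.

(** * Connection, curvature and sublaplacian in a unitary frame *)

Section Unitary.
Context {R : realType} {M : manifold3 R}.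
Local Notation C := R[i].
Variables (xi : M -> tvec M -> Prop) (J : M -> tvec M -> tvec M) (th : form1 M).
Hypothesis cf : contact_form setT xi th.
Variable F : frame M.
Hypothesis uF : unitary_frame xi J th F.

Lemma un_open : open (fdom F). Proof. by case: uF. Qed.

Lemma un_ad (V : set M) : V `<=` fdom F ->
  pre_adapted xi J th V (charT F) (Z1 F) (th1 F).
Proof. by move=> VF; case: uF => _ a l _; apply: pa_sub (pa_of_adapted a l). Qed.

Lemma un_omega_form : is_form1 (fdom F) (omega F).
Proof. by case: uF => _ _ _ []. Qed.

Lemma un_omega_conj q v : fdom F q -> tangent q v ->
  omega F q (vconj v) = - (omega F q v)^*.
Proof.
move=> Fq tv; case: uF => _ _ _ [_ _ _ H]; have := H q Fq _ (tangent_vconj tv).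
by rewrite /conj1 vconjK => /eqP; rewrite addr_eq0 => /eqP.
Qed.

Section Local.
Variables (V : set M) (oV : open V) (VF : V `<=` fdom F).
Let ad := un_ad VF.
Local Notation A := (sfun oV).
Local Notation P := (adp oV ad).
Local Notation DZ := (sder (oU := oV) (ad_Z ad)).
Local Notation DZb := (sder (oU := oV) (ad_Zb ad)).
Local Notation DT := (sder (oU := oV) (ad_T ad)).

Lemma un_forms q : V q -> [/\ omega F q (Z1 F q) = P q,
  omega F q (fconj (Z1 F) q) = - (P q)^*, omega F q (charT F q) = adr oV ad q
  & tors F q = (adt oV ad q)^*].
Proof.
move=> Vq; case: uF => oF a l [_ _ H _].
have sX X : vfield (fdom F) X -> vfield V X by apply: vfield_sub.
have [HT Z0] : vfield (fdom F) (charT F) /\ vfield (fdom F) (Z1 F) by case: a => -[].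
have [h1 h2 h3] := ad_1 ad Vq; have [g1 g2 g3] := ad_1b ad Vq.
have f1 := ad_thT ad Vq; have f2 := ad_thZ cf ad Vq; have f3 := ad_thZb cf ad Vq.
have [e1 e2 e3] := ad_ext_th1 oV ad Vq.
have Hb := vfield_fconj Z0; have Fq := VF Vq.
have k1 := H _ _ Z0 Hb q Fq; have k2 := H _ _ Z0 HT q Fq; have k3 := H _ _ Hb HT q Fq.
rewrite e1 /wedge h2 h3 f2 f3 g2 g3 in k1; rewrite e2 /wedge h1 h2 f1 f2 g1 g2 in k2.
rewrite e3 /wedge h1 h3 f1 f3 g1 g3 in k3.
have b1 : omega F q (fconj (Z1 F) q) = - (P q)^* by rewrite k1; ring.
split=> //.
- have := un_omega_conj Fq (ad_tZb ad Vq); rewrite {1}/fconj vconjK => ->.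
  by rewrite b1 rmorphN /= opprK conjK.
- by rewrite k2; ring.
- by rewrite -[RHS]opprK k3; ring.
Qed.

(** The value of d omega on [(Z, Zb)]; in this form the curvature is an element of the ring. *)
Definition Wsf : A := - DZ (scj P) - DZb P + sio oV * adr oV ad - 2 * P * scj P.

Lemma un_bracket X Y (HX : vfield V X) (HY : vfield V Y) q : V q ->
  omega F q (bracket X Y q) = bc0 cf oV HX HY q * omega F q (charT F q)
   + bc1 oV ad HX HY q * omega F q (Z1 F q) + bc2 oV ad HX HY q * omega F q (fconj (Z1 F) q).
Proof.
move=> Vq; have tB := (vfield_bracket oV HX HY Vq).1.
have -> : bracket X Y q = lcomb (bc0 cf oV HX HY q) (charT F q)
   (lcomb (bc1 oV ad HX HY q) (Z1 F q) (lcomb (bc2 oV ad HX HY q) (fconj (Z1 F) q) (fun=> 0))).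
  by apply/funext => f; rewrite (ad_expand cf ad f Vq tB) /lcomb !mkSE // addr0 addrA.
have lo := is_form1_lin un_omega_form (VF Vq).
have [t1 t2 t3] := And3 (ad_tT ad Vq) (ad_tZ ad Vq) (ad_tZb ad Vq).
have t0 := tangent0 q.
rewrite !lo ?(lin_on0 lo); repeat (try exact: tangent_lcomb); rewrite //.
  by rewrite addr0 addrA.
by apply: tangent_lcomb => //; apply: tangent_lcomb.
Qed.

Variable W : M -> R.
Hypothesis wW : webster_curvature xi J th W.

Lemma un_dom q X f g : vfield V X -> V q -> (forall z, V z -> f z = g z) -> X q f = X q g.
Proof. by move=> HX Vq; apply: field_near. Qed.

Lemma un_W q : V q -> (W q)%:C%C = Wsf q.
Proof.
move=> Vq; have Fq := VF Vq; have [HT Z0] : vfield (fdom F) (charT F) /\ vfield (fdom F) (Z1 F).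
  by case: uF => _ [[]].
have := wW uF Z0 (vfield_fconj Z0) Fq.
have [h1 h2 h3] := ad_1 ad Vq; have [g1 g2 g3] := ad_1b ad Vq.
have f2 := ad_thZ cf ad Vq; have f3 := ad_thZb cf ad Vq.
rewrite /conj2 /wedge.
have -> : fconj (fconj (Z1 F)) = Z1 F by apply/funext => z; rewrite /fconj vconjK.
rewrite h2 h3 g2 g3 f2 f3 => H.
have -> : (W q)%:C%C = ext_d (omega F) (Z1 F) (fconj (Z1 F)) q.
  by rewrite H !(mulr0, mul0r, mulr1, subr0, conjC0, addr0).
rewrite /ext_d (un_bracket (ad_Z ad) (ad_Zb ad) Vq).
have [om1 om2 om3 _] := un_forms Vq.
have [b0 _] := ad_bc0 cf oV ad; rewrite b0 (ad_bc1 oV ad).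
have -> : bc2 oV ad (ad_Z ad) (ad_Zb ad) = - P by rewrite /adp opprK.
have oz z : V z -> [/\ omega F z (Z1 F z) = P z & omega F z (fconj (Z1 F) z) = - (P z)^*].
  by move=> Vz; have [? ? _ _] := un_forms Vz.
rewrite (un_dom (g := fun z => - (scj P z)) (ad_Z ad) Vq); last first.
  by move=> z Vz; rewrite sf_cj; have [_ ->] := oz z Vz.
rewrite (un_dom (g := P) (ad_Zb ad) Vq); last by move=> z Vz; have [->] := oz z Vz.
rewrite (tanN (ad_tZ ad Vq)); last exact: (sf_smooth (scj P) Vq).
rewrite om1 om2 om3 /Wsf !(sf_nat oV _ Vq, sfD, sfN, sfM, sf_cj) !sderE // sf_cst //.
ring.
Qed.

Lemma un_sublap (f : A) (g : M -> C) q : V q -> (forall z, V z -> g z = f z) ->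
  [/\ sublaplacian F g q = lap DZ DZb P (scj P) f q,
      d1 F g q = DZ f q & d1b F g q = DZb f q].
Proof.
move=> Vq gf; have [om1 om2 om3 _] := un_forms Vq.
have e1 z : V z -> d1 F g z = DZ f z by move=> Vz; rewrite sderE //; apply: un_dom (ad_Z ad) Vz gf.
have e2 z : V z -> d1b F g z = DZb f z by move=> Vz; rewrite sderE //; apply: un_dom (ad_Zb ad) Vz gf.
split; [|exact: e1|exact: e2].
rewrite /sublaplacian /d11b /d1b1 {1}/d1b {3}/d1 e1 // e2 //.
rewrite (un_dom (ad_Zb ad) Vq e1) (un_dom (ad_Z ad) Vq e2) /conj1 om2.
have -> : (- (P q)^*)^* = - P q by rewrite rmorphN /= conjK.
rewrite /lap !(sfD, sfM, sf_cj) !mulNr !opprK.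
by rewrite [sder _ (sder _ f) q]sderE // [sder _ (sder _ f) q]sderE.
Qed.

Hypothesis tz : forall q, V q -> tors F q = 0.

Lemma un_tf : torsion_free DZ DZb DT (sio oV) P (scj P) (adr oV ad) Wsf.
Proof.
have t0 : adt oV ad = 0.
  apply: sfun_eq => q Vq; have [_ _ _ E] := un_forms Vq; rewrite sf0.
  by rewrite -[LHS]conjK -E tz // conjC0.
have c2 f : DT (DZ f) = DZ (DT f) + adr oV ad * DZ f.
  by have := ad_comm2 cf (oU := oV) ad f; rewrite t0 => h; apply: (lc1 (esym h)); ring.
have r' : scj (adr oV ad) = - adr oV ad.
  by apply: sfun_eq => q Vq; rewrite sf_cj sfN (ad_rimag_pt cf oV ad Vq).
have sc0 : scj (0 : A) = 0 by apply: sfun_eq => q Vq; rewrite sf_cj !sf0 conjC0.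
have cst0 X (HX : vfield V X) : sder (oU := oV) HX (sio oV) = 0 by exact: sder_cst.
(* The curvature equation on the pair [(Z, T)]: with vanishing torsion its right-hand side is 0
   there. The relation for [scj P] is the conjugate. *)
have Tp : DT P = DZ (adr oV ad) + adr oV ad * P.
  apply: sfun_eq => q Vq; have Fq := VF Vq.
  have [HT Z0] : vfield (fdom F) (charT F) /\ vfield (fdom F) (Z1 F) by case: uF => _ [[]].
  have Hb := vfield_fconj Z0.
  have A0 z : V z -> A11_1b F z = 0.
    move=> Vz; rewrite /A11_1b /A11 tz // conjC0 mulr0 subr0.
    rewrite (un_dom (g := fun=> 0) (ad_Zb ad) Vz) ?(tan_cst _ (ad_tZb ad Vz)) //.
    by move=> y Vy; rewrite tz // conjC0.
  have := wW uF Z0 HT Fq; rewrite /conj2 A0 // !mul0r conjC0 subr0 addr0.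
  have [h1 h2 h3] := ad_1 ad Vq; have [g1 g2 g3] := ad_1b ad Vq.
  rewrite /wedge h1 h2 g1 g2 !(mulr0, mul0r) subr0 mulr0 /ext_d.
  rewrite (un_bracket (ad_Z ad) (ad_T ad) Vq).
  have [om1 om2 om3 _] := un_forms Vq; have [_ b0] := ad_bc0 cf oV ad.
  have -> : bc1 oV ad (ad_Z ad) (ad_T ad) = - adr oV ad by rewrite /adr opprK.
  rewrite b0 -/(adt oV ad) t0 sf0 sfN om1.
  have oz z : V z -> omega F z (Z1 F z) = P z /\ omega F z (charT F z) = adr oV ad z.
    by move=> Vz; have [? _ ? _] := un_forms Vz.
  rewrite (un_dom (g := adr oV ad) (ad_Z ad) Vq); last by move=> z /oz[].
  rewrite (un_dom (g := P) (ad_T ad) Vq); last by move=> z /oz[].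
  by rewrite sfD sfM !sderE // => h; apply: (lc1 (esym h)); ring.
split; try exact: sder_deriv; try exact: cst0.
- exact: sio2.
- exact: (ad_comm1 cf ad).
- exact: c2.
- by move=> f; 
    have := ad_comm3 cf (oU := oV) ad f; rewrite t0 r' sc0 => h; apply: (lc1 (esym h)); ring.
- exact: Tp.
- have := congr1 (@scj _ _ _ oV) Tp; rewrite -(sder_Tconj ad) => ->.
  rewrite scjD scjM r' -{1}(scjK (adr oV ad)) -(sder_conj ad) r'.
  by rewrite (derN (sder_deriv oV (ad_Zb ad))); ring.
- by [].
Qed.

End Local.
End Unitary.

(** * Comparison of the frames of two contact forms *)

Section Comparison.
Context {R : realType} {M : manifold3 R}.
Local Notation C := R[i].
Variables (xi : M -> tvec M -> Prop) (J : M -> tvec M -> tvec M).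
Hypothesis hJ : cr_structure xi J.
Variables (th th' : form1 M).
Hypotheses (cf : contact_form setT xi th) (cf' : contact_form setT xi th').

(** The vector [v - th(v) v0] lies in the complexified contact plane, the common kernel of both
    forms. *)
Lemma contact_scale q v v0 : tangent q v -> tangent q v0 -> th q v0 = 1 ->
  th' q v = th' q v0 * th q v.
Proof.
move=> tv tv0 v01; have l' := th_lin cf' (q := q); have l := th_lin cf (q := q).
have tw := tangent_lcomb (- th q v) tv0 tv.
have : complexified xi q (lcomb (- th q v) v0 v).
  by apply/(complexifiedP cf); split=> //; rewrite l // v01; ring.
by move/(complexifiedP cf')=> [_]; rewrite l' // => h; apply: (lc1 h); ring.
Qed.

Variables (F F' : frame M).
Hypotheses (uF : unitary_frame xi J th F) (uF' : unitary_frame xi J th' F').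
Variables (V : set M) (oV : open V) (VF : V `<=` fdom F) (VF' : V `<=` fdom F').
Variables (c : chart R M) (ac : atlas M c) (Vc : V `<=` chart_dom c).
Let ad := un_ad uF VF.
Let ad' := un_ad uF' VF'.
Local Notation A := (sfun oV).
Local Notation P := (adp oV ad).
Local Notation P' := (adp oV ad').
Local Notation DZ := (sder (oU := oV) (ad_Z ad)).
Local Notation DZb := (sder (oU := oV) (ad_Zb ad)).
Local Notation DT := (sder (oU := oV) (ad_T ad)).
Local Notation DZ' := (sder (oU := oV) (ad_Z ad')).
Local Notation DZb' := (sder (oU := oV) (ad_Zb ad')).
Local Notation DT' := (sder (oU := oV) (ad_T ad')).

Definition cmp_z : A :=
  mkS oV (fun q (Vq : V q) => is_form1_smooth oV (ad_th1 ad) (ad_Z ad') Vq).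
Definition cmp_u : A :=
  mkS oV (fun q (Vq : V q) => is_form1_smooth oV (ad_th cf V) (ad_T ad') Vq).
Definition cmp_x : A :=
  mkS oV (fun q (Vq : V q) => is_form1_smooth oV (ad_th1 ad) (ad_T ad') Vq).
Definition cmp_v : A :=
  mkS oV (fun q (Vq : V q) => is_form1_smooth oV (ad_th cf' V) (ad_T ad) Vq).

Lemma cmp_Z f : DZ' f = cmp_z * DZ f.
Proof.
apply: sfun_eq => q Vq; rewrite sfM !sderE // mkSE //.
exact: (holomorphic_vectorE hJ cf ad _ Vq (pa_xi ad' Vq) (pa_J ad' Vq)).
Qed.

Lemma cmp_Zb f : DZb' f = scj cmp_z * DZb f.
Proof. by rewrite !(sder_conj ad') !(sder_conj ad) cmp_Z scjM. Qed.

Lemma cmp_T f : DT' f = cmp_u * DT f + cmp_x * DZ f + scj cmp_x * DZb f.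
Proof.
apply: sfun_eq => q Vq; rewrite !(sfD, sfM, sf_cj) !sderE // !mkSE //.
rewrite (ad_expand cf ad f Vq (ad_tT ad' Vq)) /conj1; congr (_ + _ * _).
by rewrite (ad_Treal ad' Vq).
Qed.

Lemma cmp_vu : cmp_v * cmp_u = 1.
Proof.
apply: sfun_eq => q Vq; rewrite sfM sf1 // !mkSE //.
rewrite -(contact_scale (ad_tT ad' Vq) (ad_tT ad Vq) (ad_thT ad Vq)).
exact: (ad_thT ad' Vq).
Qed.

Lemma cmp_ureal : scj cmp_u = cmp_u.
Proof.
apply: sfun_eq => q Vq; rewrite sf_cj !mkSE // -(th_conj cf (ad_tT ad' Vq)).
by rewrite (ad_Treal ad' Vq).
Qed.

Variable W : M -> R.
Hypothesis wW : webster_curvature xi J th W.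
Hypothesis tz : forall q, V q -> tors F q = 0.
Let tf := un_tf cf uF oV VF wW tz.
Let ind := ad_indep cf (oU := oV) (ad := ad) ac Vc.

Let c1 f : cmp_z * DZ (scj cmp_z * DZb f) = scj cmp_z * DZb (cmp_z * DZ f)
  - sio oV * (cmp_u * DT f + cmp_x * DZ f + scj cmp_x * DZb f)
  + scj P' * (cmp_z * DZ f) - P' * (scj cmp_z * DZb f).
Proof. by rewrite -!(cmp_Z, cmp_Zb) -cmp_T; exact: (ad_comm1 cf' ad'). Qed.

Let c2 f : cmp_z * DZ (cmp_u * DT f + cmp_x * DZ f + scj cmp_x * DZb f) =
  cmp_u * DT (cmp_z * DZ f) + cmp_x * DZ (cmp_z * DZ f) + scj cmp_x * DZb (cmp_z * DZ f)
  - adr oV ad' * (cmp_z * DZ f) + adt oV ad' * (scj cmp_z * DZb f).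
Proof. by rewrite -!(cmp_Z, cmp_Zb) -!cmp_T; exact: (ad_comm2 cf' ad'). Qed.

Lemma cmp_uz : cmp_u = cmp_z * scj cmp_z.
Proof. exact: (conformal_u tf ind c1). Qed.

Let xE : cmp_x = sio oV * DZb cmp_u.
Proof.
have := conformal_xb tf ind cmp_vu c1 c2; move/(congr1 (@scj _ _ _ oV)).
rewrite scjK (sder_conj ad) cmp_ureal => ->.
apply: sfun_eq => q Vq; rewrite !(sf_cj, sfN, sfM) !sf_cst //.
by rewrite -mulNr conjM; congr (_ * _); apply: eqC => /=; ring.
Qed.

Lemma cmp_lap f : lap DZ' DZb' P' (scj P') f =
  cmp_u * lap DZ DZb P (scj P) f - (DZ cmp_u * DZb f + DZb cmp_u * DZ f).
Proof.
by rewrite /lap !(cmp_Z, cmp_Zb); exact: (conformal_lap tf ind cmp_vu c1 c2 xE f).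
Qed.

Lemma cmp_W : cmp_u * Wsf uF' oV VF' =
  cmp_u * (cmp_u * Wsf uF oV VF + 2 * lap DZ DZb P (scj P) cmp_u)
  - 6 * DZ cmp_u * DZb cmp_u.
Proof.
apply: (conformal_W tf ind cmp_vu c1 c2 xE); rewrite -!(cmp_Z, cmp_Zb) //.
Qed.

End Comparison.

(** * Curvature of torsion-free spherical structures *)

Section SphericalCurvature.
Context {R : realType} {M : manifold3 R}.
Local Notation C := R[i].
Variables (xi : M -> tvec M -> Prop) (J : M -> tvec M -> tvec M).
Hypothesis hJ : cr_structure xi J.
Variable th : form1 M.
Hypothesis cf : contact_form setT xi th.
Variable F : frame M.
Hypothesis uF : unitary_frame xi J th F.
Variables (V : set M) (oV : open V) (VF : V `<=` fdom F).
Let ad := un_ad uF VF.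
Local Notation A := (sfun oV).
Local Notation P := (adp oV ad).
Local Notation DZ := (sder (oU := oV) (ad_Z ad)).
Local Notation DZb := (sder (oU := oV) (ad_Zb ad)).
Variable W : M -> R.
Hypothesis wW : webster_curvature xi J th W.
Local Notation w := (Wsf uF oV VF).

Lemma Wsf_real : scj w = w.
Proof.
apply: sfun_eq => q Vq; rewrite sf_cj -(un_W cf uF oV VF wW Vq).
by apply: eqC => /=; ring.
Qed.

Hypothesis tz : forall q, V q -> tors F q = 0.
Variables (F1 F2 : M -> C).
Hypothesis sF : forall q, V q -> csmooth_at q F1 /\ csmooth_at q F2.
Hypothesis F12 : forall q, V q -> F1 q * (F1 q)^* + F2 q * (F2 q)^* = 1.
Hypothesis imm : forall q v, V q -> real_tangent q v -> v F1 = 0 -> v F2 = 0 -> v = (fun=> 0).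
Hypothesis JF : forall q v, V q -> xi q v -> J q v F1 = 'i * v F1 /\ J q v F2 = 'i * v F2.

Let f1 : A := mkS oV (fun q (Vq : V q) => (sF Vq).1).
Let f2 : A := mkS oV (fun q (Vq : V q) => (sF Vq).2).

Let JFc q v : V q -> complexified xi q v ->
  J q v F1 = 'i * v F1 /\ J q v F2 = 'i * v F2.
Proof.
move=> Vq [a [b [xa xb ->]]]; case: hJ => _ _ Jl _.
have cx v' : xi q v' -> complexified xi q v'.
  by move/(xi_kernel cf)=> [[? _] ?]; apply/(complexifiedP cf).
have [a1 a2] := JF Vq xa; have [b1 b2] := JF Vq xb.
rewrite Jl; try exact: cx.
by rewrite /lcomb a1 a2 b1 b2; split; ring.
Qed.

Let ZbF q : V q -> fconj (Z1 F) q F1 = 0 /\ fconj (Z1 F) q F2 = 0.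
Proof.
move=> Vq; have cZ := pa_xi ad Vq.
have cb : complexified xi q (fconj (Z1 F) q).
  by apply/(complexifiedP cf); split; [exact: (ad_tZb ad Vq)|exact: (ad_thZb cf ad Vq)].
have [e1 e2] := JFc Vq cb.
have Jb f : J q (fconj (Z1 F) q) f = - 'i * fconj (Z1 F) q f.
  rewrite /fconj (J_conj hJ cf cZ) (pa_J ad Vq) /vconj conjM.
  by congr (_ * _); apply: eqC => /=; ring.
have i2 : 'i * 'i = -1 :> C by apply: eqC => /=; ring.
have K (x : C) : - 'i * x = 'i * x -> x = 0.
  move/(congr1 (fun y => 'i * y)) => h; have : x * 2%:R = 0.
    by apply: (lc2 (c := 2%:R * x) h i2); ring.
  by move/eqP; rewrite mulf_eq0 pnatr_eq0 orbF => /eqP.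
by split; apply: K; rewrite -Jb.
Qed.

Let Zbf : DZb f1 = 0 /\ DZb f2 = 0.
Proof.
by split; apply: sfun_eq => q Vq; rewrite sf0 sder_mk //; have [] := ZbF Vq.
Qed.

Let Zg : DZ (scj f1) = 0 /\ DZ (scj f2) = 0.
Proof.
have sc0 : scj (0 : A) = 0 by apply: sfun_eq => q Vq; rewrite sf_cj !sf0 conjC0.
have [e1 e2] := Zbf; split.
  by rewrite -[DZ _]scjK -(sder_conj ad) e1 sc0.
by rewrite -[DZ _]scjK -(sder_conj ad) e2 sc0.
Qed.

Let N : A := DZ f1 * DZb (scj f1) + DZ f2 * DZb (scj f2).

Let NE q : V q -> N q = (Z1 F q F1) * (Z1 F q F1)^* + (Z1 F q F2) * (Z1 F q F2)^*.
Proof.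
move=> Vq; rewrite /N !sfD !sfM !(sder_conj ad) !scjK !sf_cj.
by rewrite !sder_mk.
Qed.

Let sqn (x : C) : x * x^* = (complex.Re x ^+ 2 + complex.Im x ^+ 2)%:C%C.
Proof. by case: x => a b; apply: eqC => /=; ring. Qed.

Let Npos q : V q -> 0 < complex.Re (N q) /\ N q = (complex.Re (N q))%:C%C.
Proof.
move=> Vq; rewrite NE // !sqn; split; last by apply: eqC => /=; ring.
rewrite lt_neqAle; apply/andP; split; last by rewrite /= !addr_ge0 // sqr_ge0.
apply/negP => /eqP /= /esym H.
have z0 x y : x ^+ 2 + y ^+ 2 = 0 :> R -> x = 0 /\ y = 0.
  move/eqP; rewrite paddr_eq0 ?sqr_ge0 // !sqrf_eq0 => /andP[/eqP-> /eqP->] //.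
have H' : complex.Re (Z1 F q F1) ^+ 2 + complex.Im (Z1 F q F1) ^+ 2 = 0 /\
   complex.Re (Z1 F q F2) ^+ 2 + complex.Im (Z1 F q F2) ^+ 2 = 0.
  by move/eqP: H; rewrite paddr_eq0 ?addr_ge0 ?sqr_ge0 // => /andP[/eqP-> /eqP->].
have [/z0[a1 a2] /z0[b1 b2]] := H'.
have e1 : Z1 F q F1 = 0 by apply: eqC.
have e2 : Z1 F q F2 = 0 by apply: eqC.
have [g1 g2] := ZbF Vq.
(* If [Z1] annihilated both components, the real vector [Z1 + conj Z1] would be killed by the
   immersion, although [th1] is 1 on it. *)
have tZ := ad_tZ ad Vq; have tb := ad_tZb ad Vq.
have tv := tangent_lcomb 1 tZ tb.
have rv : vconj (lcomb 1 (Z1 F q) (fconj (Z1 F) q)) = lcomb 1 (Z1 F q) (fconj (Z1 F) q).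
  rewrite vconj_lcomb /fconj vconjK conjC1; apply/funext => f; rewrite /lcomb; ring.
have vz := imm Vq (conj tv rv).
have h1 : lcomb 1 (Z1 F q) (fconj (Z1 F) q) = (fun=> 0).
  by apply: vz; rewrite /lcomb ?e1 ?e2 ?g1 ?g2; ring.
have lt := ad_th1l ad Vq; have [_ k2 k3] := ad_1 ad Vq.
have := lt 1 _ _ tZ tb; rewrite h1 k2 k3 (lin_on0 lt) => /eqP.
by rewrite mulr1 addr0 eq_sym oner_eq0.
Qed.

Let sS q (Vq : V q) : csmooth_at q (fun z => ((complex.Re (N z))^-1)%:C%C : C).
Proof.
apply: csmooth_real; apply: smooth_atV; first by rewrite gt_eqF //; case: (Npos Vq).
by have [] := sf_smooth N Vq.
Qed.

Lemma sph_W11 : DZ (DZ w) = P * DZ w.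
Proof.
have [zb1 zb2] := Zbf; have [zg1 zg2] := Zg.
have fg : f1 * scj f1 + f2 * scj f2 = 1.
  by apply: sfun_eq => q Vq; rewrite sfD !sfM !sf_cj sf1 // !mkSE // F12.
have sN : mkS oV sS * N = 1.
  apply: sfun_eq => q Vq; rewrite sfM mkSE // sf1 //; have [n0 nE] := Npos Vq.
  by rewrite {2}nE -rmorphM /= mulVf // gt_eqF.
exact: (sphere_ZZW (un_tf cf uF oV VF wW tz) zb1 zb2 zg1 zg2 fg erefl sN).
Qed.

Lemma sph_W11b : DZb (DZb w) = scj P * DZb w.
Proof.
have := congr1 (@scj _ _ _ oV) sph_W11; rewrite scjM.
by rewrite !(sder_conj ad) !scjK Wsf_real.
Qed.

Local Notation c2 := (lap DZ DZb P (scj P) w + w ^+ 2).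
Local Notation d6 := (6 * DZ w * DZb w - 3 * c2 * w + w ^+ 3).
Local Notation DT := (sder (oU := oV) (ad_T ad)).

Lemma sph_const : [/\ DZ c2 = 0, DZb c2 = 0 & DT c2 = 0] /\
  [/\ DZ d6 = 0, DZb d6 = 0 & DT d6 = 0].
Proof.
split; first exact: (tf_c2 (un_tf cf uF oV VF wW tz) sph_W11 sph_W11b).
exact: (tf_d6 (un_tf cf uF oV VF wW tz) sph_W11 sph_W11b).
Qed.

End SphericalCurvature.

Section RealPart.
Context {R : realType}.
Lemma rcD (a b : R) : (a + b)%:C%C = a%:C%C + b%:C%C :> R[i]. Proof. exact: rmorphD. Qed.
Lemma rcB (a b : R) : (a - b)%:C%C = a%:C%C - b%:C%C :> R[i]. Proof. exact: rmorphB. Qed.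
Lemma rcM (a b : R) : (a * b)%:C%C = a%:C%C * b%:C%C :> R[i]. Proof. exact: rmorphM. Qed.
Lemma rcX (a : R) n : (a ^+ n)%:C%C = a%:C%C ^+ n :> R[i]. Proof. exact: rmorphXn. Qed.
Lemma rc_nat n : (n%:R)%:C%C = n%:R :> R[i]. Proof. exact: rmorph_nat. Qed.
Lemma rcI (a b : R) : a%:C%C = b%:C%C -> a = b. Proof. exact: complexI. Qed.
Definition rcE := (rcB, rcD, rcM, rcX, rc_nat).
End RealPart.

(** * Torsion-free spherical structures and conformal change *)

Section TorsionFreeStructure.
Context {R : realType} {M : manifold3 R}.
Local Notation C := R[i].
Variables (xi : M -> tvec M -> Prop) (J : M -> tvec M -> tvec M).
Hypothesis hJ : cr_structure xi J.
Variable th : form1 M.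
Hypothesis pos : positive_pseudohermitian xi J th.
Hypothesis tz : vanishing_torsion xi J th.
Variable W : M -> R.
Hypothesis wW : webster_curvature xi J th W.
Let cf : contact_form setT xi th := pos.1.

Lemma local_domain q (B : set M) F : fdom F q -> open (fdom F) -> nbhs q B ->
  exists (V : set M) (oV : open V) c, [/\ V q, V `<=` fdom F, V `<=` B,
    atlas M c & V `<=` chart_dom c].
Proof.
move=> Fq oF nB; have [c ac cq] := chart_at q.
have oV : open (fdom F `&` B° `&` chart_dom c).
  apply: openI; last exact: chart_dom_open.
  by apply: openI => //; exact: open_interior.
exists (fdom F `&` B° `&` chart_dom c), oV, c; split=> //.
- by move=> z [[]].
- by move=> z [[_ /interior_subset]].
Qed.

(** The case of equal contact forms in the comparison: [u = 1], so [z] is unitary and the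
    transformation law of [lap] becomes invariance. *)
Lemma lap_frame F F' (g : M -> C) q : unitary_frame xi J th F -> unitary_frame xi J th F' ->
  fdom F q -> fdom F' q -> csmooth_at q g ->
  sublaplacian F' g q = sublaplacian F g q /\
  d1 F' g q * d1b F' g q = d1 F g q * d1b F g q.
Proof.
move=> uF uF' Fq F'q gS.
have nB : nbhs q (fdom F' `&` [set z | csmooth_at z g]).
  by apply: filterI; [exact: (open_near (un_open uF'))|exact: csmooth_near].
have [V [oV [c [Vq VF VB ac Vc]]]] := local_domain Fq (un_open uF) nB.
have VF' : V `<=` fdom F' by move=> z /VB[].
pose f := mkS oV (fun z (Vz : V z) => (VB z Vz).2).
have gf z : V z -> g z = f z by move=> Vz; rewrite mkSE.
have [-> -> ->] := un_sublap cf uF VF Vq gf.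
have [-> -> ->] := un_sublap cf uF' VF' Vq gf.
have tV z : V z -> tors F z = 0 by move=> Vz; apply: tz (VF _ Vz).
have u1 : cmp_u cf uF' oV VF' = 1.
  by apply: sfun_eq => z Vz; rewrite sf1 // mkSE // (ad_thT (un_ad uF' VF') Vz).
rewrite (cmp_lap hJ cf cf uF uF' VF VF' ac Vc wW tV f) u1.
rewrite !(der1 (sder_deriv oV _)) !mul0r addr0 subr0 mul1r; split=> //.
rewrite (cmp_Z hJ cf uF uF' VF VF') (cmp_Zb hJ cf uF uF' VF VF') !sfM.
have := congr1 (fun h : sfun oV => h q) (cmp_uz hJ cf cf uF uF' oV VF VF' ac Vc wW tV).
rewrite u1 sf1 // sfM => h; apply: (lc2 (c := - (sder (oU := oV) (ad_Z (un_ad uF VF)) f q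
  * sder (oU := oV) (ad_Zb (un_ad uF VF)) f q)) (erefl (0 : C)) h); ring.
Qed.

Lemma frame_at q : {F | unitary_frame xi J th F /\ fdom F q}.
Proof. by apply/cid; have [F ? ?] := positive_frame hJ cf q pos; exists F. Qed.

(** A frame is chosen at each point separately; [Lap_local] shows that the result agrees with [lap]
    in any unitary frame. *)
Definition Lap (f : M -> R) q : R := complex.Re (sublaplacian (sval (frame_at q)) (rl f) q).
Definition Grad2 (f : M -> R) q : R :=
  complex.Re (d1 (sval (frame_at q)) (rl f) q * d1b (sval (frame_at q)) (rl f) q).

Section Local.
Variables (F : frame M) (uF : unitary_frame xi J th F).
Variables (V : set M) (oV : open V) (VF : V `<=` fdom F).
Let ad := un_ad uF VF.
Local Notation A := (sfun oV).
Local Notation P := (adp oV ad).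
Local Notation DZ := (sder (oU := oV) (ad_Z ad)).
Local Notation DZb := (sder (oU := oV) (ad_Zb ad)).

Lemma lap_real (f : A) : scj f = f -> scj (lap DZ DZb P (scj P) f) = lap DZ DZb P (scj P) f.
Proof.
move=> fr; rewrite /lap !scjD !scjM scjK.
have e : scj (DZ f) = DZb f by rewrite (sder_conj ad) fr.
have e' : scj (DZb f) = DZ f by rewrite -e scjK.
have e1 : scj (DZb (DZ f)) = DZ (DZb f) by rewrite (sder_conj ad) scjK e.
have e2 : scj (DZ (DZb f)) = DZb (DZ f) by rewrite -e1 scjK.
by rewrite e e' e1 e2; ring.
Qed.

Lemma Lap_local (f : A) (g : M -> R) : (forall z, V z -> f z = (g z)%:C%C) ->
  forall q, V q -> (Lap g q)%:C%C = lap DZ DZb P (scj P) f q /\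
    (Grad2 g q)%:C%C = (DZ f * DZb f) q.
Proof.
move=> fg q Vq; have fr : scj f = f.
  by apply: sfun_eq => z Vz; rewrite sf_cj fg //; apply: eqC => /=; ring.
have gf z : V z -> rl g z = f z by move=> Vz; rewrite fg.
have [uF0 F0q] := svalP (frame_at q).
have gS : csmooth_at q (rl g).
  by apply: (csmooth_eqU oV Vq _ (sf_smooth f Vq)) => z Vz; rewrite gf.
have [e1 e2] := lap_frame uF uF0 (VF Vq) F0q gS.
have [k1 k2 k3] := un_sublap cf uF VF Vq gf.
rewrite /Lap /Grad2 e1 e2 k1 k2 k3 -sfM.
have re (h : A) : scj h = h -> (complex.Re (h q))%:C%C = h q.
  move/(congr1 (fun k : A => k q)); rewrite sf_cj; case: (h q) => a b.
  by move/(congr1 (@complex.Im R)) => /= e; apply: eqC => //=; lra.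
split; first by apply: re; exact: lap_real.
apply: re; rewrite scjM.
have e : scj (DZ f) = DZb f by rewrite (sder_conj ad) fr.
by rewrite -e scjK mulrC.
Qed.

End Local.

Lemma W_smooth q : smooth_at q W.
Proof.
have [uF Fq] := svalP (frame_at q).
have := sf_smooth (Wsf uF (un_open uF) (@subset_refl _ _)) Fq => -[+ _].
apply: smooth_at_eq; apply: filterS (open_near (un_open uF) Fq) => z Fz.
by rewrite -(un_W cf uF (un_open uF) _ wW Fz).
Qed.

Lemma local_max_lap (f : M -> R) q : smooth_at q f ->
  (\forall z \near q, f z <= f q) -> Grad2 f q = 0 /\ Lap f q <= 0.
Proof.
move=> fS fq; have [uF Fq] := svalP (frame_at q); set F := sval _ in uF Fq.
have [c ac cq] := chart_at q.
have [G [GS fE Gneg]] := local_max_real ac cq fS fq.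
have nB : nbhs q [set z | chart_dom c z /\ (forall jk : 'I_3 * 'I_3, smooth_at z (G jk.1 jk.2)) /\
   f z = f q + \sum_j \sum_k (chart_map c z 0 j - chart_map c q 0 j) *
     ((chart_map c z 0 k - chart_map c q 0 k) * G j k z)].
  apply: filterI; first exact: chart_dom_nbhs.
  by apply: filterI => //; apply: filter_forall => jk; exact: smooth_at_near (GS _ _).
have [V [oV [_ [Vq VF VB _ _]]]] := local_domain Fq (un_open uF) nB.
pose x j := mkS oV (fun z (Vz : V z) => csmooth_coord j ac (VB z Vz).1)
  - scst oV (chart_map c q 0 j)%:C%C.
pose g j k := mkS oV (fun z (Vz : V z) => csmooth_real ((VB z Vz).2.1 (j, k))).
pose h := scst oV (f q)%:C%C + \sum_j \sum_k x j * (x k * g j k).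
have sfsum (m : nat) (k : 'I_m -> sfun oV) z : (\sum_j k j) z = \sum_j k j z.
  by elim/big_rec2: _ => [|j y1 y2 _ <-]; rewrite ?sf0 ?sfD.
have xE j z : V z -> x j z = (chart_map c z 0 j - chart_map c q 0 j)%:C%C.
  by move=> Vz; rewrite /x sfD sfN mkSE // sf_cst // -rmorphB.
have x0 j : x j q = 0 by rewrite xE // subrr.
have rs (k : 'I_3 -> R) : (\sum_j k j)%:C%C = \sum_j (k j)%:C%C :> C by exact: rmorph_sum.
have hE z : V z -> h z = (f z)%:C%C.
  move=> Vz; rewrite (VB z Vz).2.2 /h sfD sf_cst // sfsum rcD rs.
  congr (_ + _); apply: eq_bigr => j _; rewrite sfsum rs.
  by apply: eq_bigr => k _; rewrite !sfM !xE // mkSE // !rcM.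
have gE j k : g j k q = (G j k q)%:C%C by rewrite mkSE.
have [LE GE] := Lap_local uF VF hE Vq.
have hD : h = scst oV (f q)%:C%C + \sum_j \sum_k x j * (x k * g j k) by [].
clearbody x g h.
set ad := un_ad uF VF in LE GE.
set DZ := sder (ad_Z ad) in LE GE; set DZb := sder (ad_Zb ad) in LE GE.
have dZ : derivation DZ := sder_deriv oV (ad_Z ad).
have dZb : derivation DZb := sder_deriv oV (ad_Zb ad).
have dsum D : derivation D -> forall k : 'I_3 -> sfun oV, D (\sum_j k j) = \sum_j D (k j).
  by move=> dD k; elim/big_rec2: _ => [|j y1 y2 _ <-]; rewrite ?(der0 dD) ?(derD dD).
have Dh D : derivation D -> (forall a, D (scst oV a) = 0) -> D h q = 0.
  move=> dD Dc; rewrite hD derD // Dc add0r dsum // sfsum big1 // => j _.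
  rewrite dsum // sfsum big1 // => k _.
  by rewrite !(derM dD) !(sfD, sfM) !x0; ring.
have Zh : DZ h q = 0 by apply: Dh => // a; exact: sder_cst.
split; first by have := GE; rewrite sfM Zh mul0r => /(congr1 (@complex.Re R)).
have DDh D D' : derivation D -> derivation D' -> (forall a, D (scst oV a) = 0) ->
   (forall a, D' (scst oV a) = 0) ->
   D (D' h) q = \sum_j \sum_k (D (x j) q * D' (x k) q + D' (x j) q * D (x k) q) * g j k q.
  move=> dD dD' Dc D'c; rewrite hD (derD dD') D'c add0r dsum // dsum // sfsum.
  apply: eq_bigr => j _; rewrite dsum // dsum // sfsum; apply: eq_bigr => k _.
  rewrite !(derM dD', derD dD') !(derM dD, derD dD) !(sfD, sfM) !x0.
  by ring.
have cZ a : DZ (scst oV a) = 0 by exact: sder_cst.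
have cZb a : DZb (scst oV a) = 0 by exact: sder_cst.
have Zbh : DZb h q = 0 by apply: Dh.
have xZb j : DZb (x j) q = (DZ (x j) q)^*.
  rewrite /DZb (sder_conj ad) sf_cj; congr (_ ^*); congr (DZ _ q).
  by apply: sfun_eq => z Vz; rewrite sf_cj xE //; apply: eqC => /=; ring.
pose a : 'rV[R]_3 := \row_j complex.Re (DZ (x j) q).
pose b : 'rV[R]_3 := \row_j complex.Im (DZ (x j) q).
(* Since [x j] vanishes at [q], only products of first derivatives of the coordinates survive. With
   [DZ (x j) = a_j + i b_j], the sublaplacian is 4 (Q(a) + Q(b)), where Q is the quadratic form of
   [local_max_real]. *)
have L2 : (Lap f q)%:C%C = (4 * (\sum_j \sum_k a 0 j * (a 0 k * G j k q)
    + \sum_j \sum_k b 0 j * (b 0 k * G j k q)))%:C%C.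
  rewrite LE /lap !(sfD, sfM) Zh Zbh !mulr0 !addr0 !DDh //.
  pose s j := DZ (x j) q.
  transitivity (\sum_j \sum_k ((s j)^* * s k + s j * (s k)^*) * (G j k q)%:C%C
     + \sum_j \sum_k (s j * (s k)^* + (s j)^* * s k) * (G j k q)%:C%C).
    by congr (_ + _); apply: eq_bigr => j _; apply: eq_bigr => k _; rewrite !xZb gE.
  rewrite -big_split /= -big_split /= mulr_sumr rs; apply: eq_bigr => j _ /=.
  rewrite -!big_split /= mulr_sumr rs; apply: eq_bigr => k _ /=.
  rewrite !mxE -!/(s _); case: (s j) => ? ?; case: (s k) => ? ?.
  by apply: eqC => /=; ring.
move/(congr1 (@complex.Re R)): L2 => /= ->.
have := Gneg a; have := Gneg b; set A1 := \sum_j _; set A2 := \sum_j _; lra.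
Qed.

(** Meant for spatial extrema of the difference: there Z f = be Z W, so the gradient term of the
    flow equation equals that of the affine function. *)
Lemma Lap_sub_affine (f : M -> R) (al be : R) q : smooth_at q f ->
  Lap (fun z => f z - (al + be * W z)) q = Lap f q - be * Lap W q /\
  (Grad2 (fun z => f z - (al + be * W z)) q = 0 -> Grad2 f q = be ^+ 2 * Grad2 W q).
Proof.
move=> fS; have [uF Fq] := svalP (frame_at q); set F := sval _ in uF Fq.
have nB : nbhs q [set z | smooth_at z f /\ smooth_at z W].
  by apply: filterI; [exact: smooth_at_near fS|exact: smooth_at_near (@W_smooth q)].
have [V [oV [_ [Vq VF VB _ _]]]] := local_domain Fq (un_open uF) nB.
pose f' := mkS oV (fun z (Vz : V z) => csmooth_real (VB z Vz).1).
pose w' := mkS oV (fun z (Vz : V z) => csmooth_real (VB z Vz).2).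
pose h := f' - (scst oV al%:C%C + scst oV be%:C%C * w').
have fE z : V z -> f' z = (f z)%:C%C by move=> Vz; rewrite mkSE.
have wE z : V z -> w' z = (W z)%:C%C by move=> Vz; rewrite mkSE.
have hE z : V z -> h z = (f z - (al + be * W z))%:C%C.
  by move=> Vz; rewrite /h sfD sfN sfD sfM !sf_cst // fE // wE // rcB rcD rcM.
have [L1 G1] := Lap_local uF VF fE Vq; have [L2 G2] := Lap_local uF VF wE Vq.
have [L3 G3] := Lap_local uF VF hE Vq.
set ad := un_ad uF VF in L1 G1 L2 G2 L3 G3.
have Dh X (HX : vfield V X) : sder (oU := oV) HX h = sder HX f' - scst oV be%:C%C * sder HX w'.
  have dX := sder_deriv oV HX.
  by rewrite /h (derB dX) (derD dX) (derM dX) !sder_cst; ring.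
clearbody h f' w'.
split.
  apply: rcI; rewrite L3 rcB rcM L1 L2.
  rewrite -(sf_cst oV be%:C%C Vq) -sfM -sfN -sfD; congr (sf _ q); rewrite /lap !Dh.
  have dZ := sder_deriv oV (ad_Z ad); have dZb := sder_deriv oV (ad_Zb ad).
  by rewrite !(derB dZ, derM dZ, derB dZb, derM dZb) !sder_cst; ring.
move=> g0; rewrite g0 sfM !Dh !(sfD, sfN, sfM) !sf_cst // in G3.
apply: rcI; rewrite rcM rcX G1 G2 !sfM.
have cj (k : sfun oV) (k' : M -> R) : (forall z, V z -> k z = (k' z)%:C%C) ->
   sder (ad_Zb ad) k q = (sder (ad_Z ad) k q)^*.
  move=> kE; rewrite (sder_conj ad) sf_cj; congr (_ ^*); congr (sder _ _ q).
  by apply: sfun_eq => z Vz; rewrite sf_cj kE //; apply: eqC => /=; ring.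
rewrite (cj _ _ fE) (cj _ _ wE) in G3 *.
move: G3; set s := sder _ f' q; set t := sder _ w' q => G3.
have : s - be%:C%C * t = 0.
  have : (s - be%:C%C * t) * (s - be%:C%C * t)^* = 0.
    rewrite [RHS](_ : _ = 0%:C%C) // G3; congr (_ * _); rewrite rmorphB rmorphM /=.
    by congr (_ - _ * _); apply: eqC => /=; ring.
  case: (s - _) => x y /(congr1 (@complex.Re R)) /= h0.
  have h1 : x ^+ 2 + y ^+ 2 = 0 by apply: (lc1 h0); ring.
  move/eqP: h1; rewrite paddr_eq0 ?sqr_ge0 // !sqrf_eq0 => /andP[/eqP-> /eqP->].
  by apply: eqC.
move/eqP; rewrite subr_eq0 => /eqP ->; rewrite conjM.
have -> : (be%:C%C)^* = be%:C%C :> C by apply: eqC => /=; ring.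
by ring.
Qed.

Definition inv2 q := Lap W q + W q ^+ 2.
Definition inv6 q := 6 * Grad2 W q - 3 * inv2 q * W q + W q ^+ 3.

Lemma inv_locally_constant q : spherical xi J ->
  \forall z \near q, inv2 z = inv2 q /\ inv6 z = inv6 q.
Proof.
move=> sph; have [uF Fq] := svalP (frame_at q); set F := sval _ in uF Fq.
have [U [F1 [F2 [oU Uq [s1 s2 s3 s4 s5]]]]] := sph q.
have [V [oV [c [Vq VF VU ac Vc]]]] := local_domain Fq (un_open uF) (open_near oU Uq).
have tV z : V z -> tors F z = 0 by move=> Vz; apply: tz (VF _ Vz).
have sF z : V z -> csmooth_at z F1 /\ csmooth_at z F2 by move=> /VU /s1.
have F12 z : V z -> F1 z * (F1 z)^* + F2 z * (F2 z)^* = 1 by move=> /VU /s2.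
have imm z v : V z -> real_tangent z v -> v F1 = 0 -> v F2 = 0 -> v = (fun=> 0).
  by move=> /VU; exact: s4.
have JF z v : V z -> xi z v -> J z v F1 = 'i * v F1 /\ J z v F2 = 'i * v F2.
  by move=> /VU Uz /(s5 _ _ Uz)[].
have := sph_const hJ cf uF oV VF wW tV sF F12 imm JF.
have wE z : V z -> Wsf uF oV VF z = (W z)%:C%C by move=> Vz; rewrite (un_W cf uF oV VF wW Vz).
have LE := Lap_local uF VF wE.
set w := Wsf uF oV VF in wE LE *; set c2 := lap _ _ _ _ _ + _; set d6 := _ + w ^+ 3.
have c2E z : V z -> c2 z = (inv2 z)%:C%C.
  move=> Vz; have [L1 _] := LE z Vz.
  by rewrite /c2 sfD sfX // -L1 wE // /inv2 rcD rcX.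
have d6E z : V z -> d6 z = (inv6 z)%:C%C.
  move=> Vz; have [_ L2] := LE z Vz; rewrite /d6 sfD sfX // sfD sfN !sfM -mulrA -sfM -L2.
  rewrite !(sf_nat oV _ Vz) c2E // wE // /inv6.
  by rewrite !rcE.
have K (h : sfun oV) (g : M -> R) : (forall z, V z -> h z = (g z)%:C%C) ->
   [/\ sder (oU := oV) (ad_Z (un_ad uF VF)) h = 0, sder (oU := oV) (ad_Zb (un_ad uF VF)) h = 0
     & sder (oU := oV) (ad_T (un_ad uF VF)) h = 0] -> \forall z \near q, g z = g q.
  move=> hg [z1 z2 z3].
  apply: (frame_locally_constant (e := fun k z => fr (charT F) (Z1 F) z k)
     (phi := fun k z => cofr th (th1 F) z k)).
    have [+ _] := sf_smooth h Vq; apply: smooth_at_eq.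
    by apply: filterS (open_near oV Vq) => z Vz; rewrite hg.
  apply: filterS (open_near oV Vq) => z Vz; have adz := un_ad uF VF; split.
  - exact: (fr_tan adz Vz).
  - exact: (cofr_lin cf adz Vz).
  - exact: (fr_dual cf adz Vz).
  - have gh y : V y -> rl g y = h y by move=> Vy; rewrite hg.
    apply: (tri3P (P := fun v : tvec M => v (rl g) = 0)).
    + by rewrite (field_near oV (ad_T adz) Vz gh) -(sderE (ad_T (un_ad uF VF)) h Vz) z3 sf0.
    + by rewrite (field_near oV (ad_Z adz) Vz gh) -(sderE (ad_Z (un_ad uF VF)) h Vz) z1 sf0.
    + by rewrite (field_near oV (ad_Zb adz) Vz gh) -(sderE (ad_Zb (un_ad uF VF)) h Vz) z2 sf0.
by move=> [h1 h2]; apply: filterI; [exact: K c2E h1|exact: K d6E h2].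
Qed.

End TorsionFreeStructure.

(** * Moebius functions of the curvature *)

Section Mobius.
Context {A : comPzRingType}.
Variables (Z Zb : A -> A) (p pb a b c d w u v W' : A).
Hypotheses (dZ : derivation Z) (dZb : derivation Zb).
Hypotheses (Za : Z a = 0) (Zba : Zb a = 0) (Zb0 : Z b = 0) (Zbb : Zb b = 0)
  (Zc : Z c = 0) (Zbc : Zb c = 0) (Zd : Z d = 0) (Zbd : Zb d = 0).
Hypotheses (vu : v * u = 1) (uE : u = a + b * w).
Hypothesis lw : lap Z Zb p pb w = c - w ^+ 2.
Hypothesis gw : 6 * (Z w * Zb w) = d + 3 * c * w - w ^+ 3.

(* If u = a + b w, then u W' = [mob_b] w + [mob_g], of determinant [mob_k]; when
   [mob_k] = 1 the invariants c, d of w become [mob_c], [mob_d] for W'. *)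
Definition mob_b : A := a ^+ 2 - b ^+ 2 * c.
Definition mob_g : A := 2 * a * b * c - b ^+ 2 * d.
Definition mob_c : A := a ^+ 2 * c + b ^+ 2 * c ^+ 2 - a * b * d.
Definition mob_d : A := a ^+ 3 * d - 6 * a ^+ 2 * b * c ^+ 2 + 3 * a * b ^+ 2 * c * d
  - b ^+ 3 * d ^+ 2 + 2 * b ^+ 3 * c ^+ 3.
Definition mob_k : A := a ^+ 3 - 3 * a * b ^+ 2 * c + b ^+ 3 * d.

(** The cubic and the quadratic terms in [w] cancel on the right, so that [u * W'] is affine in [w].
    This is why the flow preserves affine functions of the curvature. *)
Lemma mobius_num : u * W' = u * (u * w + 2 * lap Z Zb p pb u) - 6 * Z u * Zb u ->
  u * W' = mob_b * w + mob_g.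
Proof.
have ZE := derE dZ; have ZbE := derE dZb.
have lu : lap Z Zb p pb u = b * (c - w ^+ 2).
  by rewrite -lw /lap uE !(ZE, ZbE, Za, Zba, Zb0, Zbb); ring.
have gu : 6 * Z u * Zb u = b ^+ 2 * (d + 3 * c * w - w ^+ 3).
  by rewrite -gw uE !(ZE, ZbE, Za, Zba, Zb0, Zbb); ring.
by move=> ->; rewrite lu gu uE /mob_b /mob_g; ring.
Qed.

Hypothesis uW : u * W' = mob_b * w + mob_g.
Hypothesis k1 : mob_k = 1.
Let N : A := mob_b * w + mob_g.

Let W'E : W' = v * N.
Proof. by rewrite /N -uW mulrA vu mul1r. Qed.

(** The derivative of a Moebius map of determinant 1 is the inverse square of its denominator, here
    [v ^+ 2]. *)
Let dW D : derivation D -> D a = 0 -> D b = 0 -> D c = 0 -> D d = 0 ->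
  D W' = v ^+ 2 * D w /\ D v = - (v ^+ 2 * b * D w).
Proof.
move=> dD Da Db Dc Dd; have DE := derE dD.
have Du : D u = b * D w by rewrite uE !DE Da Db; ring.
split.
  have := congr1 D uW; rewrite derM // Du /mob_b /mob_g !DE Da Db Dc Dd => h.
  have h2 : u * D W' = (mob_b - b * W') * D w by apply: (lc1 h); rewrite /mob_b; ring.
  have h3 : D W' = v * (mob_b - b * W') * D w by rewrite -mulrA -h2 mulrA vu mul1r.
  have e : v * (mob_b - b * (v * N)) = v ^+ 2.
    apply: (lc2 (c := - (v * mob_b)) (congr1 (fun x => v ^+ 2 * x) k1) vu).
    by rewrite /N /mob_k /mob_g /mob_b uE; ring.
  by rewrite h3 {1}W'E e.
have := congr1 D vu; rewrite derM // Du der1 // => h.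
have : v * (D v * u + v * (b * D w)) = 0 by rewrite h mulr0.
move=> h2; apply: (lc2 (c := - D v) h2 vu); ring.
Qed.

Lemma mobius_lap : u * lap Z Zb p pb W' - (Z u * Zb W' + Zb u * Z W') = mob_c - W' ^+ 2.
Proof.
have ZE := derE dZ; have ZbE := derE dZb.
have [Z1' Zv] := dW dZ Za Zb0 Zc Zd; have [Zb1 Zbv] := dW dZb Zba Zbb Zbc Zbd.
have Zu : Z u = b * Z w by rewrite uE !ZE Za Zb0; ring.
have Zbu : Zb u = b * Zb w by rewrite uE !ZbE Zba Zbb; ring.
have lW : lap Z Zb p pb W' = v ^+ 2 * (c - w ^+ 2) - 4 * v ^+ 3 * b * (Z w * Zb w).
  by rewrite -lw /lap Z1' Zb1 !(ZE, ZbE) Zv Zbv; ring.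
rewrite lW Zu Zbu Z1' Zb1 W'E.
have gw' := gw; set Q := d + 3 * c * w - w ^+ 3 in gw'; set S := (c - w ^+ 2) * u - b * Q.
have e1 : u * (v ^+ 2 * (c - w ^+ 2) - 4 * v ^+ 3 * b * (Z w * Zb w))
   - (b * Z w * (v ^+ 2 * Zb w) + b * Zb w * (v ^+ 2 * Z w)) = v * (c - w ^+ 2) - b * v ^+ 2 * Q.
  rewrite -gw'; apply: (lc1 (congr1 (fun x => (v * (c - w ^+ 2) - 4 * v ^+ 2 * b * (Z w * Zb w)) * x) vu)).
  ring.
(* The claim holds modulo [v * u = 1] and [mob_k = 1]; the multipliers of these two relations turn
   it into a polynomial identity. *)
rewrite e1; apply: (lc2 (c := - v * (c - w ^+ 2) + mob_c * (1 + v * u)) (congr1 (fun x => - v ^+ 2 * S * x) k1) vu).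
rewrite /S /Q /N /mob_c /mob_k /mob_b /mob_g uE; ring.
Qed.

(** As [D W' = v ^+ 2 * D w], the left-hand side is [v ^+ 3] times the cubic in [w]. The right-hand
    side is the transform of this binary cubic under the Moebius map, and that is where [mob_c] and
    [mob_d] come from. *)
Lemma mobius_grad : 6 * (u * (Z W' * Zb W')) = mob_d + 3 * mob_c * W' - W' ^+ 3.
Proof.
have [Z1' _] := dW dZ Za Zb0 Zc Zd; have [Zb1 _] := dW dZb Zba Zbb Zbc Zbd.
have gw' := gw; set Q := d + 3 * c * w - w ^+ 3 in gw'.
have -> : 6 * (u * (Z W' * Zb W')) = u * v ^+ 4 * Q by rewrite -gw' Z1' Zb1; ring.
rewrite W'E; apply: (lc2 (c := v ^+ 3 * Q + mob_d * (1 + v * u + (v * u) ^+ 2) + 3 * mob_c * (v * N) * (1 + v * u))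
  (congr1 (fun x => - v ^+ 3 * Q * (1 + mob_k) * x) k1) vu).
rewrite /Q /N /mob_d /mob_c /mob_k /mob_b /mob_g uE; ring.
Qed.
End Mobius.

(** * The factor between two contact forms *)

Section ConformalChange.
Context {R : realType} {M : manifold3 R}.
Local Notation C := R[i].
Variables (xi : M -> tvec M -> Prop) (J : M -> tvec M -> tvec M).
Hypothesis hJ : cr_structure xi J.
Variables th th' : form1 M.
Hypothesis pos : positive_pseudohermitian xi J th.
Hypothesis tz : vanishing_torsion xi J th.
Hypothesis pos' : positive_pseudohermitian xi J th'.
Variables W W' : M -> R.
Hypothesis wW : webster_curvature xi J th W.
Hypothesis wW' : webster_curvature xi J th' W'.
Let cf : contact_form setT xi th := pos.1.
Let cf' : contact_form setT xi th' := pos'.1.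
Local Notation Lap := (Lap hJ pos).
Local Notation Grad2 := (Grad2 hJ pos).

Definition factor q : R := complex.Re (th' q (charT (sval (frame_at hJ pos q)) q)).

Lemma factor_scale q v : tangent q v -> th' q v = (factor q)%:C%C * th q v.
Proof.
move=> tv; have [uF Fq] := svalP (frame_at hJ pos q).
set F := sval _ in uF Fq.
have ad := un_ad uF (@subset_refl _ (fdom F)).
have tT := ad_tT ad Fq.
rewrite (contact_scale cf cf' tv tT (ad_thT ad Fq)); congr (_ * _).
have := th_conj cf' tT; rewrite (ad_Treal ad Fq) /factor -/F.
case: (th' q _) => a b /(congr1 (@complex.Im R)) /= e.
by apply: eqC => //=; lra.
Qed.

Section Local.
Variables (F F' : frame M).
Hypotheses (uF : unitary_frame xi J th F) (uF' : unitary_frame xi J th' F').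
Variables (V : set M) (oV : open V) (VF : V `<=` fdom F) (VF' : V `<=` fdom F').
Variables (c : chart R M) (ac : atlas M c) (Vc : V `<=` chart_dom c).
Let ad := un_ad uF VF.
Let ad' := un_ad uF' VF'.

Lemma factor_v z : V z -> cmp_v cf' uF oV VF z = (factor z)%:C%C.
Proof.
move=> Vz; rewrite mkSE // (factor_scale (ad_tT ad Vz)) (ad_thT ad Vz).
by rewrite mulr1.
Qed.

Let tV z : V z -> tors F z = 0. Proof. by move=> Vz; exact: (tz uF (VF Vz)). Qed.

(** In a common domain of frames the inverse factor is [u = z * conj z] by [cmp_uz]. *)
Lemma factor_gt0_local z : V z -> 0 < factor z.
Proof.
move=> Vz; have := congr1 (fun k : sfun oV => k z) (cmp_vu cf cf' uF uF' oV VF VF').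
rewrite sfM sf1 // factor_v //.
rewrite (cmp_uz hJ cf cf' uF uF' oV VF VF' ac Vc wW tV) sfM sf_cj.
case: (cmp_z _ _ _ _ _ z) => x y /(congr1 (@complex.Re R)) /= h.
have h1 : factor z * (x ^+ 2 + y ^+ 2) = 1 by apply: (lc1 h); ring.
rewrite ltNge; apply/negP => l0.
have : factor z * (x ^+ 2 + y ^+ 2) <= 0.
  by apply: mulr_le0_ge0 => //; rewrite addr_ge0 // sqr_ge0.
by rewrite h1 ler10.
Qed.

Lemma factor_u z : V z -> cmp_u cf uF' oV VF' z = ((factor z)^-1)%:C%C.
Proof.
move=> Vz; have := congr1 (fun k : sfun oV => k z) (cmp_vu cf cf' uF uF' oV VF VF').
rewrite sfM sf1 // factor_v // => h; have l0 := factor_gt0_local Vz.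
have n0 : (factor z)%:C%C != 0 :> C by rewrite (inj_eq (@rcI R)) gt_eqF.
by apply: (mulfI n0); rewrite h -rcM mulfV // gt_eqF.
Qed.

End Local.

Lemma factor_domain F' q : unitary_frame xi J th' F' -> fdom F' q ->
  forall B, nbhs q B -> exists F (V : set M) (oV : open V) (c : chart R M),
   [/\ unitary_frame xi J th F, V `<=` fdom F & [/\ V `<=` fdom F', atlas M c,
     V `<=` chart_dom c, V `<=` B & V q]].
Proof.
move=> uF' F'q B nB; have [uF Fq] := svalP (frame_at hJ pos q).
have nB' : nbhs q (fdom F' `&` B) by apply: filterI => //; exact: (open_near (un_open uF')).
have [V [oV [c [Vq VF VB ac Vc]]]] := local_domain Fq (un_open uF) nB'.
exists (sval (frame_at hJ pos q)), V, oV, c; split=> //.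
by split=> // z /VB[].
Qed.

Lemma factor_gt0 q : 0 < factor q.
Proof.
have [uF' F'q] := svalP (frame_at hJ pos' q).
have [F [V [oV [c [uF VF [VF' ac Vc _ Vq]]]]]] := factor_domain uF' F'q (@filterT _ (nbhs q) _).
exact: (factor_gt0_local uF uF' oV VF VF' ac Vc Vq).
Qed.

Lemma factor_smooth q : smooth_at q (fun z => (factor z)^-1).
Proof.
have [uF' F'q] := svalP (frame_at hJ pos' q).
have [F [V [oV [c [uF VF [VF' ac Vc _ Vq]]]]]] := factor_domain uF' F'q (@filterT _ (nbhs q) _).
have [+ _] := sf_smooth (cmp_u cf uF' oV VF') Vq; apply: smooth_at_eq.
apply: filterS (open_near oV Vq) => z Vz.
by rewrite (factor_u uF uF' oV VF VF' ac Vc Vz).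
Qed.

Lemma factor_W q : (factor q)^-1 * W' q =
  (factor q)^-1 * ((factor q)^-1 * W q + 2 * Lap (fun z => (factor z)^-1) q)
  - 6 * Grad2 (fun z => (factor z)^-1) q.
Proof.
have [uF' F'q] := svalP (frame_at hJ pos' q).
have [F [V [oV [c [uF VF [VF' ac Vc _ Vq]]]]]] := factor_domain uF' F'q (@filterT _ (nbhs q) _).
have tV z : V z -> tors F z = 0 by move=> Vz; exact: (tz uF (VF z Vz)).
have uE z (Vz : V z) := factor_u uF uF' oV VF VF' ac Vc Vz.
have [LE GE] := Lap_local hJ pos tz wW uF VF uE Vq.
have ev (u w w' L a b : sfun oV) : u * w' = u * (u * w + 2 * L) - 6 * a * b ->
    u q * w' q = u q * (u q * w q + 2 * L q) - 6 * (a * b) q.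
  move/(congr1 (fun k : sfun oV => k q)).
  by rewrite !(sf_nat oV _ Vq, sfM, sfD, sfN) mulrA.
have := ev _ _ _ _ _ _ (cmp_W hJ cf cf' uF uF' oV VF VF' ac Vc wW tV).
rewrite -GE -LE -(un_W cf' uF' oV VF' wW' Vq) -(un_W cf uF oV VF wW Vq) uE //.
by move=> h; apply: rcI; rewrite !rcE.
Qed.

Section Affine.
Variables (F' : frame M) (uF' : unitary_frame xi J th' F') (q : M) (F'q : fdom F' q).
Variables a b c d : R.
Hypothesis inv : \forall z \near q, inv2 hJ pos W z = c /\ inv6 hJ pos W z = d.
Hypothesis aff : \forall z \near q, (factor z)^-1 = a + b * W z.
Hypothesis k1 : mob_k a b c d = 1.
Local Notation cc := (mob_c a b c d).
Local Notation Wc := (fun z => (W' z)%:C%C).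

Lemma affine_curvature : [/\ (a + b * W q) * W' q = mob_b a b c * W q + mob_g a b c d,
  sublaplacian F' Wc q = (cc - W' q ^+ 2)%:C%C
  & 6 * (d1 F' Wc q * d1b F' Wc q) = (mob_d a b c d + 3 * cc * W' q - W' q ^+ 3)%:C%C].
Proof.
have nB : nbhs q [set z | (inv2 hJ pos W z = c /\ inv6 hJ pos W z = d) /\
   (factor z)^-1 = a + b * W z] by apply: filterI.
have [F [V [oV [ch [uF VF [VF' ac Vc VB Vq]]]]]] := factor_domain uF' F'q nB.
have tV z : V z -> tors F z = 0 by move=> Vz; exact: (tz uF (VF z Vz)).
have uE z (Vz : V z) := factor_u uF uF' oV VF VF' ac Vc Vz.
have wE z : V z -> Wsf uF oV VF z = (W z)%:C%C.
  by move=> Vz; rewrite (un_W cf uF oV VF wW Vz).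
have w'E z : V z -> Wsf uF' oV VF' z = (W' z)%:C%C.
  by move=> Vz; rewrite (un_W cf' uF' oV VF' wW' Vz).
have vu := cmp_vu cf cf' uF uF' oV VF VF'.
have uz := cmp_uz hJ cf cf' uF uF' oV VF VF' ac Vc wW tV.
have cW := cmp_W hJ cf cf' uF uF' oV VF VF' ac Vc wW tV.
have cL f := cmp_lap hJ cf cf' uF uF' VF VF' ac Vc wW tV f.
have cZ f := cmp_Z hJ cf uF uF' (oV := oV) VF VF' f.
have cZb f := cmp_Zb hJ cf uF uF' (oV := oV) VF VF' f.
have LE := Lap_local hJ pos tz wW uF VF wE.
have [S1 S2 S3] := un_sublap cf' uF' VF' Vq (f := Wsf uF' oV VF') (g := Wc)
   (fun z Vz => esym (w'E z Vz)).
rewrite S1 S2 S3 cL cZ cZb.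
set w := Wsf uF oV VF in wE cW LE *.
set w' := Wsf uF' oV VF' in w'E cW S1 S2 S3 *.
set u := cmp_u _ _ _ _ in uE vu uz cW cL *.
set v := cmp_v _ _ _ _ in vu.
set zz := cmp_z _ _ _ _ _ in uz cZ cZb *.
set ad := un_ad uF VF in LE cW cL cZ cZb *.
set DZ := sder (ad_Z ad) in LE cW cL cZ cZb *.
set DZb := sder (ad_Zb ad) in LE cW cL cZ cZb *.
have dZ : derivation DZ := sder_deriv oV (ad_Z ad).
have dZb : derivation DZb := sder_deriv oV (ad_Zb ad).
pose k (x : R) := scst oV x%:C%C.
have Zk x : DZ (k x) = 0 by exact: sder_cst.
have Zbk x : DZb (k x) = 0 by exact: sder_cst.
have kE x z : V z -> k x z = x%:C%C by exact: sf_cst.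
have uA : u = k a + k b * w.
  apply: sfun_eq => z Vz; rewrite sfD sfM !kE // wE // uE // (VB z Vz).2.
  by rewrite rcD rcM.
have lw : lap DZ DZb (adp oV ad) (scj (adp oV ad)) w = k c - w ^+ 2.
  apply: sfun_eq => z Vz; have [L1 _] := LE z Vz; have [[<- _] _] := VB z Vz.
  by rewrite -L1 sfD sfN sfX // kE // wE // /inv2 -!rcE; congr (_ %:C%C); ring.
have gw : 6 * (DZ w * DZb w) = k d + 3 * k c * w - w ^+ 3.
  apply: sfun_eq => z Vz; have [_ L2] := LE z Vz; have [[<- <-] _] := VB z Vz.
  rewrite sfM (sf_nat oV _ Vz) -L2.
  rewrite !(kE _ _ Vz, wE _ Vz, sf_nat oV _ Vz, sfX _ _ Vz, sfD, sfN, sfM).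
  by rewrite /inv6 -!rcE; congr (_ %:C%C); ring.
have kD x y : k (x + y) = k x + k y by apply: sfun_eq => z Vz; rewrite sfD !kE // rcD.
have kN x : k (- x) = - k x.
  by apply: sfun_eq => z Vz; rewrite sfN !kE //; apply: eqC => /=; ring.
have kM x y : k (x * y) = k x * k y by apply: sfun_eq => z Vz; rewrite sfM !kE // rcM.
have kX x n : k (x ^+ n) = k x ^+ n by apply: sfun_eq => z Vz; rewrite sfX // !kE // rcX.
have kn n : k n%:R = n%:R by apply: sfun_eq => z Vz; rewrite sf_nat // !kE // rc_nat.
have uW := mobius_num dZ dZb (Zk a) (Zbk a) (Zk b) (Zbk b) uA lw gw cW.
have K1 : mob_k (k a) (k b) (k c) (k d) = 1.
  by rewrite -[RHS](kn 1%N) -k1 /mob_k !(kD, kN, kM, kX, kn).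
have ML := mobius_lap dZ dZb (Zk a) (Zbk a) (Zk b) (Zbk b) (Zk c) (Zbk c) (Zk d) (Zbk d)
  vu uA lw gw uW K1.
have MG := mobius_grad dZ dZb (Zk a) (Zbk a) (Zk b) (Zbk b) (Zk c) (Zbk c) (Zk d) (Zbk d)
  vu uA gw uW K1.
have cE : mob_c (k a) (k b) (k c) (k d) = k cc by rewrite /mob_c !(kD, kN, kM, kX, kn).
have dE : mob_d (k a) (k b) (k c) (k d) = k (mob_d a b c d).
  by rewrite /mob_d !(kD, kN, kM, kX, kn).
have bE : mob_b (k a) (k b) (k c) = k (mob_b a b c) by rewrite /mob_b !(kD, kN, kM, kX, kn).
have gE : mob_g (k a) (k b) (k c) (k d) = k (mob_g a b c d).
  by rewrite /mob_g !(kD, kN, kM, kX, kn).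
split.
- apply: rcI; have := congr1 (fun h : sfun oV => h q) uW.
  rewrite bE gE !(kE _ _ Vq, wE _ Vq, w'E _ Vq, uE _ Vq, sfD, sfM) (VB q Vq).2 => h.
  by rewrite rcM h -rcM -rcD.
- by rewrite ML cE !(kE _ _ Vq, w'E _ Vq, sfX _ _ Vq, sfD, sfN) !rcE.
- have -> : 6 * ((zz * DZ w') q * (scj zz * DZb w') q) = (6 * (u * (DZ w' * DZb w'))) q.
    by rewrite uz !(sf_nat oV _ Vq, sfM); ring.
  by rewrite MG cE dE !(kE _ _ Vq, w'E _ Vq, sf_nat oV _ Vq, sfX _ _ Vq, sfD, sfN, sfM) !rcE.
Qed.
End Affine.

End ConformalChange.

(** * The explicit solution *)

Section Antiderivative.
Context {R : realType}.
Local Notation mu := (@lebesgue_measure R).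

Lemma antiderivative (f : R -> R) (a s0 : R) : a < s0 ->
  (forall x, a < x -> {for x, continuous f}) ->
  exists tau : R -> R, tau s0 = 0 /\ forall x, s0 <= x -> is_derive x 1 tau (f x).
Proof.
(* The lower limit lies strictly between [a] and [s0], so that the derivative is two-sided at [s0]
   as well. *)
move=> a0 fc; pose b := (a + s0) / 2.
have ab : a < b by rewrite /b; lra.
have bs : b < s0 by rewrite /b; lra.
pose F x := (\int[mu]_(t in [set` `[b, x]]) (f t))%R.
exists (fun x => F x - F s0); split; first by rewrite subrr.
move=> x sx; have bx : b < x by exact: lt_le_trans sx.
have fi : mu.-integrable `[b, x + 1] (EFin \o f).
  apply: continuous_compact_integrable; first exact: segment_compact.
  apply: continuous_in_subspaceT => y; rewrite inE /= in_itv /= => /andP[by_ _].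
  by apply: fc; exact: lt_le_trans by_.
have x1 : x < x + 1 by rewrite ltrDl.
have [dF F'] := continuous_FTC1_closed x1 fi bx (fc x (lt_trans ab bx)).
have HF : is_derive x 1 F (f x).
  by apply: DeriveDef; [exact: dF|rewrite -derive1E; exact: F'].
have := is_deriveB HF (is_derive_cst (F s0) x 1); rewrite subr0; exact.
Qed.

(** Made for the maximum principle, where a maximum is compared with earlier times only. *)
Lemma is_derive_cvg_left (f : R -> R) (x l : R) : is_derive x 1 f l ->
  forall e, 0 < e -> \forall h \near (0 : R), 0 < h -> (l - e) * h <= f x - f (x - h).
Proof.
move=> [df dE] e e0.
have : (fun h => h^-1 *: (f (h *: 1 + x) - f x)) @ (0 : R)^' --> l by rewrite -dE; exact: df.
move=> /cvgr_distC_lt /(_ e e0); rewrite !near_withinE => H.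
have : \forall h \near (0 : R), h != 0 -> `|h^-1 * (f (x + h) - f x) - l| < e.
  by apply: filterS H => h; rewrite /= (_ : h%:A = h) ?[h + x]addrC //; exact: mulr1.
set P := (fun h => _ -> _) => H0.
have H1 : \forall h \near (0 : R), P (- h) by apply/nearN; rewrite oppr0.
apply: filterS H1 => h; rewrite /P => + h0.
rewrite oppr_eq0 gt_eqF // => /(_ isT); rewrite ltr_norml => /andP[+ _].
rewrite ltrBrDl => /ltW K; rewrite -(ler_pM2r h0) in K; apply: le_trans K _.
by rewrite invrN le_eqVlt; apply/orP; left; apply/eqP; field; rewrite gt_eqF.
Qed.

End Antiderivative.

Section Explicit.
Context {R : realType}.
Variables k l : R.
Hypotheses (l0 : 0 < l) (lk : l <= k) (k2l : k < 2 * l).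

(* [k] and [l] are 2 max + min and max + 2 min of the initial curvature.  The flow
   parameter is s, with dt/ds = [exrate]; u = [exa] + [exb] W_hat, and [exq],
   [exq + k exb], [exq + l exb] are the values of this affine function at the
   three roots of the cubic, whose product is 1. *)
Definition exq (s : R) := k * l / s.
Definition exS (s : R) := Num.sqrt (((k - l) * exq s) ^+ 2 + 4 * s).
Definition exb (s : R) := (exS s - (k + l) * exq s) / (2 * k * l).
Definition exa (s : R) := exq s + exb s * (k + l) / 3.
Definition exc : R := (k ^+ 2 - k * l + l ^+ 2) / 9.
Definition exd : R := - ((2 * k - l) * (2 * l - k) * (k + l)) / 27.
Definition exrate (s : R) := 3 / (2 * s * exS s).
Local Notation A s := (exq s + k * exb s).
Local Notation B s := (exq s + l * exb s).

Let k0 : 0 < k. Proof. exact: lt_le_trans lk. Qed.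
Let kl0 : 0 < k * l. Proof. exact: mulr_gt0. Qed.

Lemma exS_gt0 s : 0 < s -> 0 < exS s.
Proof.
by move=> s0; rewrite sqrtr_gt0; apply: ltr_wpDl; [exact: sqr_ge0|lra].
Qed.

Lemma exS_sqr s : 0 < s -> exS s ^+ 2 = ((k - l) * exq s) ^+ 2 + 4 * s.
Proof.
by move=> s0; rewrite sqr_sqrtr //; apply: addr_ge0; [exact: sqr_ge0|lra].
Qed.

(** The origin of [exb]: the numbers X = l A and Y = k B have difference [(k - l) * exq s], and
    [exq s * A * B = 1] means X Y = s. Hence the sum X + Y is the square root [exS], and [b] is
    solved from it. *)
Lemma exS_E s : exS s = l * A s + k * B s.
Proof. by rewrite /exb; field; rewrite !gt_eqF. Qed.

Lemma exD_E s : (k - l) * exq s = k * B s - l * A s.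
Proof. by rewrite /exb; field; rewrite !gt_eqF. Qed.

Lemma exS_gtD s : 0 < s -> (k - l) * exq s < exS s.
Proof.
move=> s0; rewrite -[ltLHS]ger0_norm; last first.
  by rewrite mulr_ge0 ?subr_ge0 // /exq divr_ge0 // ltW.
rewrite -sqrtr_sqr ltr_sqrt; first by lra.
by apply: ltr_wpDl; [exact: sqr_ge0|lra].
Qed.

Lemma ex_pos s : 0 < s -> [/\ 0 < exq s, 0 < A s & 0 < B s].
Proof.
move=> s0; have q0 : 0 < exq s by rewrite /exq divr_gt0.
have h := exS_gtD s0; rewrite exD_E exS_E in h.
have D0 : 0 <= (k - l) * exq s by rewrite mulr_ge0 ?subr_ge0 // ltW.
rewrite exD_E in D0.
have hA : 0 < l * A s by lra.
have hB : 0 < k * B s by lra.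
by rewrite !pmulr_rgt0 // in hA hB.
Qed.

Lemma ex_prod s : 0 < s -> exq s * A s * B s = 1 /\ l * A s * (k * B s) = s.
Proof.
move=> s0; have h := exS_sqr s0; rewrite exD_E exS_E in h.
have h1 : l * A s * (k * B s) = s by lra.
split=> //; have -> : exq s * A s * B s = (l * A s * (k * B s)) / s.
  by rewrite {1}/exq; field; rewrite gt_eqF.
by rewrite h1 divff // gt_eqF.
Qed.

Lemma ex_k1 s : 0 < s -> mob_k (exa s) (exb s) exc exd = 1.
Proof.
move=> s0; have [<- _] := ex_prod s0.
by rewrite /mob_k /exa /exc /exd; field.
Qed.

Lemma ex_start : exa (k * l) = 1 /\ exb (k * l) = 0.
Proof.
have q1 : exq (k * l) = 1 by rewrite /exq divff // gt_eqF.
have S1 : exS (k * l) = k + l.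
  rewrite /exS q1 mulr1 (_ : _ + _ = (k + l) ^+ 2); last by ring.
  by rewrite sqrtr_sqr ger0_norm // ltW // addr_gt0.
have b0 : exb (k * l) = 0 by rewrite /exb S1 q1 mulr1 subrr mul0r.
by split=> //; rewrite /exa b0 q1; ring.
Qed.

Lemma is_derive_exq (s : R) : 0 < s -> is_derive s 1 exq (- (exq s / s)).
Proof.
move=> s0; have n0 : s != 0 by rewrite gt_eqF.
have H := is_deriveZ (k * l) (is_deriveV (f := id) n0 (is_derive_id s 1)).
apply: (is_derive_eq H); rewrite /exq /GRing.scale /=; field; exact: n0.
Qed.

Lemma is_derive_exS (s : R) : 0 < s ->
  is_derive s 1 exS ((2 * s - ((k - l) * exq s) ^+ 2) / (s * exS s)).
Proof.
move=> s0; have S0 := exS_gt0 s0.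
have Hq := is_derive_exq s0.
pose g s := ((k - l) * exq s) ^+ 2 + 4 * s.
have Hg : is_derive s 1 g (2 * ((k - l) * exq s) * ((k - l) * (- (exq s / s))) + 4).
  have H := is_deriveD (is_deriveX 2 (is_deriveZ (k - l) Hq)) (is_deriveZ 4 (is_derive_id s 1)).
  by apply: (is_derive_eq H); rewrite /GRing.scale /= /GRing.scale /= ?expr1; ring.
have g0 : 0 < g s by rewrite /g -exS_sqr // exprn_gt0.
have Hs := is_derive1_sqrt g0.
have H := is_derive1_comp Hs Hg.
by apply: (is_derive_eq H); rewrite -/(exS s); field; rewrite !gt_eqF.
Qed.

(** Since u_t = 2 u W_t, [mobius_num] gives the system b_t = 2 mob_b, a_t = 2 mob_g; the factor
    [exrate] converts t-derivatives to s-derivatives. *)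
Lemma is_derive_exb (s : R) : 0 < s ->
  is_derive s 1 exb (exrate s * (2 * mob_b (exa s) (exb s) exc)).
Proof.
move=> s0; have S0 := exS_gt0 s0.
have H := is_deriveZ ((2 * k * l)^-1)
  (is_deriveB (is_derive_exS s0) (is_deriveZ (k + l) (is_derive_exq s0))).
have fE : exb = (2 * k * l)^-1 \*: (exS - (k + l) \*: exq).
  by apply/funext => x; rewrite /exb /GRing.scale /= mulrC.
rewrite -fE in H.
apply: (is_derive_eq H); rewrite /GRing.scale /=.
have id : 2 * s - ((k - l) * exq s) ^+ 2 + (k + l) * exq s * exS s =
    6 * k * l * mob_b (exa s) (exb s) exc.
  have [_ sE] := ex_prod s0; rewrite -[in 2 * s]sE exS_E /mob_b /exa /exc.
  by move: (exb s) (exq s) => b q; field.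
have -> : mob_b (exa s) (exb s) exc =
    (2 * s - ((k - l) * exq s) ^+ 2 + (k + l) * exq s * exS s) / (6 * k * l).
  by rewrite id; field; rewrite !gt_eqF.
by rewrite /exrate; field; rewrite !gt_eqF.
Qed.

Lemma is_derive_exa (s : R) : 0 < s ->
  is_derive s 1 exa (exrate s * (2 * mob_g (exa s) (exb s) exc exd)).
Proof.
move=> s0; have S0 := exS_gt0 s0.
have H := is_deriveD (is_derive_exq s0) (is_deriveZ ((k + l) / 3) (is_derive_exb s0)).
have fE : exa = exq + ((k + l) / 3) \*: exb.
  by apply/funext => x; rewrite /exa -mulrA [exb x * _]mulrC.
rewrite -fE in H.
apply: (is_derive_eq H); rewrite /GRing.scale /=.
(* In terms of time this says q_t = - (2/3) q S. As q = k l / s, it is equivalent to dt/ds = 3 / (2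
   s S), the origin of [exrate]. *)
have id : - exq s * exS s + (k + l) * mob_b (exa s) (exb s) exc =
    3 * mob_g (exa s) (exb s) exc exd.
  rewrite exS_E /mob_b /mob_g /exa /exc /exd.
  by move: (exb s) (exq s) => b q; field.
have -> : mob_g (exa s) (exb s) exc exd =
    (- exq s * exS s + (k + l) * mob_b (exa s) (exb s) exc) / 3 by rewrite id; field.
by rewrite /exrate; field; rewrite !gt_eqF.
Qed.

Local Notation mx := ((2 * k - l) / 3).
Local Notation mn := ((2 * l - k) / 3).

Lemma ex_affine s h : 0 < s -> mn <= h <= mx -> 0 < exa s + exb s * h.
Proof.
move=> s0 /andP[h1 h2]; have [q0 A0 B0] := ex_pos s0.
have [b0|b0] := leP 0 (exb s).
  have -> : exa s + exb s * h = B s + exb s * (h - mn) by rewrite /exa; field.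
  by apply: ltr_wpDr => //; rewrite mulr_ge0 // subr_ge0.
have -> : exa s + exb s * h = A s + exb s * (h - mx) by rewrite /exa; field.
by apply: ltr_wpDr => //; rewrite mulr_le0 ?subr_le0 // ltW.
Qed.

Lemma ex_ends s : exa s + exb s * mx = A s /\ exa s + exb s * mn = B s.
Proof. by rewrite /exa; split; field. Qed.

Lemma ex_harnack (s t h W : R) : k * l <= s -> 0 < t ->
  t * ((k - l) * exq s) <= 3 / 2 -> mn <= h <= mx ->
  (exa s + exb s * h) * W = mob_b (exa s) (exb s) exc * h + mob_g (exa s) (exb s) exc exd ->
  0 < W /\ 0 <= W / t - W ^+ 2 / 3 - 2 * mob_d (exa s) (exb s) exc exd / (3 * W).
Proof.
move=> sk t0 tD hh WE; have s0 : 0 < s by exact: lt_le_trans sk.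
have [q0 A0 B0] := ex_pos s0.
have u0 := ex_affine s0 hh; move/andP: hh => [h1 h2].
set X := l * A s; set Y := k * B s.
have SE : exS s = X + Y by exact: exS_E.
have DE : (k - l) * exq s = Y - X by exact: exD_E.
have [_ XY] := ex_prod s0; rewrite -/X -/Y in XY.
have X0 : 0 < X by exact: mulr_gt0.
have Y0 : 0 < Y by exact: mulr_gt0.
have D0 : 0 <= Y - X by rewrite -DE mulr_ge0 ?subr_ge0 // ltW.
(* Positivity of the minimum [M2] below. Otherwise X <= k - l and Y <= 2 (k - l), so that s = X Y <=
   2 (k - l)^2 < k l. *)
have XY2 : Y < 2 * X.
  have q1 : exq s <= 1 by rewrite /exq ler_pdivrMr // mul1r.
  have D1 : Y - X <= k - l by rewrite -DE ler_piMr // subr_ge0.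
  rewrite ltNge; apply/negP => YX.
  have Xe : X <= k - l by lra.
  have Ye : Y <= 2 * (k - l) by lra.
  have : s <= (k - l) * (2 * (k - l)) by rewrite -XY; apply: ler_pM => //; exact: ltW.
  have : 0 < (2 * l - k) * (2 * k - l).
    apply: mulr_gt0; first by rewrite subr_gt0.
    by rewrite subr_gt0; apply: le_lt_trans lk _; rewrite mulr_natl mulr2n ltrDl.
  have -> : (2 * l - k) * (2 * k - l) = k * l - (k - l) * (2 * (k - l)) by ring.
  lra.
(* [M1] and [M2] are the values of W_t where W_hat is maximal and minimal. Y = 2 M1 + M2 and X = M1
   + 2 M2 play for W_t the role of [k] and [l]; M1 - M2 is [(k - l) * exq s], whence the form of the
   hypothesis on [t]. *)
pose M1 := (2 * Y - X) / 3; pose M2 := (2 * X - Y) / 3.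
have dE : mob_d (exa s) (exb s) exc exd = - (M1 * M2 * (M1 + M2)).
  rewrite /M1 /M2 /X /Y /mob_d /exa /exc /exd.
  by move: (exb s) (exq s) => b q; field.
have e1 : mob_b (exa s) (exb s) exc * mx + mob_g (exa s) (exb s) exc exd = A s * M1.
  rewrite /M1 /X /Y /mob_b /mob_g /exa /exc /exd.
  by move: (exb s) (exq s) => b q; field.
have e2 : mob_b (exa s) (exb s) exc * mn + mob_g (exa s) (exb s) exc exd = B s * M2.
  rewrite /M2 /X /Y /mob_b /mob_g /exa /exc /exd.
  by move: (exb s) (exq s) => b q; field.
have M20 : 0 < M2 by rewrite /M2; lra.
have M12 : M2 <= M1 by rewrite /M1 /M2; lra.
have DM : M1 - M2 = Y - X by rewrite /M1 /M2; field.
have [aA aB] := ex_ends s.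
clearbody M1 M2 X Y; move: A0 B0 aA aB e1 e2.
move: (exq s + k * exb s) (exq s + l * exb s) => AA BB A0 B0.
move: (exa s) (exb s) (mob_b _ _ _) (mob_g _ _ _ _) (mob_d _ _ _ _) u0 WE dE.
move=> a b be ga d6 u0 WE -> aA aB e1 e2.
(* W is a weighted mean of [M1] and [M2]: both u and u W are affine in h, and u is positive at both
   ends. The case [k = l] is separate because the interval for h is a point. *)
have [m1 m2] : 0 <= (a + b * h) * (W - M2) /\ 0 <= (a + b * h) * (M1 - W).
  have [kl|] := eqVneq k l.
    have hm : h = mx by apply/eqP; rewrite eq_le h2 (le_trans _ h1) // kl; lra.
    have M12e : M1 = M2.
      by apply/eqP; rewrite -subr_eq0 DM -DE kl subrr mul0r.
    rewrite !mulrBr WE hm e1 aA M12e !subrr; split; lra.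
  move=> nkl; have lk' : l < k by rewrite lt_neqAle eq_sym nkl lk.
  have e0 : 0 < k - l by rewrite subr_gt0.
  pose r := (h - mn) / (k - l).
  have r0 : 0 <= r by apply: divr_ge0; [rewrite subr_ge0|exact: ltW].
  have r1 : 0 <= 1 - r.
    rewrite (_ : 1 - r = (mx - h) / (k - l)); last by rewrite /r; field; rewrite gt_eqF.
    by apply: divr_ge0; [rewrite subr_ge0|exact: ltW].
  have hE : h = r * mx + (1 - r) * mn by rewrite /r; field; rewrite gt_eqF.
  have uE : a + b * h = r * AA + (1 - r) * BB by rewrite -aA -aB {1}hE; ring.
  have wE : (a + b * h) * W = r * (AA * M1) + (1 - r) * (BB * M2).
    by rewrite WE -e1 -e2 {1}hE; ring.
  have P x y z : 0 <= x -> 0 < y -> 0 <= z -> 0 <= x * y * z :> R.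
    by move=> ? ? ?; rewrite !mulr_ge0 // ltW.
  have n12 : 0 <= M1 - M2 by rewrite subr_ge0.
  rewrite !mulrBr wE uE; split.
    rewrite (_ : _ - _ = r * AA * (M1 - M2)); [exact: P|ring].
  rewrite (_ : _ - _ = (1 - r) * BB * (M1 - M2)); [exact: P|ring].
rewrite !pmulr_rge0 // !subr_ge0 in m1 m2.
have W0 : 0 < W by exact: lt_le_trans m1.
split=> //.
have it : (M1 - M2) * 2 / 3 <= 1 / t.
  by rewrite ler_pdivlMr // DM -DE; move: tD; set z := (k - l) * exq s; lra.
have D0' : 0 <= M1 - M2 by rewrite subr_ge0.
(* W^3 <= M1 W^2 = (M1 - M2) W^2 + M2 W^2, and M2 W^2 <= M2 M1^2 is absorbed by the last term. *)
have main : W ^+ 3 <= (M1 - M2) * W ^+ 2 + 2 * (M1 * M2 * (M1 + M2)).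
  have h3 : W ^+ 2 * W <= W ^+ 2 * M1 by rewrite ler_pM2l // exprn_gt0.
  have h4 : W ^+ 2 <= M1 ^+ 2 by rewrite lerXn2r // nnegrE ltW // (lt_le_trans W0).
  have h5 : M2 * W ^+ 2 <= M2 * M1 ^+ 2 by rewrite ler_pM2l.
  have h6 : 0 <= M1 * M2 * M2 by rewrite !mulr_ge0 // ltW // (lt_le_trans W0).
  have -> : W ^+ 3 = W ^+ 2 * W by ring.
  have h7 : 0 <= M2 * M1 ^+ 2 by rewrite mulr_ge0 ?sqr_ge0 // ltW.
  have -> : M1 * M2 * (M1 + M2) = M2 * M1 ^+ 2 + M1 * M2 * M2 by ring.
  lra.
have hit : (M1 - M2) / 3 * W <= W / t.
  rewrite [W / t]mulrC ler_pM2r //; apply: le_trans (_ : 1 / t <= _); last by rewrite div1r.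
  by apply: le_trans it; lra.
have -> : 2 * - (M1 * M2 * (M1 + M2)) / (3 * W) = - (2 * (M1 * M2 * (M1 + M2)) / (3 * W)).
  by rewrite mulrN mulNr.
have : W ^+ 2 / 3 <= (M1 - M2) / 3 * W + 2 * (M1 * M2 * (M1 + M2)) / (3 * W).
  rewrite -(ler_pM2r (_ : 0 < 3 * W)); last by rewrite mulr_gt0.
  rewrite (_ : W ^+ 2 / 3 * (3 * W) = W ^+ 3); last by field.
  rewrite (_ : _ * (3 * W) = (M1 - M2) * W ^+ 2 + 2 * (M1 * M2 * (M1 + M2))) //.
  by field; rewrite gt_eqF.
lra.
Qed.
End Explicit.
(** * Maximum principle and uniqueness *)

(** The flow exists for nonnegative times only, so continuity at time 0 is one-sided. *)
Definition cont_on (R : realType) (T : topologicalType) (D : set T) (f : T -> R) :=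
  forall z, D z -> f z' @[z' --> within D (nbhs z)] --> f z.

Lemma cont_on_max (R : realType) (T : topologicalType) (D : set T) (f : T -> R) :
  D !=set0 -> compact D -> cont_on D f -> exists2 z, D z & forall z', D z' -> f z' <= f z.
Proof.
move=> D0 cD /subspace_continuousP fc.
have [z zD zm] := compact_EVT_max D0 cD fc; exists z; first by rewrite inE in zD.
by move=> z' Dz'; apply: zm; rewrite inE.
Qed.

Lemma cont_on_continuous (R : realType) (T : topologicalType) (D : set T) (f : T -> R) :
  (forall z, D z -> {for z, continuous f}) -> cont_on D f.
Proof. by move=> fc z Dz; apply: cvg_within_filter; exact: fc. Qed.

(** The differential inequality is required at positive spatial maxima only, where the second-order
    term has a sign. For L above all values of [C], the function f exp(- L s) has negative time
    derivative at a positive maximum over time and space, so it is larger slightly earlier. *)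
Lemma max_principle (R : realType) (T : topologicalType) (K : set T)
    (f C : R -> T -> R) (a s1 : R) : compact K ->
  cont_on (`[a, s1]%classic `*` K) (fun z : R * T => f z.1 z.2) ->
  cont_on (`[a, s1]%classic `*` K) (fun z : R * T => C z.1 z.2) ->
  (forall q, K q -> f a q <= 0) ->
  (forall s q, a < s <= s1 -> K q -> 0 < f s q -> (forall q', K q' -> f s q' <= f s q) ->
     exists2 l, is_derive s 1 (fun s => f s q) l & l <= C s q * f s q) ->
  forall s q, a <= s <= s1 -> K q -> f s q <= 0.
Proof.
move=> cK fc Cc fa0 fmax s q sab Kq; rewrite leNgt; apply/negP => fsq.
have as1 : a <= s1 by case/andP: sab => h1 h2; exact: le_trans h2.
have cD : compact (`[a, s1]%classic `*` K) by apply: compact_setX => //; exact: segment_compact.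
have D0 : (`[a, s1]%classic `*` K) !=set0 by exists (s, q); split=> //=; rewrite in_itv.
have [z0 _ HL] := cont_on_max D0 cD Cc.
pose L := C z0.1 z0.2 + 1.
have LC s' q' : a <= s' <= s1 -> K q' -> C s' q' + 1 <= L.
  move=> h Kq'; rewrite lerD2r; apply: (HL (s', q')).
  by split=> //=; rewrite in_itv.
pose e (s : R) : R := expR (- L * s).
have ec : cont_on (`[a, s1]%classic `*` K) (fun z : R * T => f z.1 z.2 * e z.1).
  move=> z Dz; apply: cvgM; first exact: fc.
  apply: cvg_within_filter; apply: (@continuous_comp _ _ _ fst e); first exact: cvg_fst.
  apply: (@continuous_comp _ _ _ (fun x : R => - L * x) expR); last exact: continuous_expR.
  by apply: cvgM; [exact: cvg_cst|exact: cvg_id].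
have [[s2 q2] + Hmax] := cont_on_max D0 cD ec.
move=> -[/=]; rewrite in_itv /= => s2I Kq2.
have e0 x : 0 < e x by exact: expR_gt0.
have fm s' q' : a <= s' <= s1 -> K q' -> f s' q' * e s' <= f s2 q2 * e s2.
  by move=> h Kq'; apply: (Hmax (s', q')); split=> //=; rewrite in_itv.
have f20 : 0 < f s2 q2.
  have := fm s q sab Kq; rewrite -(pmulr_lgt0 _ (e0 s2)); apply: lt_le_trans.
  exact: mulr_gt0.
have as2 : a < s2.
  case/andP: s2I => + _; rewrite le_eqVlt => /orP[/eqP aE|//].
  by move: f20; rewrite -aE ltNge fa0.
have s21 : a < s2 <= s1 by case/andP: s2I => _ ->; rewrite as2.
have fsp q' : K q' -> f s2 q' <= f s2 q2.
  by move=> Kq'; have := fm s2 q' s2I Kq'; rewrite ler_pM2r.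
have [l dl lL] := fmax _ _ s21 Kq2 f20 fsp.
have de : is_derive s2 1 e (- L * e s2).
  have H := is_derive1_comp (is_derive_expR (- L * s2)) (is_deriveZ (- L) (is_derive_id s2 1)).
  by apply: (is_derive_eq H); rewrite /e /GRing.scale /=; ring.
pose g' := l * e s2 - f s2 q2 * (L * e s2).
have dg : is_derive s2 1 (fun s => - (f s q2 * e s)) (- g').
  have H := is_deriveN (is_deriveM dl de).
  by apply: (is_derive_eq H); rewrite /g' /GRing.scale /=; ring.
have g'0 : g' < 0.
  have -> : g' = (l - L * f s2 q2) * e s2 by rewrite /g'; ring.
  rewrite pmulr_llt0 // subr_lt0; apply: le_lt_trans lL _; rewrite ltr_pM2r //.
  by apply: lt_le_trans (LC s2 q2 s2I Kq2); rewrite ltrDl.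
have := is_derive_cvg_left dg (e := - g' / 2); rewrite divr_gt0 ?oppr_gt0 // => /(_ isT) H.
have [d /= d0 Hd] := (nbhs_ballP _ _).1 H.
pose h := Num.min (d / 2) (s2 - a).
have h0 : 0 < h by rewrite lt_min subr_gt0 as2 divr_gt0.
have hd : h < d by rewrite gt_min; apply/orP; left; lra.
have ha : h <= s2 - a by rewrite ge_min lexx orbT.
have s2h : a <= s2 - h <= s1.
  by apply/andP; split; [lra|case/andP: s2I => _; apply: le_trans; lra].
have := Hd h; rewrite /ball /= sub0r normrN gtr0_norm // => /(_ hd h0).
have := fm (s2 - h) q2 s2h Kq2; set x1 := f _ _ * _; set x2 := f s2 q2 * _ => k1 k2.
have : 0 < - g' / 2 * h by rewrite mulr_gt0 // divr_gt0 // oppr_gt0.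
by lra.
Qed.

Section LocalMin.
Context {R : realType} {M : manifold3 R}.
Variables (xi : M -> tvec M -> Prop) (J : M -> tvec M -> tvec M).
Hypothesis hJ : cr_structure xi J.
Variable th : form1 M.
Hypothesis pos : positive_pseudohermitian xi J th.
Hypothesis tz : vanishing_torsion xi J th.
Variable W : M -> R.
Hypothesis wW : webster_curvature xi J th W.
Local Notation Lap := (Lap hJ pos).
Local Notation Grad2 := (Grad2 hJ pos).

Lemma Lap_opp f q : smooth_at q f ->
  Lap (fun z => - f z) q = - Lap f q /\ Grad2 (fun z => - f z) q = Grad2 f q.
Proof.
move=> fS; have [uF Fq] := svalP (frame_at hJ pos q); set F := sval _ in uF Fq.
have [V [oV [_ [Vq VF VB _ _]]]] := local_domain Fq (un_open uF) (smooth_at_near fS).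
pose f' := mkS oV (fun z (Vz : V z) => csmooth_real (VB z Vz)).
have fE z : V z -> f' z = (f z)%:C%C by move=> Vz; rewrite mkSE.
have hE z : V z -> (- f') z = (- f z)%:C%C.
  by move=> Vz; rewrite sfN fE //; apply: eqC => /=; ring.
have [L1 G1] := Lap_local hJ pos tz wW uF VF fE Vq.
have [L3 G3] := Lap_local hJ pos tz wW uF VF hE Vq.
clearbody f'; set ad := un_ad uF VF in L1 G1 L3 G3.
have Dn X (HX : vfield V X) k : sder (oU := oV) HX (- k) = - sder HX k.
  by rewrite (derN (sder_deriv oV HX)).
split; apply: rcI.
  have -> : (- Lap f q)%:C%C = - (Lap f q)%:C%C by apply: eqC => /=; ring.
  by rewrite L3 L1 -sfN; congr (sf _ q); rewrite /lap !Dn; ring.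
by rewrite G3 G1 !Dn mulrNN.
Qed.

Lemma local_min_lap (f : M -> R) q : smooth_at q f ->
  (\forall z \near q, f q <= f z) -> Grad2 f q = 0 /\ 0 <= Lap f q.
Proof.
move=> fS fq; have [e1 e2] := Lap_opp fS.
have fq' : \forall z \near q, - f z <= - f q by apply: filterS fq => z; rewrite lerN2.
have [] := local_max_lap hJ pos tz wW (smooth_atN fS) fq'.
by rewrite e1 e2 oppr_le0.
Qed.

End LocalMin.

(** * The Yamabe flow on a level set of the invariants *)

Section Flow.
Context {R : realType} {M : manifold3 R}.
Local Notation C := R[i].
Variables (xi : M -> tvec M -> Prop) (J : M -> tvec M -> tvec M).
Hypothesis hJ : cr_structure xi J.
Variables (that : form1 M) (What : M -> R).
Hypothesis hthat : positive_pseudohermitian xi J that.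
Hypothesis htors : vanishing_torsion xi J that.
Hypothesis hWhat : webster_curvature xi J that What.
Variables (tmax : \bar R) (th : R -> form1 M) (W : R -> M -> R).
Hypothesis hflow : yamabe_flow xi J tmax th W.
Hypothesis hinit : forall p v, tangent p v -> th 0 p v = that p v.
Local Notation lam s q := (factor hJ (th s) hthat q).
Local Notation u s q := (factor hJ (th s) hthat q)^-1.

Lemma flow_pos s : 0 <= s -> (s%:E < tmax)%E -> positive_pseudohermitian xi J (th s).
Proof. by move=> s0 st; have [/(_ s s0 st)[]] := hflow. Qed.

Lemma flow_W s : 0 <= s -> (s%:E < tmax)%E -> webster_curvature xi J (th s) (W s).
Proof. by move=> s0 st; have [/(_ s s0 st)[]] := hflow. Qed.

Lemma flow_factor s q v : 0 <= s -> (s%:E < tmax)%E -> tangent q v -> that q v = 1 ->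
  complex.Re (th s q v) = lam s q.
Proof.
by move=> s0 st tv v1; rewrite (factor_scale hJ hthat (flow_pos s0 st) tv) v1 mulr1.
Qed.

Lemma flow_factor_gt0 s q : 0 <= s -> (s%:E < tmax)%E -> 0 < lam s q.
Proof. by move=> s0 st; exact: (factor_gt0 hJ hthat htors (flow_pos s0 st) hWhat). Qed.

Lemma flow_factor0 q : (0%:E < tmax)%E -> lam 0 q = 1.
Proof.
move=> t0; have [uF Fq] := svalP (frame_at hJ hthat q).
have ad := un_ad uF (@subset_refl _ _).
by rewrite /factor hinit ?(ad_thT ad Fq) //; exact: (ad_tT ad Fq).
Qed.

(** Locally the factor is the value of [th s] on the characteristic field of [that], a real smooth
    field, to which the joint smoothness of the flow applies. *)
Lemma flow_factor_cont t : (t%:E < tmax)%E ->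
  cont_on (`[0, t]%classic `*` [set: M]) (fun z : R * M => lam z.1 z.2).
Proof.
move=> tt [s0 q0] [/= + _]; rewrite in_itv /= => /andP[s00 s0t].
have lt s : s <= t -> (s%:E < tmax)%E by move=> st; apply: le_lt_trans tt; rewrite lee_fin.
have [uF Fq] := svalP (frame_at hJ hthat q0); set F := sval _ in uF Fq.
have oF := un_open uF; have ad := un_ad uF (@subset_refl _ (fdom F)).
have [_ /(_ _ _ oF (ad_T ad) (fun z => @ad_Treal _ _ _ _ _ _ _ _ _ ad z)) sit _] := hflow.
have [c [ac cq [V [G [Vn Gs GE]]]]] := sit s0 q0 s00 (lt _ s0t) Fq.
pose phi (z : R * M) : 'rV[R]_(1 + 3) := row_mx (const_mx z.1) (chart_map c z.2).
have phic : phi z @[z --> (s0, q0)] --> phi (s0, q0).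
  apply: cvg_rV => i; rewrite /phi; case: (split_ordP i) => j ->.
    rewrite row_mxEl mxE; under eq_fun do rewrite row_mxEl mxE.
    exact: cvg_fst.
  rewrite row_mxEr; under eq_fun do rewrite row_mxEr.
  apply: (@continuous_comp _ _ _ snd (fun q => chart_map c q 0 j)); first exact: cvg_snd.
  exact: smooth_at_continuous (smooth_at_coord j ac cq).
have Gc : G (phi z) @[z --> (s0, q0)] --> G (phi (s0, q0)).
  apply: (@cvg_comp _ _ _ phi G); first exact: phic.
  have [Vo VV] := Vn; exact: (class_C_continuous (Gs 0%N)).
have nq : \forall z \near (s0, q0), [/\ V (phi z), chart_dom c z.2 & fdom F z.2].
  have n1 : \forall z \near (s0, q0), V (phi z).
    by apply: phic; have [Vo VV] := Vn; exact: open_nbhs_nbhs.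
  have n2 : \forall z \near (s0, q0), chart_dom c z.2.
    by apply: (@cvg_snd _ _ (nbhs s0) (nbhs q0)); exact: chart_dom_nbhs.
  have n3 : \forall z \near (s0, q0), fdom F z.2.
    by apply: (@cvg_snd _ _ (nbhs s0) (nbhs q0)); exact: (open_near oF).
  by near=> z; split; near: z.
have GL z : 0 <= z.1 -> z.1 <= t -> [/\ V (phi z), chart_dom c z.2 & fdom F z.2] ->
    G (phi z) = lam z.1 z.2.
  move=> z0 zt [Vz cz Fz]; rewrite (GE z.1 (chart_map c z.2) z0 Vz) (chart_mapK cz).
  by apply: flow_factor => //; [exact: lt|exact: (ad_tT ad Fz)|exact: (ad_thT ad Fz)].
rewrite -[lam _ _](GL (s0, q0)) //; last exact: nbhs_singleton nq.
have Gw : G (phi z) @[z --> within (`[0, t]%classic `*` [set: M]) (nbhs (s0, q0))]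
    --> G (phi (s0, q0)) by exact: cvg_within_filter Gc.
apply: cvg_trans Gw; apply: near_eq_cvg; rewrite near_withinE.
apply: filterS nq => z hz [+ _]; rewrite /= in_itv /= => /andP[z0 zt].
exact: GL.
Unshelve. all: by end_near.
Qed.

Lemma flow_u_derive s q : 0 < s -> (s%:E < tmax)%E ->
  is_derive s 1 (fun s => u s q) (2 * (u s q * W s q)).
Proof.
move=> s0 st; have l0 := flow_factor_gt0 q (ltW s0) st.
have [uF Fq] := svalP (frame_at hJ hthat q); set F := sval _ in uF Fq.
have ad := un_ad uF (@subset_refl _ (fdom F)).
have rT : real_tangent q (charT F q) by split; [exact: (ad_tT ad Fq)|exact: (ad_Treal ad Fq)].
have [_ _ /(_ s q _ (ltW s0) st rT)] := hflow.
rewrite -/(factor hJ (th s) hthat q) => H.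
have H' : (fun h => h^-1 *: (lam (h *: 1 + s) q - lam s q)) @ (0 : R)^' --> - 2%:R * W s q * lam s q.
  apply/cvgrPdist_lt => e e0; have Ff : Filter (within [set s | 0 <= s] s^') by exact: within_filter.
  have := (cvgrPdist_lt _ _).1 H e e0; rewrite !near_withinE.
  move=> /(_ Ff) /nbhs_ballP[d /= d0 Hd].
  (* A radius at most [s] keeps the times nonnegative, where the limit in [yamabe_flow] is taken. *)
  apply/nbhs_ballP; exists (Num.min d s) => /=; first by rewrite lt_min d0 s0.
  move=> h; rewrite /ball /= sub0r normrN lt_min => /andP[hd hs] h0.
  have hE : h *: 1 = h :> R by exact: mulr1.
  have := Hd (h + s); rewrite /ball /= opprD addrCA subrr addr0 normrN => /(_ hd).
  rewrite -subr_eq0 addrK => /(_ h0); rewrite hE; apply.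
  by move: hs; rewrite ltr_norml => /andP[+ _]; lra.
have dl : is_derive s 1 (fun s => lam s q) (- 2%:R * W s q * lam s q).
  by apply: DeriveDef; [apply/cvg_ex; eexists; exact: H'|exact: cvg_lim H'].
have n0 : lam s q != 0 by rewrite gt_eqF.
apply: (is_derive_eq (is_deriveV n0 dl)); rewrite /GRing.scale /=; field; exact: n0.
Qed.

Hypothesis hM : closed_manifold M.
Hypothesis hsph : spherical xi J.
Hypothesis hWpos : forall q, 0 < What q.
Variable p : M.
Local Notation c2 := (inv2 hJ hthat What p).
Local Notation d6 := (inv6 hJ hthat What p).

(* The level set of the two locally constant invariants; it is open and closed. *)
Definition comp_set : set M :=
  [set q | inv2 hJ hthat What q = c2 /\ inv6 hJ hthat What q = d6].
Local Notation K := comp_set.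

Lemma comp_set_near q : K q -> \forall z \near q, K z.
Proof.
move=> [e1 e2]; apply: filterS (inv_locally_constant hJ hthat htors hWhat q hsph).
by move=> z [f1 f2]; split; rewrite ?f1 ?f2.
Qed.

Lemma comp_set_compact : compact K.
Proof.
apply: (subclosed_compact _ hM (@subsetT _ _)); rewrite -openC openE => q nKq.
apply: filterS (inv_locally_constant hJ hthat htors hWhat q hsph) => z [f1 f2] [e1 e2].
by apply: nKq; split; rewrite -?f1 -?f2.
Qed.

Lemma What_cont q : {for q, continuous What}.
Proof. exact: smooth_at_continuous (W_smooth hJ hthat hWhat q). Qed.

(** At the extremes [m], [w] of W_hat on K the gradient vanishes, so both are roots of the cubic;
    subtracting the two equations and dividing by m - w gives 3 c = m^2 + m w + w^2. The condition
    [k < 2 * l] is positivity of the minimum. *)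
Lemma comp_set_extremes : exists k l, [/\ 0 < l, l <= k & k < 2 * l] /\
  [/\ exc k l = c2, exd k l = d6,
    forall q, K q -> (2 * l - k) / 3 <= What q <= (2 * k - l) / 3,
    exists2 q, K q & What q = (2 * k - l) / 3
   & exists2 q, K q & What q = (2 * l - k) / 3].
Proof.
have K0 : K !=set0 by exists p.
have wc : cont_on K What by apply: cont_on_continuous => q _; exact: What_cont.
have wc' : cont_on K (fun q => - What q).
  by apply: cont_on_continuous => q _; apply: cvgN; exact: What_cont.
have [a Ka am] := cont_on_max K0 comp_set_compact wc.
have [b Kb bm] := cont_on_max K0 comp_set_compact wc'.
have bm' q : K q -> What b <= What q by move=> /bm; rewrite lerN2.
have [g1 l1] : Grad2 hJ hthat What a = 0 /\ Lap hJ hthat What a <= 0.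
  apply: (local_max_lap hJ hthat htors hWhat (W_smooth hJ hthat hWhat a)).
  by apply: filterS (comp_set_near Ka) => z; exact: am.
have [g2 l2] : Grad2 hJ hthat What b = 0 /\ 0 <= Lap hJ hthat What b.
  apply: (local_min_lap hJ hthat htors hWhat (W_smooth hJ hthat hWhat b)).
  by apply: filterS (comp_set_near Kb) => z; exact: bm'.
have [a2 a6] := Ka; have [b2 b6] := Kb.
rewrite /inv6 a2 g1 in a6; rewrite /inv6 b2 g2 in b6.
have ba := bm' a Ka; have b0 := hWpos b.
move: a2 b2 a6 b6; set c := c2; set d := d6; rewrite /inv2.
set la := Lap _ _ _ a in l1 *; set lb := Lap _ _ _ b in l2 *.
set m := What a in ba *; set w := What b in ba b0 * => a2 b2 a6 b6.
have {}a6 : 6 * 0 - 3 * c * m + m ^+ 3 = d by exact: a6.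
have {}b6 : 6 * 0 - 3 * c * w + w ^+ 3 = d by exact: b6.
have cE : 3 * c = m ^+ 2 + m * w + w ^+ 2.
  (* For constant curvature on K the division is impossible; instead the signs of the sublaplacian
     at a maximum and at a minimum give c <= m^2 and c >= w^2. *)
  have [mw|mw] := eqVneq m w.
    have : c = m ^+ 2 by apply/eqP; rewrite eq_le; apply/andP; split; [lra|rewrite mw; lra].
    by move=> ->; rewrite -mw; ring.
  have : (m - w) * (m ^+ 2 + m * w + w ^+ 2 - 3 * c) = 0.
    by apply: (lc2 (c := -1) a6 b6); ring.
  move/eqP; rewrite mulf_eq0 !subr_eq0 (negPf mw) /= => /eqP ->.
  by [].
exists (2 * m + w), (m + 2 * w); split; first by split; lra.
split.
- by rewrite /exc; apply: (lc1 (congr1 (fun x => - (1 / 3) * x) cE)); field.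
- have -> : d = 0 - 3 * c * m + m ^+ 3 by rewrite -a6 mulr0.
  by rewrite /exd cE; field.
- by move=> q Kq; have := am q Kq; have := bm' q Kq; rewrite -/m -/w => h1 h2; apply/andP; split; lra.
- by exists a => //; rewrite -/m; field.
- by exists b => //; rewrite -/w; field.
Qed.

Section Explicit.
Variables k l : R.
Hypotheses (l0 : 0 < l) (lk : l <= k) (k2l : k < 2 * l).
Hypotheses (cE : exc k l = c2) (dE : exd k l = d6).
Variable tau : R -> R.
Hypothesis tau0 : tau (k * l) = 0.
Hypothesis dtau : forall s, k * l <= s -> is_derive s 1 tau (exrate k l s).
Variables (t s1 : R).
Hypothesis tt : (t%:E < tmax)%E.
Hypothesis ks1 : k * l <= s1.
Hypothesis taut : forall s, k * l <= s <= s1 -> 0 <= tau s <= t.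
Hypothesis taupos : forall s, k * l < s -> 0 < tau s.
Let kl0 : 0 < k * l. Proof. by apply: mulr_gt0 => //; exact: lt_le_trans lk. Qed.
Local Notation D := (`[k * l, s1]%classic `*` K).
Local Notation ut s q := (exa k l s + exb k l s * What q).

Let der_cont (f : R -> R) (x y : R) : is_derive x 1 f y -> {for x, continuous f}.
Proof. by case=> df _; apply: differentiable_continuous; apply/derivable1_diffP. Qed.

Lemma exrate_cont s : 0 < s -> {for s, continuous (exrate k l)}.
Proof.
move=> s0; have S0 := exS_gt0 k l s0.
apply: cvgM; first exact: cvg_cst.
apply: cvgV; first by rewrite !mulf_neq0 // gt_eqF.
apply: cvgM; last exact: (der_cont (is_derive_exS k l s0)).
by apply: cvgM; [exact: cvg_cst|exact: cvg_id].
Qed.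

Let ct1 (h : R -> R) : (forall s, 0 < s -> {for s, continuous h}) ->
  cont_on D (fun z => h z.1).
Proof.
move=> hc; apply: cont_on_continuous => z [/= + _]; rewrite in_itv /= => /andP[z1 _].
apply: (@continuous_comp _ _ _ fst h); first exact: cvg_fst.
by apply: hc; exact: lt_le_trans z1.
Qed.

Let ct2 : cont_on D (fun z => What z.2).
Proof.
apply: cont_on_continuous => z _.
by apply: (@continuous_comp _ _ _ snd What); [exact: cvg_snd|exact: What_cont].
Qed.

Let ctu : cont_on D (fun z => u (tau z.1) z.2).
Proof.
move=> z Dz; have [/= + _] := Dz; rewrite in_itv /= => z1.
have /andP[t0 t1] := taut z1.
apply: cvgV; first by rewrite gt_eqF // flow_factor_gt0 // (le_lt_trans _ tt) ?lee_fin.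
have Dz' : (`[0, t]%classic `*` [set: M]) (tau z.1, z.2) by split=> //=; rewrite in_itv /= t0.
have H := flow_factor_cont tt Dz'.
have g : (fun z' : R * M => (tau z'.1, z'.2)) z' @[z' --> z] --> (tau z.1, z.2).
  have g1 : tau z'.1 @[z' --> z] --> tau z.1.
    apply: (@continuous_comp _ _ _ fst tau); first exact: cvg_fst.
    by apply: der_cont (dtau _); case/andP: z1.
  have g2 : z'.2 @[z' --> z] --> z.2 by exact: cvg_snd.
  exact: (cvg_pair g1 g2).
move=> A nA.
have nB : \forall z' \near (tau z.1, z.2), (`[0, t]%classic `*` [set: M]) z' ->
  A (lam z'.1 z'.2) by exact: (H A nA).
suff : \forall z' \near z, D z' -> A (lam (tau z'.1) z'.2) by exact.
refine (@filterS _ _ (nbhs_filter z) _ _ _ (g _ nB)) => z' h [/= + _].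
rewrite in_itv /= => z'1; by apply: h; split=> //=; rewrite in_itv /=; exact: taut.
Qed.

Lemma flow_explicit s q : k * l <= s <= s1 -> K q -> u (tau s) q = ut s q.
Proof.
(* The coefficient of the difference of the two solutions in identity [E] below, multiplied by 2
   [exrate]. *)
pose C s q := exrate k l s * 2 * ((u (tau s) q + ut s q) * What q
  + 2 * exb k l s * (c2 - What q * What q)).
have ctt : cont_on D (fun z => ut z.1 z.2).
  move=> z Dz; apply: cvgD.
    by apply: (ct1 (h := exa k l)) => // s' s0; apply: der_cont (is_derive_exa l0 lk s0).
  apply: cvgM; last exact: ct2.
  by apply: (ct1 (h := exb k l)) => // s' s0; apply: der_cont (is_derive_exb l0 lk s0).
have ctC : cont_on D (fun z => C z.1 z.2).
  move=> z Dz; apply: cvgM.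
    by apply: cvgM; [apply: (ct1 (h := exrate k l)) => //; exact: exrate_cont|exact: cvg_cst].
  apply: cvgD; first by apply: cvgM; [apply: cvgD; [exact: ctu|exact: ctt]|exact: ct2].
  apply: cvgM.
    apply: cvgM; first exact: cvg_cst.
    by apply: (ct1 (h := exb k l)) => // s' s0; apply: der_cont (is_derive_exb l0 lk s0).
  by apply: cvgB; [exact: cvg_cst|apply: cvgM; exact: ct2].
(* The two signs run the maximum principle on the difference and on its negative. *)
suff main eps : eps = 1 \/ eps = -1 -> forall s q, k * l <= s <= s1 -> K q ->
    eps * (u (tau s) q - ut s q) <= 0.
  move=> sI Kq; have := main 1 (or_introl erefl) s q sI Kq.
  have := main (-1) (or_intror erefl) s q sI Kq.
  by move=> h1 h2; apply/eqP; rewrite eq_le; apply/andP; split; lra.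
move=> epsE; apply: (max_principle comp_set_compact _ ctC).
- by move=> z Dz; apply: cvgM; [exact: cvg_cst|apply: cvgB; [exact: ctu|exact: ctt]].
- move=> q' Kq'; have [-> ->] := ex_start l0 lk.
  rewrite tau0 flow_factor0 ?invr1 ?mul0r ?addr0 ?subrr ?mulr0 //.
  apply: le_lt_trans tt; rewrite lee_fin.
  have k1 : k * l <= k * l <= s1 by rewrite lexx.
  by have := taut k1; rewrite tau0 => /andP[].
- move=> s' q' /andP[ks s's1] Kq' _ vmax.
  have s0 : 0 < s' by exact: lt_trans ks.
  have sI : k * l <= s' <= s1 by rewrite ltW.
  have T0 := taupos ks; have /andP[_ T1] := taut sI.
  have Tm : ((tau s')%:E < tmax)%E by apply: le_lt_trans tt; rewrite lee_fin.
  have du := is_derive1_comp (flow_u_derive q' T0 Tm) (dtau (ltW ks)).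
  have da := is_derive_exa l0 lk s0; have db := is_derive_exb l0 lk s0.
  set r := exrate k l s' in du da db.
  have r0 : 0 < r by rewrite /r /exrate divr_gt0 // !mulr_gt0 // exS_gt0.
  pose be := mob_b (exa k l s') (exb k l s') (exc k l).
  pose ga := mob_g (exa k l s') (exb k l s') (exc k l) (exd k l).
  exists (eps * (r * (2 * (u (tau s') q' * W (tau s') q' - (be * What q' + ga))))).
    have H := is_deriveZ eps (is_deriveB du (is_deriveD da (is_deriveM db (is_derive_cst (What q') s' 1)))).
    apply: (is_derive_eq H); rewrite /GRing.scale /= /GRing.scale /= -/be -/ga; ring.
  pose v z := u (tau s') z - (exa k l s' + exb k l s' * What z).
  have uS : smooth_at q' (fun z => u (tau s') z).
    exact: (factor_smooth hJ hthat htors (flow_pos (ltW T0) Tm) hWhat).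
  have vS : smooth_at q' v.
    apply: smooth_atD => //; apply: smooth_atN; apply: smooth_atD; first exact: smooth_at_cst.
    by apply: smooth_atM; [exact: smooth_at_cst|exact: (W_smooth hJ hthat hWhat)].
  have nv : \forall z \near q', eps * v z <= eps * v q'.
    by apply: filterS (comp_set_near Kq') => z; exact: vmax.
  have [Gv Lv] : Grad2 hJ hthat v q' = 0 /\ eps * Lap hJ hthat v q' <= 0.
    case: epsE nv => -> nv.
      rewrite mul1r; apply: (local_max_lap hJ hthat htors hWhat vS).
      by apply: filterS nv => z; rewrite !mul1r.
    rewrite mulN1r oppr_le0; apply: (local_min_lap hJ hthat htors hWhat vS).
    by apply: filterS nv => z; rewrite !mulN1r lerN2.
  have [LE GE] := Lap_sub_affine hJ hthat htors hWhat (exa k l s') (exb k l s') uS.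
  have {}GE := GE Gv; rewrite -/(v) in LE.
  have FW := factor_W hJ hthat htors (flow_pos (ltW T0) Tm) hWhat (flow_W (ltW T0) Tm) q'.
  have [j2 j6] := Kq'.
  have i2 : Lap hJ hthat What q' + What q' ^+ 2 = c2 by exact: j2.
  have i6 : 6 * Grad2 hJ hthat What q' - 3 * c2 * What q' + What q' ^+ 3 = d6.
    by rewrite -j6 -j2.
  have u0 : 0 < u (tau s') q' by rewrite invr_gt0 flow_factor_gt0 // ltW.
  rewrite /C -/r; rewrite /v in Lv LE.
  move: FW LE GE i2 i6 Lv u0; rewrite /be /ga cE dE.
  set U := u (tau s') q'; set LU := Lap _ _ (fun z => u (tau s') z) q'.
  set LV := Lap _ _ (fun z => _ - _) q'; set GU := Grad2 _ _ (fun z => u (tau s') z) q'.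
  set Gw := Grad2 _ _ What q'; set Lw := Lap _ _ What q'.
  move: (exa k l s') (exb k l s') (What q') c2 d6 (W (tau s') q') => a b w c d w'.
  move=> FW LE GE i2 i6 Lv u0.
  (* At a spatial extremum of the difference v the gradient terms agree up to the factor b^2, so
     subtracting the two equations leaves 2 U Lap v plus a multiple of v. The first term has the
     right sign there, since U > 0. *)
  have E : U * w' - (mob_b a b c * w + mob_g a b c d) =
      2 * U * LV + (U - (a + b * w)) * ((U + (a + b * w)) * w + 2 * b * (c - w * w)).
    rewrite FW GE (_ : LU = LV + b * Lw); last by rewrite LE; ring.
    rewrite (_ : Lw = c - w ^+ 2); last by rewrite -i2; ring.
    rewrite -i6 -i2 /mob_b /mob_g; ring.
  rewrite E; have h : 0 <= r * (4 * U) * - (eps * LV).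
    apply: mulr_ge0; last by rewrite oppr_ge0.
    by apply: mulr_ge0; [exact: ltW|lra].
  rewrite -subr_ge0; move: h; congr (0 <= _); ring.
Qed.

End Explicit.

(** * The inequality minimized over Legendrian directions *)

Section Harnack.
Variables (t : R) (t0 : 0 < t) (tt : (t%:E < tmax)%E).
Variables (F : frame M) (uF : unitary_frame xi J (th t) F) (Fp : fdom F p).
Local Notation Wc := (fun q => (W t q)%:C%C : C).

Lemma flow_harnack_gradient : exists l2 g2 : R,
  [/\ 0 < W t p, sublaplacian F Wc p = l2%:C%C, d1 F Wc p * d1b F Wc p = g2%:C%C
    & 0 <= 2 * l2 + W t p ^+ 2 + W t p / t - 4 * g2 / W t p].
Proof.
have [k [l [[l0 lk k2l] [cE dE wI [qm Km wm] [qn Kn wn]]]]] := comp_set_extremes.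
have k0 : 0 < k by exact: lt_le_trans lk.
have kl0 : 0 < k * l by exact: mulr_gt0.
have kl2 : k * l / 2 < k * l by lra.
have ratec s : k * l / 2 < s -> {for s, continuous (exrate k l)}.
  by move=> ks; apply: exrate_cont => //; apply: lt_trans ks; lra.
have [tau [tau0 dtau]] := antiderivative kl2 ratec.
have rate0 s : k * l <= s -> 0 < exrate k l s.
  move=> ks; have s0 : 0 < s by exact: lt_le_trans ks.
  by rewrite /exrate divr_gt0 // !mulr_gt0 // exS_gt0.
have tauc a b : k * l <= a -> {within `[a, b], continuous tau}.
  move=> ka; apply: continuous_in_subspaceT => s; rewrite inE /= in_itv /= => /andP[as_ _].
  by have [df _] := dtau s (le_trans ka as_); apply: differentiable_continuous; apply/derivable1_diffP.
have mvt a b : k * l <= a -> a < b -> exists2 c, a < c < b & tau b - tau a = exrate k l c * (b - a).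
  move=> ka ab; have [] := MVT ab (df := exrate k l) (f := tau) _ (tauc a b ka).
    by move=> x; rewrite in_itv /= => /andP[ax _]; apply: dtau; apply: le_trans ka (ltW ax).
  by move=> c; rewrite in_itv /= => cI e; exists c.
have taulo a b : k * l <= a -> a < b -> tau a < tau b.
  move=> ka ab; have [c /andP[ac _] e] := mvt a b ka ab.
  by rewrite -subr_gt0 e mulr_gt0 ?subr_gt0 // rate0 // (le_trans ka) // ltW.
have taule a b : k * l <= a -> a <= b -> tau a <= tau b.
  by move=> ka; rewrite le_eqVlt => /orP[/eqP -> //|ab]; apply: ltW; exact: taulo.
have taupos s : k * l < s -> 0 < tau s by move=> ks; rewrite -tau0; exact: taulo.
have expl s1 : k * l <= s1 -> tau s1 <= t -> forall s q, k * l <= s <= s1 -> K q ->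
    u (tau s) q = exa k l s + exb k l s * What q.
  move=> ks1 ts1; apply: (flow_explicit l0 lk cE dE tau0 dtau tt) => //.
  move=> s /andP[ks ss1]; rewrite -{1}tau0 taule //=.
  by apply: le_trans (taule _ _ ks ss1) ts1.
have [s /andP[ks ss1] ts] : exists2 s, k * l <= s <= s & tau s = t.
  have cD : compact (`[0, t]%classic `*` K).
    by apply: compact_setX; [exact: segment_compact|exact: comp_set_compact].
  have D0 : (`[0, t]%classic `*` K) !=set0.
    by exists (0, p); split=> //=; rewrite in_itv /= lexx ltW.
  have cu : cont_on (`[0, t]%classic `*` K) (fun z : R * M => u z.1 z.2).
    move=> z [z1 z2]; have z1' := z1; rewrite /= in_itv /= in z1'; case/andP: z1' => z0 zt.
    apply: cvgV; first by rewrite gt_eqF // flow_factor_gt0 // (le_lt_trans _ tt) ?lee_fin.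
    have := flow_factor_cont tt (conj z1 I : (`[0, t]%classic `*` [set: M]) z).
    apply: cvg_trans; apply: cvg_app; apply: within_subset.
    by move=> z' [? _]; split.
  have [z Dz zm] := cont_on_max D0 cD cu.
  pose B := u z.1 z.2.
  have B1 q : K q -> u 0 q <= B.
    by move=> Kq; apply: (zm (0, q)); split=> //=; rewrite in_itv /= lexx ltW.
  have BB : 1 <= B.
    have := B1 p (conj erefl erefl); rewrite flow_factor0 ?invr1 //.
    by apply: lt_trans tt; rewrite lte_fin.
  (* Chosen so that, were [tau s1 <= t], the values of u at the two extremes of W_hat would have
     product s1 / (k l) = B^2 + 1, although both are at most [B]. *)
  pose s1 := k * l * (B ^+ 2 + 1).
  have ks1 : k * l <= s1 by rewrite ler_peMr ?lerDr ?sqr_ge0 // ltW.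
  have ts1 : t < tau s1.
    rewrite ltNge; apply/negP => ts1.
    have s1I : k * l <= s1 <= s1 by rewrite ks1 lexx.
    have T1 : 0 <= tau s1 by rewrite -tau0; exact: taule.
    have em := expl s1 ks1 ts1 s1 qm s1I Km; have en := expl s1 ks1 ts1 s1 qn s1I Kn.
    rewrite wm (ex_ends k l s1).1 in em; rewrite wn (ex_ends k l s1).2 in en.
    have s10 : 0 < s1 by exact: lt_le_trans ks1.
    have [_ A0 B0] := ex_pos l0 lk s10; have [_ sE] := ex_prod l0 lk s10.
    have bm : u (tau s1) qm <= B by apply: (zm (tau s1, qm)); split=> //=; rewrite in_itv /= T1.
    have bn : u (tau s1) qn <= B by apply: (zm (tau s1, qn)); split=> //=; rewrite in_itv /= T1.
    rewrite em in bm; rewrite en in bn.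
    have : (exq k l s1 + k * exb k l s1) * (exq k l s1 + l * exb k l s1) <= B * B.
      by apply: ler_pM => //; exact: ltW.
    rewrite -(ler_pM2l kl0) leNgt => /negP; apply.
    rewrite [ltRHS](_ : _ = s1); last by rewrite -[RHS]sE; ring.
    by rewrite /s1 ltr_pM2l // -expr2 ltrDl.
  have [|s] := @IVT _ tau (k * l) s1 t ks1 (tauc _ _ (lexx _)).
    by rewrite tau0 ge_min (ltW t0) le_max (ltW ts1) orbT.
  by rewrite in_itv /= => /andP[h1 h2] h3; exists s => //; rewrite h1 lexx.
have s0 : 0 < s by exact: lt_le_trans ks.
have aff : \forall z \near p, u t z = exa k l s + exb k l s * What z.
  have Kp : K p by [].
  apply: filterS (comp_set_near Kp) => z Kz; rewrite -{1}ts; apply: (expl s) => //.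
    by rewrite ts.
  by rewrite ks lexx.
have inv : \forall z \near p, inv2 hJ hthat What z = exc k l /\ inv6 hJ hthat What z = exd k l.
  by rewrite cE dE; apply: comp_set_near.
have [E1 E2 E3] := affine_curvature htors (flow_pos (ltW t0) tt) hWhat (flow_W (ltW t0) tt)
  uF Fp inv aff (ex_k1 l0 lk s0).
(* By the mean value theorem t = exrate(c) (s - k l) with k l < c < s. The left-hand side is then
   3/2 times two factors in [0, 1]: (k - l) k l / (c S(c)), bounded by [exS_gtD] since k l = c q(c),
   and (s - k l) / s. *)
have tD : t * ((k - l) * exq k l s) <= 3 / 2.
  have [e|ne] := eqVneq (k * l) s.
    by move: t0; rewrite -ts -e tau0 ltxx.
  have ks' : k * l < s by rewrite lt_neqAle ne.
  have [c /andP[kc cs] e] := mvt _ _ (lexx _) ks'; rewrite tau0 subr0 ts in e.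
  have c0 : 0 < c by exact: lt_trans kc.
  have S0 := exS_gt0 k l c0; have D0 := exS_gtD l0 lk c0.
  have h1 : (k - l) * (k * l) <= c * exS k l c.
    have -> : (k - l) * (k * l) = c * ((k - l) * exq k l c).
      by rewrite /exq; field; rewrite gt_eqF.
    by rewrite ler_pM2l // ltW.
  have h2 : t * ((k - l) * exq k l s) = 3 / 2 * ((k - l) * (k * l) / (c * exS k l c)) * ((s - k * l) / s).
    by rewrite e /exrate /exq; field; rewrite !gt_eqF.
  rewrite h2 -mulrA ler_piMr ?divr_ge0 // mulr_ile1 //.
  - by rewrite divr_ge0 // mulr_ge0 ?subr_ge0 // ltW // mulr_gt0.
  - by rewrite divr_ge0 ?subr_ge0 // ltW.
  - by rewrite ler_pdivrMr ?mul1r // mulr_gt0.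
  - by rewrite ler_pdivrMr // mul1r; lra.
have [W0 H] := ex_harnack l0 lk k2l ks t0 tD (wI p (conj erefl erefl)) E1.
set cc := mob_c _ _ _ _ in E2 E3; set dd := mob_d _ _ _ _ in E3 H.
exists (cc - W t p ^+ 2), ((dd + 3 * cc * W t p - W t p ^+ 3) / 6); split=> //.
  have n6 : (6 : C) != 0 by rewrite pnatr_eq0.
  by apply: (mulfI n6); rewrite E3 -(rc_nat 6) -rcM; congr (_ %:C%C); field.
(* With l2 = cc - W^2 and 6 g2 = dd + 3 cc W - W^3, the invariant [cc] cancels. *)
rewrite [leRHS](_ : _ = W t p / t - W t p ^+ 2 / 3 - 2 * dd / (3 * W t p)) //.
by field; rewrite !gt_eqF.
Qed.

End Harnack.
End Flow.

Theorem theoremA (R : realType) (M : manifold3 R)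
  (xi : M -> tvec M -> Prop) (J : M -> tvec M -> tvec M)
  (hM : closed_manifold M)
  (hxi : contact_structure xi) (hJ : cr_structure xi J)
  (hsph : spherical xi J)
  (that : form1 M) (What : M -> R)
  (hthat : positive_pseudohermitian xi J that)
  (htors : vanishing_torsion xi J that)
  (hWhat : webster_curvature xi J that What)
  (hWpos : forall p, 0 < What p)
  (tmax : \bar R) (htmax : (0 < tmax)%E)
  (th : R -> form1 M) (W : R -> M -> R)
  (hflow : yamabe_flow xi J tmax th W)
  (hinit : forall p v, tangent p v -> th 0 p v = that p v)
  (t : R) (ht0 : 0 < t) (htm : (t%:E < tmax)%E)
  (eta : M -> tvec M) (heta : legendrian xi eta)
  (p : M) (F : frame M) (hF : unitary_frame xi J (th t) F) (hp : fdom F p) :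
  0 <= harnack F (W t) t eta p.
Proof.
have [l2 [g2 [W0 L2 G2 H]]] := flow_harnack_gradient hJ hthat htors hWhat hflow hinit hM
  hsph hWpos ht0 htm hF hp.
have post := flow_pos hflow (ltW ht0) htm.
have ad := un_ad hF (@subset_refl _ (fdom F)).
set Wc := (fun q : M => (W t q)%:C%C : R[i]) in L2 G2.
have tZ := ad_tZ ad hp; have tb := ad_tZb ad hp.
have [h1 h2 h3] := ad_1 ad hp; have [g1 g2' g3] := ad_1b ad hp.
have lt1 := ad_th1l ad hp; have ltb := ad_th1bl ad hp.
have d1bE : d1b F Wc p = (d1 F Wc p)^*.
  rewrite /d1b /d1 /fconj /vconj; congr ((_ _)^*).
  by apply/funext => q; apply: eqC => /=; ring.
have [[te re] _] := (xi_kernel post.1 p (eta p)).1 (heta.2 p).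
have sgE : subgradient F Wc p = lcomb (d1b F Wc p) (Z1 F p)
    (fun f => d1 F Wc p * fconj (Z1 F) p f) by [].
have tib : tangent p (fun f => d1 F Wc p * fconj (Z1 F) p f).
  have := tangent_lcomb (d1 F Wc p) tb (tangent0 p); congr tangent.
  by apply/funext => f; rewrite /lcomb addr0.
have s1 : th1 F p (subgradient F Wc p) = d1b F Wc p.
  by rewrite sgE lt1 // (linZ _ lt1 tb) h2 h3; ring.
have s2 : conj1 (th1 F) p (subgradient F Wc p) = d1 F Wc p.
  by rewrite sgE ltb // (linZ _ ltb tb) g2' g3; ring.
have eb : conj1 (th1 F) p (eta p) = (th1 F p (eta p))^* by rewrite /conj1 re.
rewrite /harnack -/Wc L2 /levi_form s1 s2 eb d1bE; rewrite d1bE in G2.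
move: G2; case: (d1 F Wc p) => x y G2; case: (th1 F p (eta p)) => a b.
have G : x ^+ 2 + y ^+ 2 = g2 by move/(congr1 (@complex.Re R)): G2 => /= <-; ring.
rewrite [leRHS](_ : _ = (2 * l2 + W t p ^+ 2 + W t p / t + 2 * (x * a - y * b)
   + W t p / 4 * (a ^+ 2 + b ^+ 2))%:C%C).
  rewrite -[0]/(0%:C%C) lecR.
  (* Completing the square in the components a, b of eta: the minimum is at a = - 4 x / W, b = 4 y /
     W, and it costs 4 |Z W|^2 / W. *)
  rewrite [leRHS](_ : _ = (2 * l2 + W t p ^+ 2 + W t p / t - 4 * g2 / W t p)
    + W t p / 4 * ((a + 4 * x / W t p) ^+ 2 + (b - 4 * y / W t p) ^+ 2)).
    by rewrite addr_ge0 // mulr_ge0 ?addr_ge0 ?sqr_ge0 // divr_ge0 // ltW.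
  by rewrite -G; field; rewrite !gt_eqF.
have tE : (t%:C%C)^-1 = (t^-1)%:C%C :> R[i] by rewrite [RHS]rmorphV // unitfE gt_eqF.
have eE : (8%:R)^-1 = (8^-1)%:C%C :> R[i] 
  by rewrite [RHS]rmorphV ?unitfE ?pnatr_eq0 //; congr (_^-1); exact: esym (rc_nat 8).
rewrite tE eE -[2%:R](rc_nat 2) /Wc -!rcE.
by apply: eqC => /=; field; rewrite ?gt_eqF.
Qed.
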